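(* Let $f:\mathbb{R}_{>0}\to\mathbb{R}_{>0}$ be a decreasing function and let $\sigma\in\mathbb{R}$ with $-1\leqslant\sigma\leqslant 1$. Then every ovaloid in Euclidean space $\mathbb{E}^3$ whose support function $\rho$, mean curvature $H$ and Gaussian curvature $K$ satisfy $$\rho=f\big(H^{\sigma}\,(\sqrt{K})^{1-\sigma}\big)$$ at every point is a sphere.
   Context: An ovaloid is a smooth compact connected surface without boundary embedded in $\mathbb{E}^3$ with everywhere positive Gaussian curvature $K$. Its unit normal $N$ is the inward one (pointing into the half-space bounded by the tangent plane that contains the surface). The shape operator is $A(V)=-D_VN$, with $D$ the standard flat connection, $H=\frac12\mathrm{trace}(A)$ (so $H>0$) and $K=\det A$. $P$ is the position vector field along the surface with respect to a fixed origin of $\mathbb{E}^3$, and the support function is $\rho=\langle P,-N\rangle$. ''Decreasing'' is understood in the weak sense: $s<t$ implies $f(s)\geqslant f(t)$. *)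

(* Defs.v *)
From HB Require Import structures.
From mathcomp Require Export all_boot all_order all_algebra.
From mathcomp Require Export all_classical all_reals all_analysis.

Set Implicit Arguments.
Unset Strict Implicit.
Unset Printing Implicit Defensive.

Import Order.TTheory GRing.Theory Num.Theory.
Import numFieldNormedType.Exports.

Local Open Scope classical_set_scope.
Local Open Scope ring_scope.

(* Points and vectors of E^3 are row vectors, and the fixed origin is 0.  The  *)
(* library norm on 'rV[R]_3 is the sup norm: it only supplies the topology,    *)
(* and all metric notions go through dot.                                      *)
Definition dot (R : realType) n (u v : 'rV[R]_n) : R := \sum_i u 0 i * v 0 i.

(* f is C^k at the points of the open set U *)
Fixpoint C_k (R : realType) m n (k : nat) (U : set 'rV[R]_m.+1)
    (f : 'rV[R]_m.+1 -> 'rV[R]_n.+1) : Prop :=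
  match k with
  | 0%N => forall u, U u -> {for u, continuous f}
  | k'.+1 => (forall u, U u -> differentiable f u) /\
             (forall v, C_k k' U (fun u => 'D_v f u))
  end.

Definition smooth_on (R : realType) m n (U : set 'rV[R]_m.+1)
    (f : 'rV[R]_m.+1 -> 'rV[R]_n.+1) : Prop := forall k, C_k k U f.

Section Surfaces.
Variable R : realType.
Implicit Types (S : set 'rV[R]_3) (p q n : 'rV[R]_3).
Implicit Types (N : 'rV[R]_3 -> 'rV[R]_3) (x : 'rV[R]_2 -> 'rV[R]_3).

(* x is a regular parametrization of S around p = x 0: on an open U containing *)
(* 0 it is a smooth immersion and a homeomorphism onto S `&` W, W open.  Only  *)
(* the values of x on U matter.                                                *)
Definition local_parametrization S p x : Prop :=
  x 0 = p /\
  exists (U : set 'rV[R]_2) (W : set 'rV[R]_3) (y : 'rV[R]_3 -> 'rV[R]_2),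
    [/\ open U, U 0 & open W] /\
    [/\ smooth_on U x,
        forall u, U u -> row_free ('J x u),
        x @` U = S `&` W,
        forall u, U u -> y (x u) = u &
        {within S `&` W, continuous y}].

(* smooth surface without boundary embedded in E^3 *)
Definition embedded_surface S : Prop :=
  forall p, S p -> exists x, local_parametrization S p x.

Definition chart S p : 'rV[R]_2 -> 'rV[R]_3 :=
  xget (fun=> 0) [set x | local_parametrization S p x].

(* The rows are the coordinate basis of the tangent plane at p, because        *)
(* 'd x u v = v *m 'J x u.                                                     *)
Definition tangent_basis S p : 'M[R]_(2, 3) := 'J (chart S p) 0.

Definition unit_normal S p n : Prop :=
  dot n n = 1 /\ (forall v, (v <= tangent_basis S p)%MS -> dot v n = 0).

(* Matrix of the shape operator A(V) = - D_V N at p, acting on row vectors of  *)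
(* coordinates in tangent_basis S p.  The rows of 'J (N \o chart S p) 0 are    *)
(* the derivatives of N along the rows of tangent_basis S p; they are tangent  *)
(* when N is a unit normal field, and right multiplication by pinvmx returns   *)
(* their coordinates.  Trace and determinant do not depend on the chart.       *)
Definition shape_operator S N p : 'M[R]_2 :=
  - ('J (N \o chart S p) 0 *m pinvmx (tangent_basis S p)).

Definition mean_curvature S N p : R := 2^-1 * \tr (shape_operator S N p).

Definition gaussian_curvature S N p : R := \det (shape_operator S N p).

(* support function, with the origin 0: the position vector of p is p itself   *)
Definition support S N p : R := dot p (- N p).

(* N is a smooth unit normal field on a neighbourhood of p in S, extended to a *)
(* smooth field on an open set of E^3.                                         *)
Definition local_unit_normal_field S p N : Prop :=
  exists W : set 'rV[R]_3,
    [/\ open W, W p, smooth_on W N &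
        forall q, S q -> W q -> unit_normal S q (N q)].

(* A local field is enough to state K > 0, as K = \det A is the same for N and *)
(* - N (dimension 2).  Neither a global orientation nor convexity of S is      *)
(* assumed.                                                                    *)
Definition ovaloid S : Prop :=
  [/\ embedded_surface S, S !=set0, compact S, connected S &
      forall p, S p -> exists2 N, local_unit_normal_field S p N &
                                  0 < gaussian_curvature S N p].

(* The inward unit normal: it points into the half-space that is bounded by    *)
(* the tangent plane at p and contains S.  Its existence on an ovaloid is      *)
(* Hadamard's theorem, which is not built in here: the value is 0 where no     *)
(* such vector exists.                                                         *)
Definition inward_normal S p : 'rV[R]_3 :=
  xget 0 [set n | unit_normal S p n /\ forall q, S q -> 0 <= dot (q - p) n].

Definition is_sphere S : Prop :=
  exists (c : 'rV[R]_3) (r : R),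
    0 < r /\ S = [set q | dot (q - c) (q - c) = r ^+ 2].

End Surfaces.

(* Main.v *)
(* Let psi = H^sigma sqrt(K)^(1 - sigma).  As K <= H^2 and -1 <= sigma <= 1, psi <= H
   and K <= psi H.

   Let q y be the point of S where <., y> is maximal.  It is homogeneous of degree 0
   on E^3 minus the origin and is the gradient of the support function h, which has
   degree 1.  With Q the Hessian of h, T = tr Q - Q (which is divergence free) and
   W = |y|^3 grad (h / |y|), the field Z = W - psi T W is tangent to the spheres
   centred at 0, and on the unit sphere, where E = 1 / K and rho = h,
     div Z = 2 E ((H - psi) + rho (psi H - K)) - <grad psi, T W>.
   The first two terms are nonnegative, and so is the third one: T >= 0, and psi and
   rho cannot both increase in one direction because f is decreasing.  The divergence
   of Z times a radial cutoff integrates to 0, so all terms vanish, whence H^2 = K,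
   the Hessian is umbilic, and q y - r y / |y| is constant for some r.

   Convexity of S is not assumed.  The set of points with an inward normal has an open
   relative interior, nonempty because of a farthest point of S.  Where the inward
   normal field is not differentiable, the curvatures take the value 0 and the relation
   reads support = f 0; comparing with the values of f > 0 on the interior shows that
   the interior is closed, hence all of S. *)

Require Import Defs.
From mathcomp Require Import ring lra.
Set Implicit Arguments.
Unset Strict Implicit.
Unset Printing Implicit Defensive.
Import Order.TTheory GRing.Theory Num.Theory.
Import numFieldNormedType.Exports.
Local Open Scope classical_set_scope.
Local Open Scope ring_scope.

(** * Differential calculus by coordinates *)

Section Calculus.
Variable R : realType.

(** On the unit sphere the divergences of W and T W are 2 E (H - rho K) and 2 E (1 - rho H), the
    integrands of Minkowski's two formulas carried over by the Gauss map. Subtracting psi times the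
    second from the first brings out H - psi and psi H - K. In logarithms these two gaps are (1 -
    sigma) and (1 + sigma) times ln H - ln (sqrt K), whence the range of sigma. As f may jump, the
    relation cannot be differentiated. It says only that psi / |y| and rho are never both strictly
    larger at one point than at another, so a direction in which rho is merely nondecreasing to
    first order has to be perturbed. Regularity is budgeted accordingly: q is C^2, psi and Z are
    C^1, and Z is differentiated once. Homogeneous extension to E^3 replaces integration on a
    surface by a statement about compactly supported C^1 fields, proved with Riemann sums on a cubic
    grid. The link between the Hessian and the shape operator comes from differentiating N (q y) = -
    y / |y|. *)

Lemma near_center (V : normedModType R) (x : V) (P : set V) :
  (\forall h \near (0 : V), P h) -> \forall y \near x, P (y - x).
Proof.
move=> P0; suff: (fun y => y - x) @ x --> (0 : V) by apply.
by rewrite -(subrr x); apply: cvgB; [exact: cvg_id|exact: cvg_cst].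
Qed.

Lemma near_translate (V : normedModType R) (x : V) (P : set V) :
  (\forall y \near x, P y) -> \forall h \near (0 : V), P (h + x).
Proof.
move=> Px; suff: (fun y => y + x) @ (0 : V) --> x by apply.
by rewrite -[X in _ --> X]add0r; apply: cvgD; [exact: cvg_id|exact: cvg_cst].
Qed.

Lemma diff_epsP (V W : normedModType R) (f : V -> W) x :
  differentiable f x -> forall e, 0 < e ->
  \forall y \near x, `|f y - f x - 'd f x (y - x)| <= e * `|y - x|.
Proof.
move=> /diff_locallyP [_ /eqaddoP fd] e e0; have /near_center := fd e e0.
move=> /(_ x); apply: filterS => y /=.
rewrite !fctE /= subrK opprD addrA; exact.
Qed.

Lemma diff_eps_intro (V W : normedModType R) (f : V -> W) x (df : {linear V -> W}) :
  continuous df ->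
  (forall e, 0 < e -> \forall y \near x, `|f y - f x - df (y - x)| <= e * `|y - x|) ->
  differentiable f x /\ 'd f x = df :> (V -> W).
Proof.
move=> cdf fd.
have fE : f \o shift x = cst (f x) + df +o_ 0 id.
  apply/eqaddoP => e e0; have /near_translate := fd e e0.
  apply: filterS => y /=.
  by rewrite !fctE /= addrK opprD addrA.
have dE := diff_unique cdf fE.
split=> //; apply/diff_locallyP; split; by rewrite dE.
Qed.

Local Notation "'D[ i ] f" := (fun u => 'D_(delta_mx 0 i) f u) (at level 10, i at level 0, f at next level).

Lemma jacobianE m n (f : 'rV[R]_m.+1 -> 'rV[R]_n.+1) x v :
  differentiable f x -> 'd f x v = v *m 'J f x.
Proof. by move=> df; rewrite /jacobian mul_rV_lin1. Qed.

Lemma derive_coordE n (f : 'rV[R]_n.+1 -> R) x v :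
  differentiable f x -> 'D_v f x = \sum_i v 0 i * 'D_(delta_mx 0 i) f x.
Proof.
move=> df; rewrite deriveE// [in LHS](row_sum_delta v) linear_sum /=.
by apply: eq_bigr => i _; rewrite linearZ /= deriveE.
Qed.

Lemma cvg_coordP (T : Type) (F : set_system T) m n (f : T -> 'M[R]_(m, n)) (l : 'M[R]_(m, n)) :
  Filter F ->
  (forall i j, (fun x => f x i j) @ F --> l i j) -> f @ F --> l.
Proof.
move=> FF fl; apply/cvgrPdist_le => /= e e0.
have : \forall x \near F, forall ij : 'I_m * 'I_n, `|l ij.1 ij.2 - f x ij.1 ij.2| <= e.
  apply: filter_forall => -[i j] /=.
  by move/cvgrPdist_le : (fl i j) => /(_ e e0).
apply: filterS => x fx.
rewrite [leLHS]/Num.Def.normr/= mx_normrE (bigmax_le _ (ltW e0))//= => i _.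
by rewrite !mxE.
Qed.

Lemma continuous_rVP (T : topologicalType) n (f : T -> 'rV[R]_n) x :
  (forall j, {for x, continuous (fun y => f y 0 j)}) -> {for x, continuous f}.
Proof. by move=> fc; apply: cvg_coordP => i j; rewrite !ord1; exact: fc. Qed.

Lemma coord_le_norm m n (M : 'M[R]_(m, n)) i j : `|M i j| <= `|M|.
Proof.
rewrite [leRHS]/Num.Def.normr/= mx_normrE.
exact: (le_bigmax _ (fun ij : 'I_m * 'I_n => `|M ij.1 ij.2|) (i, j)).
Qed.

Lemma norm_le_coord m n (M : 'M[R]_(m, n)) e : 0 <= e ->
  (forall i j, `|M i j| <= e) -> `|M| <= e.
Proof.
by move=> e0 Me; rewrite [leLHS]/Num.Def.normr/= mx_normrE (bigmax_le _ e0).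
Qed.

Lemma cont_add (T : topologicalType) (f g : T -> R) x :
  {for x, continuous f} -> {for x, continuous g} ->
  {for x, continuous (fun y => f y + g y)}.
Proof. exact: (@continuousD R R T f g x). Qed.

Lemma cont_mul (T : topologicalType) (f g : T -> R) x :
  {for x, continuous f} -> {for x, continuous g} ->
  {for x, continuous (fun y => f y * g y)}.
Proof. exact: (@continuousM R T f g x). Qed.

Lemma cont_opp (T : topologicalType) (f : T -> R) x :
  {for x, continuous f} -> {for x, continuous (fun y => - f y)}.
Proof. exact: (@continuousN R R T f x). Qed.

Lemma cvg_sumR (T I : Type) (F : set_system T) (r : seq I) (P : pred I)
    (f : I -> T -> R) (l : I -> R) : Filter F ->
  (forall i, P i -> f i @ F --> l i) ->
  (fun x => \sum_(i <- r | P i) f i x) @ F --> \sum_(i <- r | P i) l i.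
Proof.
move=> FF fl; elim: r => [|i r IH].
  by under eq_fun do rewrite big_nil; rewrite big_nil; exact: cvg_cst.
under eq_fun do rewrite big_cons; rewrite big_cons.
by case: ifPn => // Pi; apply: cvgD => //; exact: fl.
Qed.

Lemma cvg_coord (T : Type) (F : set_system T) m n (f : T -> 'M[R]_(m, n))
    (l : 'M[R]_(m, n)) i j : Filter F ->
  f @ F --> l -> (fun x => f x i j) @ F --> l i j.
Proof.
move=> FF /cvgrPdist_le fl; apply/cvgrPdist_le => e e0; apply: filterS (fl e e0) => x.
by apply: le_trans; have := coord_le_norm (l - f x) i j; rewrite !mxE.
Qed.

Lemma cvg_mulmx (T : Type) (F : set_system T) m n p
    (f : T -> 'M[R]_(m, n)) (g : T -> 'M[R]_(n, p)) A B : Filter F ->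
  f @ F --> (A : 'M[R]_(m, n)) -> g @ F --> (B : 'M[R]_(n, p)) ->
  (fun x => f x *m g x) @ F --> A *m B.
Proof.
move=> FF fA gB; apply: cvg_coordP => i j; rewrite mxE.
under eq_fun do rewrite mxE.
by apply: cvg_sumR => k _; apply: cvgM; exact: cvg_coord.
Qed.

Lemma mulmx_continuous m n (M : 'M[R]_(m.+1, n.+1)) :
  continuous (mulmxr M : 'rV[R]_m.+1 -> 'rV[R]_n.+1).
Proof.
by move=> x; apply: (@cvg_mulmx _ (nbhs x)); [exact: cvg_id|exact: cvg_cst].
Qed.

Lemma diff_rV_intro m n (f : 'rV[R]_m.+1 -> 'rV[R]_n.+1) x :
  (forall j, differentiable (fun y => f y 0 j) x) -> differentiable f x.
Proof.
move=> df.
pose J : 'M[R]_(m.+1, n.+1) := \matrix_(i, j) 'D_(delta_mx 0 i) (fun y => f y 0 j) x.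
apply: (proj1 (@diff_eps_intro _ _ f x (mulmxr J) _ _)).
  exact: mulmx_continuous.
move=> e e0.
have : \forall y \near x, forall j : 'I_n.+1,
   `|f y 0 j - f x 0 j - 'd (fun y => f y 0 j) x (y - x)| <= e * `|y - x|.
  apply: (@filter_forall _ 'I_n.+1 (fun (j : 'I_n.+1) y => is_true (`|f y 0 j - f x 0 j - 'd (fun y => f y 0 j) x (y - x)| <= e * `|y - x|)) (nbhs x)) => j; exact: (@diff_epsP _ _ (fun y => f y 0 j) x (df j) e e0).
apply: filterS => y fy; apply: norm_le_coord; first by rewrite mulr_ge0// ltW.
move=> i j; rewrite ord1; apply: le_trans (fy j); rewrite !mxE.
rewrite -deriveE// derive_coordE//.
rewrite le_eqVlt; apply/orP; left; apply/eqP; congr (`|_ - _|).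
by apply: eq_bigr => k _; rewrite !mxE.
Qed.

Lemma diff_rV_coord m n (f : 'rV[R]_m.+1 -> 'rV[R]_n.+1) x j :
  differentiable f x -> differentiable (fun y => f y 0 j) x.
Proof.
move=> df.
apply: (@differentiable_comp _ _ _ _ f (fun M : 'rV[R]_n.+1 => M 0 j : R) x df).
exact: differentiable_coord.
Qed.

Lemma derive_rV_coord m n (f : 'rV[R]_m.+1 -> 'rV[R]_n.+1) x v j :
  differentiable f x -> 'D_v f x 0 j = 'D_v (fun y => f y 0 j) x.
Proof. by move=> df; rewrite derive_mx ?mxE//; exact: diff_derivable. Qed.

Lemma jacobian_coord m n (f : 'rV[R]_m.+1 -> 'rV[R]_n.+1) x i j :
  differentiable f x -> 'J f x i j = 'D_(delta_mx 0 i) (fun y => f y 0 j) x.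
Proof.
move=> df; rewrite -derive_rV_coord// deriveE// jacobianE//.
by rewrite -rowE [RHS]mxE.
Qed.

Lemma jacobian_comp m n p (f : 'rV[R]_m.+1 -> 'rV[R]_n.+1)
    (g : 'rV[R]_n.+1 -> 'rV[R]_p.+1) x :
  differentiable f x -> differentiable g (f x) ->
  'J (g \o f) x = 'J f x *m 'J g (f x).
Proof.
move=> df dg; apply/row_matrixP => i; rewrite !rowE mulmxA -!jacobianE//.
  by rewrite diff_comp.
exact: differentiable_comp.
Qed.

End Calculus.

(** * Scalar functions of class C^k *)

Section Ck.
Variable R : realType.

Definition pd n (i : 'I_n.+1) (f : 'rV[R]_n.+1 -> R) : 'rV[R]_n.+1 -> R :=
  fun u => 'D_('e_i) f u.

(* A scalar version of C_k that iterates the partial derivatives only. *)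
Fixpoint Ck n k (U : set 'rV[R]_n.+1) (f : 'rV[R]_n.+1 -> R) : Prop :=
  match k with
  | 0%N => forall u, U u -> {for u, continuous f}
  | k'.+1 => (forall u, U u -> differentiable f u) /\ forall i, Ck k' U (pd i f)
  end.

Lemma differentiable_near_eq (V W : normedModType R) (f g : V -> W) x :
  (\forall y \near x, f y = g y) -> differentiable f x -> differentiable g x.
Proof.
move=> fg df; have fgx := nbhs_singleton fg; apply: (proj1 (@diff_eps_intro _ _ _ g x ('d f x) _ _)).
  exact: diff_continuous.
move=> e e0; apply: filterS2 fg (diff_epsP df e0) => y <-.
by rewrite fgx.
Qed.

Lemma pd_near_eq n i (f g : 'rV[R]_n.+1 -> R) x :
  (\forall y \near x, f y = g y) -> pd i f x = pd i g x.
Proof. exact: near_eq_derive. Qed.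

Lemma near_open (T : topologicalType) (U : set T) (P : T -> Prop) x :
  open U -> U x -> (forall y, U y -> P y) -> \forall y \near x, P y.
Proof. by move=> oU Ux UP; apply: filterS UP _; exact: open_nbhs_nbhs. Qed.

Lemma near_ex_open (T : topologicalType) (P : T -> Prop) (x : T) :
  (\forall y \near x, P y) -> exists V, [/\ open V, V x & forall y, V y -> P y].
Proof.
rewrite /prop_near1 nbhsE => -[V [oV Vx] VP]; by exists V.
Qed.

Lemma continuous_near_eq (V W : topologicalType) (f g : V -> W) x :
  (\forall y \near x, f y = g y) -> {for x, continuous f} -> {for x, continuous g}.
Proof.
move=> fg fc; rewrite /prop_for /continuous_at -(nbhs_singleton fg).
by apply: cvg_trans fc; apply: near_eq_cvg.
Qed.

Variable n : nat.
Implicit Types (i : 'I_n.+1) (U V : set 'rV[R]_n.+1) (f g : 'rV[R]_n.+1 -> R).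

Lemma Ck_ext k U f g : open U -> (forall u, U u -> f u = g u) ->
  Ck k U f -> Ck k U g.
Proof.
move=> oU; elim: k f g => [|k IH] f g fg /= => [fc u Uu|[df fk]].
  by apply: continuous_near_eq (fc u Uu); exact: (near_open oU).
split=> [u Uu|i].
  by apply: differentiable_near_eq (df u Uu); exact: (near_open oU).
apply: IH (fk i) => u Uu.
by apply: pd_near_eq; exact: (near_open oU).
Qed.

Lemma Ck_continuous k U f u : Ck k U f -> U u -> {for u, continuous f}.
Proof.
case: k => [fc Uu|k [df _] Uu]; first exact: fc.
by apply: differentiable_continuous; exact: df.
Qed.

Lemma CkS k U f : Ck k.+1 U f -> Ck k U f.
Proof.
elim: k f => [|k IH] f fk; first by move=> u Uu; exact: Ck_continuous fk Uu.
by case: fk => df fk; split=> // i; apply: IH.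
Qed.

Lemma Ck_diff k U f u : Ck k.+1 U f -> U u -> differentiable f u.
Proof. by case=> df _; exact: df. Qed.

Lemma Ck_pd k U f i : Ck k.+1 U f -> Ck k U (pd i f).
Proof. by case=> _ fk; exact: fk. Qed.

Lemma Ck_subset k U V f : V `<=` U -> Ck k U f -> Ck k V f.
Proof.
move=> VU; elim: k f => [|k IH] f; first by move=> fc u /VU; exact: fc.
by case=> df fk; split=> [u /VU|i]; [exact: df|apply: IH; exact: fk].
Qed.

(** V may be any set: [Ck] is a family of pointwise conditions on functions of the whole space, and
    the derivatives do not refer to the set. *)
Lemma Ck_local k U f :
  (forall u, U u -> exists2 V, V u & Ck k V f) -> Ck k U f.
Proof.
elim: k f => [|k IH] f fl; first by move=> u /fl[V Vu fV]; exact: fV.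
split=> [u /fl[V Vu fk]|i]; first exact: Ck_diff fk Vu.
by apply: IH => u /fl[V Vu fk]; exists V => //; exact: Ck_pd.
Qed.

Lemma pdD i f g u : differentiable f u -> differentiable g u ->
  pd i (fun u => f u + g u) u = pd i f u + pd i g u.
Proof. by move=> df dg; apply: deriveD; exact: diff_derivable. Qed.

Lemma pdN i f u : differentiable f u -> pd i (fun u => - f u) u = - pd i f u.
Proof. by move=> df; apply: deriveN; exact: diff_derivable. Qed.

Lemma pdM i f g u : differentiable f u -> differentiable g u ->
  pd i (fun u => f u * g u) u = f u * pd i g u + g u * pd i f u.
Proof. by move=> df dg; apply: deriveM; exact: diff_derivable. Qed.

Lemma pd_cst i c u : pd i (fun=> c) u = 0.
Proof. exact: (@derive_cst R 'rV[R]_n.+1 R c u 'e_i). Qed.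

Lemma pd_coord i j u : pd i (fun v : 'rV[R]_n.+1 => v 0 j) u = (i == j)%:R.
Proof.
rewrite /pd -(derive_rV_coord (f := id)) ?derive_id ?mxE ?eqxx//.
by rewrite eq_sym.
Qed.

Lemma Ck_cst k U c : Ck k U (fun=> c).
Proof.
elim: k c => [|k IH] c; first by move=> u _; exact: (@cst_continuous 'rV[R]_n.+1 R c u).
split=> [u _|i]; first exact: differentiable_cst.
by rewrite (_ : pd i _ = fun=> 0)//; apply/funext => u; exact: pd_cst.
Qed.

Lemma Ck_coord k U j : Ck k U (fun v => v 0 j).
Proof.
case: k => [|k]; first by move=> u _; exact: coord_continuous.
split=> [u _|i]; first exact: differentiable_coord.
by rewrite (_ : pd i _ = fun=> (i == j)%:R); [exact: Ck_cst|apply/funext => u; exact: pd_coord].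
Qed.

Lemma Ck_add k U f g : open U -> Ck k U f -> Ck k U g -> Ck k U (fun u => f u + g u).
Proof.
move=> oU; elim: k f g => [|k IH] f g fk gk.
  by move=> u Uu; apply: cont_add; [exact: fk|exact: gk].
split=> [u Uu|i].
  by apply: differentiableD; [exact: Ck_diff fk Uu|exact: Ck_diff gk Uu].
apply: (Ck_ext oU _ (IH _ _ (Ck_pd i fk) (Ck_pd i gk))) => u Uu.
by rewrite pdD//; [exact: Ck_diff fk Uu|exact: Ck_diff gk Uu].
Qed.

Lemma Ck_opp k U f : open U -> Ck k U f -> Ck k U (fun u => - f u).
Proof.
move=> oU; elim: k f => [|k IH] f fk.
  by move=> u Uu; apply: cont_opp; exact: fk.
split=> [u Uu|i]; first by apply: differentiableN; exact: Ck_diff fk Uu.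
apply: (Ck_ext oU _ (IH _ (Ck_pd i fk))) => u Uu.
by rewrite pdN//; exact: Ck_diff fk Uu.
Qed.

Lemma Ck_sub k U f g : open U -> Ck k U f -> Ck k U g -> Ck k U (fun u => f u - g u).
Proof. by move=> oU fk gk; apply: Ck_add => //; exact: Ck_opp. Qed.

Lemma Ck_mul k U f g : open U -> Ck k U f -> Ck k U g -> Ck k U (fun u => f u * g u).
Proof.
move=> oU; elim: k f g => [|k IH] f g fk gk.
  by move=> u Uu; apply: cont_mul; [exact: fk|exact: gk].
split=> [u Uu|i].
  by apply: differentiableM; [exact: Ck_diff fk Uu|exact: Ck_diff gk Uu].
have fk' := CkS fk; have gk' := CkS gk.
apply: (Ck_ext oU _ (Ck_add oU (IH _ _ fk' (Ck_pd i gk)) (IH _ _ gk' (Ck_pd i fk)))) => u Uu.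
by rewrite pdM//; [exact: Ck_diff fk Uu|exact: Ck_diff gk Uu].
Qed.

Lemma Ck_sum k U (I : Type) (r : seq I) (P : pred I) (F : I -> 'rV[R]_n.+1 -> R) :
  open U -> (forall j : I, P j -> Ck k U (F j)) ->
  Ck k U (fun u => \sum_(j <- r | P j) F j u).
Proof.
move=> oU FU; elim: r => [|i r IH].
  have -> : (fun u => \sum_(j <- [::] | P j) F j u) = (fun=> 0).
    by apply/funext => u; rewrite big_nil.
  exact: Ck_cst.
have [Pi|/negbTE Pi] := boolP (P i); last first.
  have -> // : (fun u => \sum_(j <- i :: r | P j) F j u) =
    (fun u => \sum_(j <- r | P j) F j u).
  by apply/funext => u; rewrite big_cons Pi.
have -> : (fun u => \sum_(j <- i :: r | P j) F j u) =
    (fun u => F i u + \sum_(j <- r | P j) F j u).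
  by apply/funext => u; rewrite big_cons Pi.
by apply: Ck_add => //; exact: FU.
Qed.

Lemma Ck_prod k U (I : Type) (r : seq I) (P : pred I) (F : I -> 'rV[R]_n.+1 -> R) :
  open U -> (forall j : I, P j -> Ck k U (F j)) ->
  Ck k U (fun u => \prod_(j <- r | P j) F j u).
Proof.
move=> oU FU; elim: r => [|i r IH].
  have -> : (fun u => \prod_(j <- [::] | P j) F j u) = (fun=> 1).
    by apply/funext => u; rewrite big_nil.
  exact: Ck_cst.
have [Pi|/negbTE Pi] := boolP (P i); last first.
  have -> // : (fun u => \prod_(j <- i :: r | P j) F j u) =
    (fun u => \prod_(j <- r | P j) F j u).
  by apply/funext => u; rewrite big_cons Pi.
have -> : (fun u => \prod_(j <- i :: r | P j) F j u) =
    (fun u => F i u * \prod_(j <- r | P j) F j u).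
  by apply/funext => u; rewrite big_cons Pi.
by apply: Ck_mul => //; exact: FU.
Qed.

Lemma diff_pd_sum i u (I : Type) (r : seq I) (F : I -> 'rV[R]_n.+1 -> R) :
  (forall j, differentiable (F j) u) ->
  differentiable (fun u => \sum_(j <- r) F j u) u /\
   pd i (fun u => \sum_(j <- r) F j u) u = \sum_(j <- r) pd i (F j) u.
Proof.
move=> dF; elim: r => [|j r [IHd IHe]].
  have -> : (fun u => \sum_(j <- [::]) F j u) = (fun=> 0).
    by apply/funext => v; rewrite big_nil.
  by rewrite big_nil pd_cst; split=> //; exact: differentiable_cst.
have -> : (fun u => \sum_(j <- j :: r) F j u) = (fun u => F j u + \sum_(j <- r) F j u).
  by apply/funext => v; rewrite big_cons.
by rewrite big_cons -IHe; split; [exact: differentiableD|exact: pdD].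
Qed.

Lemma pd_sum i u (I : Type) (r : seq I) (F : I -> 'rV[R]_n.+1 -> R) :
  (forall j, differentiable (F j) u) ->
  pd i (fun u => \sum_(j <- r) F j u) u = \sum_(j <- r) pd i (F j) u.
Proof. by move=> dF; have [] := diff_pd_sum i r dF. Qed.

Lemma diff_sum u (I : Type) (r : seq I) (F : I -> 'rV[R]_n.+1 -> R) :
  (forall j, differentiable (F j) u) ->
  differentiable (fun u => \sum_(j <- r) F j u) u.
Proof. by move=> dF; have [] := diff_pd_sum 0 r dF. Qed.

(** Serves exp, ln, the inverse and the quadratic cutoff. Order 1 is enough because [psi] already
    contains second derivatives of the support function and is differentiated only once. *)
Lemma C1_comp1 U f (g g' : R -> R) : open U -> Ck 1 U f ->
  (forall u, U u -> is_derive (f u) 1 g (g' (f u))) ->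
  (forall u, U u -> {for f u, continuous g'}) ->
  Ck 1 U (fun u => g (f u)) /\
  forall i u, U u -> pd i (fun u => g (f u)) u = g' (f u) * pd i f u.
Proof.
move=> oU f1 gd gc.
have dg u : U u -> differentiable g (f u).
  by move=> /gd gu; apply/derivable1_diffP; exact: ex_derive.
have dgf u : U u -> differentiable (g \o f) u.
  move=> Uu; apply: differentiable_comp; last exact: dg.
  exact: Ck_diff f1 Uu.
have pdgf i u : U u -> pd i (fun u => g (f u)) u = g' (f u) * pd i f u.
  move=> Uu; have df := Ck_diff f1 Uu.
  rewrite /pd deriveE; last exact: dgf.
  rewrite [LHS](_ : _ = 'd (g \o f) u 'e_i)// diff_comp//; last exact: dg.
  rewrite /= deriveE// diff1E; last exact: dg.
  by rewrite derive1E; have gu := gd _ Uu; rewrite derive_val mulrC.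
split=> //; split=> [//|i u Uu].
apply: (@continuous_near_eq _ _ (fun u => g' (f u) * pd i f u)).
  by apply: (near_open oU Uu) => v Uv; rewrite pdgf.
apply: cont_mul; last exact: (Ck_pd i f1).
apply: continuous_comp; first exact: Ck_continuous f1 Uu.
exact: gc.
Qed.

End Ck.

Section CkComp.
Variables (R : realType) (m n : nat).
Implicit Types (i : 'I_m.+1) (F : 'rV[R]_m.+1 -> 'rV[R]_n.+1) (g : 'rV[R]_n.+1 -> R).

Lemma pd_comp i F g u : differentiable F u -> differentiable g (F u) ->
  pd i (fun u => g (F u)) u = \sum_j pd i (fun v => F v 0 j) u * pd j g (F u).
Proof.
move=> dF dg; rewrite /pd deriveE; last exact: differentiable_comp.
rewrite [LHS](_ : _ = 'd (g \o F) u 'e_i)// diff_comp//=.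
rewrite -deriveE// -[X in 'D_X g _]deriveE// derive_coordE//.
by apply: eq_bigr => j _; rewrite derive_rV_coord.
Qed.

Lemma Ck_comp k U V F g : open U ->
  (forall j, Ck k U (fun u => F u 0 j)) -> (forall u, U u -> V (F u)) ->
  Ck k V g -> Ck k U (fun u => g (F u)).
Proof.
move=> oU; elim: k g F => [|k IH] g F FU UV gV.
  move=> u Uu; apply: (@continuous_comp _ _ _ F g); last by apply: (gV (F u)); exact: UV.
  by apply: (@continuous_rVP R 'rV[R]_m.+1) => j; exact: (FU j u Uu).
have dF u : U u -> differentiable F u.
  by move=> Uu; apply: diff_rV_intro => j; exact: Ck_diff (FU j) Uu.
have dg u : U u -> differentiable g (F u).
  by move=> /UV; exact: Ck_diff gV.
split=> [u Uu|i]; first by apply: (@differentiable_comp _ _ _ _ F g); [exact: dF|exact: dg].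
have Ce : Ck k U (fun u => \sum_j pd i (fun v => F v 0 j) u * pd j g (F u)).
  apply: Ck_sum => // j _; apply: Ck_mul => //; first exact: Ck_pd.
  by apply: IH (Ck_pd j gV) => // j'; apply: CkS.
apply: (Ck_ext oU _ Ce) => u Uu.
by rewrite pd_comp//; [exact: dF|exact: dg].
Qed.

(** Bridge from the vector-valued smoothness of the definitions to the scalar calculus; among all
    directions only the coordinate ones are kept. *)
Lemma C_k_coord k (U : set 'rV[R]_m.+1) F j : open U ->
  C_k k U F -> Ck k U (fun u => F u 0 j).
Proof.
move=> oU; elim: k F => [|k IH] F.
  move=> FU u Uu; apply: (@cvg_coord R _ (nbhs u) 1 n.+1 F (F u) 0 j); exact: FU.
move=> [dF FU]; split=> [u Uu|i]; first by apply: diff_rV_coord; exact: dF.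
apply: (Ck_ext oU _ (IH _ (FU 'e_i))) => u Uu.
by rewrite derive_rV_coord//; exact: dF.
Qed.

End CkComp.

(** * Mean value theorem, symmetry of second derivatives, implicit functions *)

Section MeanValue.
Variable R : realType.

Lemma cont_near_le (T : topologicalType) (f : T -> R) x e :
  {for x, continuous f} -> 0 < e -> \forall y \near x, `|f x - f y| <= e.
Proof. by move=> /cvgrPdist_le; exact. Qed.

Lemma line_quotientE (V : normedModType R) (f : V -> R) y v (t : R) :
  (fun h : R => h^-1 *: (((fun s : R => f (y + s *: v)) \o shift t) (h *: 1) - f (y + t *: v))) =
  (fun h : R => h^-1 *: ((f \o shift (y + t *: v)) (h *: v) - f (y + t *: v))).
Proof.
apply/funext => h /=; congr (_ *: (f _ - _)).
by rewrite [h *: 1]mulr1 scalerDl addrCA.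
Qed.

Lemma line_is_derive (V : normedModType R) (f : V -> R) y v (t : R) :
  derivable f (y + t *: v) v ->
  is_derive t 1 (fun s : R => f (y + s *: v)) ('D_v f (y + t *: v)).
Proof.
move=> fd; split; first by rewrite /derivable line_quotientE.
by rewrite /derive line_quotientE.
Qed.

Lemma segment_mvt (V : normedModType R) (f : V -> R) y v :
  (forall t : R, 0 <= t <= 1 -> derivable f (y + t *: v) v) ->
  exists2 c : R, 0 < c < 1 & f (y + v) - f y = 'D_v f (y + c *: v).
Proof.
move=> fd.
have [||c c01] := @MVT R (fun s : R => f (y + s *: v)) (fun s => 'D_v f (y + s *: v)) 0 1 ltr01.
- move=> t; rewrite in_itv /= => /andP[t0 t1]; apply: line_is_derive.
  by apply: fd; rewrite !ltW.
- apply: derivable_within_continuous => t; rewrite in_itv /= => t01.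
  by have [] := line_is_derive (fd _ t01).
rewrite scale1r scale0r addr0 subr0 mulr1 => fE.
by exists c => //; rewrite in_itv in c01.
Qed.

Lemma shift_quotientE (V : normedModType R) (f : V -> R) y v w :
  (fun h : R => h^-1 *: (((fun z => f (z + w)) \o shift y) (h *: v) - f (y + w))) =
  (fun h : R => h^-1 *: ((f \o shift (y + w)) (h *: v) - f (y + w))).
Proof. by apply/funext => h /=; rewrite addrA. Qed.

Lemma shift_is_derive (V : normedModType R) (f : V -> R) y v w :
  derivable f (y + w) v ->
  is_derive y v (fun z => f (z + w)) ('D_v f (y + w)).
Proof.
move=> fd; split; first by rewrite /derivable shift_quotientE.
by rewrite /derive shift_quotientE.
Qed.

Lemma deriveZdir n (f : 'rV[R]_n.+1 -> R) x (h : R) v :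
  differentiable f x -> 'D_(h *: v) f x = h * 'D_v f x.
Proof. by move=> df; rewrite !deriveE// linearZ. Qed.

Lemma ball_segment (V : normedModType R) (x y v : V) e (c : R) :
  ball x e y -> ball x e (y + v) -> 0 <= c <= 1 -> ball x e (y + c *: v).
Proof.
rewrite -!ball_normE /= => xy xyv /andP[c0 c1].
have -> : x - (y + c *: v) = (1 - c) *: (x - y) + c *: (x - (y + v)).
  by rewrite !opprD !addrA [c *: (_ - v)]scalerBr [RHS]addrA -scalerDl subrK scale1r.
apply: le_lt_trans (ler_normD _ _) _.
rewrite !normrZ !ger0_norm ?subr_ge0//.
have [->|cn0] := eqVneq c 0; first by rewrite subr0 mul1r mul0r addr0.
have {}c0 : 0 < c by rewrite lt_def cn0.
rewrite -[ltRHS](mul1r e) -[X in _ < X * e](subrK c) [ltRHS]mulrDl.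
by apply: ler_ltD; [apply: ler_wpM2l; [rewrite subr_ge0|exact: ltW]|rewrite ltr_pM2l].
Qed.

Lemma delta_norm n (i : 'I_n.+1) : `|'e_i : 'rV[R]_n.+1| <= 1.
Proof.
apply: norm_le_coord => // k j; rewrite mxE normr_nat.
by case: (_ && _).
Qed.

(** Two mean value theorems: along ['e_i] for the increment of f by h in direction j, then along
    ['e_j] for [pd i f]. The left-hand side is symmetric in i and j, which is the point of the
    lemma. *)
Lemma second_difference n (U : set 'rV[R]_n.+1) f u i j (h : R) :
  Ck 2 U f -> 0 < h -> (forall y, `|y - u| <= h + h -> U y) ->
  exists2 y, `|y - u| <= h + h &
    f (u + h *: 'e_i + h *: 'e_j) - f (u + h *: 'e_i) - f (u + h *: 'e_j) + f u =
    h * (h * pd j (pd i f) y).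
Proof.
move=> f2 h0 hU.
have inU s t : 0 <= s <= 1 -> 0 <= t <= 1 ->
    `|u + s *: (h *: 'e_i) + t *: (h *: 'e_j) - u| <= h + h.
  move=> /andP[s0 s1] /andP[t0 t1]; rewrite -[u + _ + _]addrA [u + _ - u]addrAC subrr add0r.
  apply: le_trans (ler_normD _ _) _; rewrite !normrZ !ger0_norm ?(ltW h0)//.
  apply: lerD; rewrite -[leRHS]mul1r; apply: ler_pM => //; rewrite ?mulr_ge0// ?(ltW h0)//.
    by rewrite -[leRHS]mulr1 ler_wpM2l ?delta_norm ?ltW.
  by rewrite -[leRHS]mulr1 ler_wpM2l ?delta_norm ?ltW.
have df1 s t : 0 <= s <= 1 -> 0 <= t <= 1 ->
    differentiable f (u + s *: (h *: 'e_i) + t *: (h *: 'e_j)).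
  by move=> s01 t01; apply: Ck_diff f2 _; apply: hU; exact: inU.
have df2 s t : 0 <= s <= 1 -> 0 <= t <= 1 ->
    differentiable (pd i f) (u + s *: (h *: 'e_i) + t *: (h *: 'e_j)).
  by move=> s01 t01; apply: Ck_diff (Ck_pd i f2) _; apply: hU; exact: inU.
have I0 : 0 <= (0 : R) <= 1 by rewrite lexx ler01.
have I1 : 0 <= (1 : R) <= 1 by rewrite lexx ler01.
pose F y := f (y + h *: 'e_j) - f y.
have FD s : 0 <= s <= 1 -> is_derive (u + s *: (h *: 'e_i)) (h *: 'e_i) F
    ('D_(h *: 'e_i) f (u + s *: (h *: 'e_i) + h *: 'e_j) - 'D_(h *: 'e_i) f (u + s *: (h *: 'e_i))).
  move=> s01; have := df1 _ 1 s01 I1; have := df1 _ 0 s01 I0.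
  rewrite scale0r addr0 scale1r => d1 d2.
  apply: is_deriveB; last by apply: derivableP; exact: diff_derivable.
  by apply: shift_is_derive; exact: diff_derivable.
have [s s01|c /andP[c0 c1]] := @segment_mvt _ F u (h *: 'e_i).
  by have [] := FD _ s01.
have c01 : 0 <= c <= 1 by rewrite !ltW.
have Fc := FD _ c01; rewrite derive_val.
have := df1 _ 1 c01 I1; have := df1 _ 0 c01 I0.
rewrite scale0r addr0 scale1r => d1 d2.
rewrite !deriveZdir// -mulrBr -/(pd i f) /F => FE.
have [t t01|d /andP[d0 d1']] := @segment_mvt _ (pd i f) (u + c *: (h *: 'e_i)) (h *: 'e_j).
  by apply: diff_derivable; exact: df2.
have d01 : 0 <= d <= 1 by rewrite !ltW.
rewrite deriveZdir; last exact: df2.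
move=> E; exists (u + c *: (h *: 'e_i) + d *: (h *: 'e_j)); first exact: inU.
rewrite -[pd j _ _]/('D_'e_j (pd i f) _) -E -FE.
have aux (p q r s : R) : p - q - r + s = p - q - (r - s) by lra.
exact: aux.
Qed.

(** Exchanging i and j in [second_difference] leaves the second difference unchanged, so the two
    mixed derivatives agree at two points close to u; continuity brings both points to u. *)
Lemma pdC n (U : set 'rV[R]_n.+1) f u i j : open U -> U u -> Ck 2 U f ->
  pd i (pd j f) u = pd j (pd i f) u.
Proof.
move=> oU Uu f2; apply/eqP; rewrite -subr_eq0 -normr_le0; apply/ler_addgt0Pr => e e0.
rewrite add0r.
have c1 : {for u, continuous (pd i (pd j f))} by apply: Ck_continuous Uu; do 2! apply: Ck_pd; exact: f2.
have c2 : {for u, continuous (pd j (pd i f))} by apply: Ck_continuous Uu; do 2! apply: Ck_pd; exact: f2.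
have e20 : 0 < e / 2 by rewrite divr_gt0.
have n1 := cont_near_le c1 e20.
have n2 := cont_near_le c2 e20.
have n3 : \forall y \near u, U y by exact: open_nbhs_nbhs.
have /nbhs_normP[d /= d0 dP] : \forall y \near u, [/\ U y,
   `|pd i (pd j f) u - pd i (pd j f) y| <= e / 2 &
   `|pd j (pd i f) u - pd j (pd i f) y| <= e / 2].
  by apply: filterS3 n3 n1 n2 => y ? ? ?; split.
have h0 : 0 < d / 4 by rewrite divr_gt0.
have sm y : `|y - u| <= d / 4 + d / 4 -> ball_ Num.norm u d y.
  by rewrite /ball_ /= distrC => /le_lt_trans; apply; lra.
have hU y : `|y - u| <= d / 4 + d / 4 -> U y by move=> /sm /dP[].
have [y1 /sm/dP[_ _ P1] E1] := second_difference i j f2 h0 hU.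
have [y2 /sm/dP[_ P2 _] E2] := second_difference j i f2 h0 hU.
have E : pd j (pd i f) y1 = pd i (pd j f) y2.
  have hn : d / 4 != 0 by rewrite gt_eqF.
  apply: (mulfI hn); apply: (mulfI hn).
  apply: etrans (esym E1) _; apply: etrans _ E2.
  by rewrite [u + _ + _]addrAC; congr (_ + _); rewrite -!addrA; congr (_ + _); rewrite addrC.
rewrite (splitr e); apply: le_trans (lerD P2 P1).
rewrite E [X in _ <= _ + X]distrC.
apply: le_trans (ler_normD _ _).
by rewrite addrA subrK.
Qed.

Lemma norm_mulmx_le m n p (A : 'M[R]_(m, n)) (B : 'M[R]_(n, p)) :
  `|A *m B| <= n%:R * `|A| * `|B|.
Proof.
apply: norm_le_coord; first by rewrite !mulr_ge0.
move=> i j; rewrite mxE; apply: le_trans (ler_norm_sum _ _ _) _.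
apply: le_trans (_ : \sum_(k < n) `|A| * `|B| <= _); last first.
  by rewrite sumr_const card_ord -mulrA mulr_natl.
by apply: ler_sum => k _; rewrite normrM ler_pM// coord_le_norm.
Qed.

(** Let z = v - u and F u = F v. Column by column, z is orthogonal to a gradient at some point of
    the segment, which differs from the gradient at u0 by at most e; hence z J is small compared
    with z. As z = z J P for the right inverse P of J, the choice of e gives |z| <= |z| / 2. The
    mean value point may change with the column. *)
Lemma immersion_inj m n (U : set 'rV[R]_m.+1) (F : 'rV[R]_m.+1 -> 'rV[R]_n.+1) u0 :
  open U -> U u0 -> (forall j, Ck 1 U (fun u => F u 0 j)) ->
  row_free ('J F u0) ->
  exists2 d : R, 0 < d & forall u v, ball u0 d u -> ball u0 d v -> F u = F v -> u = v.
Proof.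
move=> oU Uu0 F1 rf; set J := 'J F u0; set P := pinvmx J.
have JP : J *m P = 1%:M by rewrite mulmxVp.
have dF : differentiable F u0 by apply: diff_rV_intro => j; exact: Ck_diff (F1 j) Uu0.
pose k : R := n.+1%:R * m.+1%:R * `|P| + 1.
have k0 : 0 < k by rewrite ltr_wpDl// !mulr_ge0.
pose e := 1 / (2 * k).
have e0 : 0 < e by rewrite divr_gt0// mulr_gt0.
have : \forall y \near u0, U y /\ forall ij : 'I_m.+1 * 'I_n.+1,
    `|pd ij.1 (fun u => F u 0 ij.2) u0 - pd ij.1 (fun u => F u 0 ij.2) y| <= e.
  have n1 : \forall y \near u0, U y by exact: open_nbhs_nbhs.
  apply: filterI n1 _.
  apply: (@filter_forall _ ('I_m.+1 * 'I_n.+1)%type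
    (fun (ij : 'I_m.+1 * 'I_n.+1) y => is_true (`|pd ij.1 (fun u => F u 0 ij.2) u0 - pd ij.1 (fun u => F u 0 ij.2) y| <= e)) (nbhs u0)).
  move=> [i j] /=.
  have c : {for u0, continuous (pd i (fun u => F u 0 j))}.
    by apply: Ck_continuous Uu0; apply: Ck_pd; exact: F1.
  exact: cont_near_le c e0.
move=> /nbhs_ballP[d /= d0 dP]; exists d => // u v ud vd Fuv.
apply/eqP; rewrite eq_sym -subr_eq0 -normr_le0; set z := v - u.
have vE : v = u + z by rewrite addrC subrK.
have zJ : `|z *m J| <= m.+1%:R * `|z| * e.
  apply: norm_le_coord; first by apply: mulr_ge0; [exact: mulr_ge0|exact: ltW].
  move=> r j; rewrite ord1.
  have inb t : 0 <= t <= 1 -> ball u0 d (u + t *: z).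
    by move=> t01; apply: ball_segment => //; rewrite -vE.
  have [t t01|c /andP[c0 c1]] := @segment_mvt _ (fun u => F u 0 j) u z.
    by apply: diff_derivable; apply: Ck_diff (F1 j) _; have [] := dP _ (inb t t01).
  have c01 : 0 <= c <= 1 by rewrite !ltW.
  have [Uc cP] := dP _ (inb c c01).
  rewrite -vE Fuv subrr derive_coordE; last exact: Ck_diff (F1 j) Uc.
  move=> E; rewrite mxE -[X in `|X|]subr0 [X in _ - X]E -sumrB.
  apply: le_trans (ler_norm_sum _ _ _) _.
  apply: le_trans (_ : \sum_(i < m.+1) `|z| * e <= _); last first.
    by rewrite sumr_const card_ord -mulrA mulr_natl.
  apply: ler_sum => i _; rewrite -mulrBr normrM.
  apply: ler_pM => //; first exact: coord_le_norm.
  rewrite jacobian_coord//; exact: (cP (i, j)).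
have zE : z = z *m J *m P by rewrite -mulmxA JP mulmx1.
have : `|z| <= n.+1%:R * `|z *m J| * `|P| by rewrite {1}zE norm_mulmx_le.
move=> /le_trans H; have {}H : `|z| <= n.+1%:R * (m.+1%:R * `|z| * e) * `|P|.
  by apply: H; rewrite ler_wpM2r// ler_wpM2l.
have : n.+1%:R * (m.+1%:R * `|z| * e) * `|P| <= `|z| / 2.
  have -> : n.+1%:R * (m.+1%:R * `|z| * e) * `|P| = `|z| * ((n.+1%:R * m.+1%:R * `|P|) * e) by ring.
  rewrite ler_wpM2l//; apply: le_trans (_ : k * e <= _).
    by rewrite ler_wpM2r ?(ltW e0)// lerDl.
  by rewrite /e mul1r invfM mulrCA mulfV ?gt_eqF// mulr1.
by move=> /(le_trans H); lra.
Qed.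

(** The solution w is given and continuous, so only its differentiability is at stake. Continuity
    makes the expansion of G available at [w y]; its error is absorbed to give a Lipschitz bound for
    w at y0, after which that error is small compared with y - y0. *)
Lemma implicit_diff m n (G : 'rV[R]_m.+1 -> 'rV[R]_m.+1)
    (w phi : 'rV[R]_n.+1 -> 'rV[R]_m.+1) y0 :
  differentiable G (w y0) -> 'J G (w y0) \in unitmx ->
  {for y0, continuous w} -> differentiable phi y0 ->
  (\forall y \near y0, G (w y) = phi y) ->
  differentiable w y0 /\ 'J w y0 = 'J phi y0 *m invmx ('J G (w y0)).
Proof.
move=> dG Ju cw dphi Gw; set J := 'J G (w y0); set P := invmx J.
have mxbd p r (M : 'M[R]_(p.+1, r.+1)) : exists2 k : R, 0 < k &
    forall v : 'rV_p.+1, `|v *m M| <= k * `|v|.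
  exists (p.+1%:R * `|M| + 1) => [|v]; first by rewrite ltr_wpDl// mulr_ge0.
  apply: le_trans (norm_mulmx_le _ _) _.
  by rewrite mulrAC ler_wpM2r// lerDl.
have [k k0 kP] := mxbd _ _ P; have [l l0 lP] := mxbd _ _ ('J phi y0).
suff dw : differentiable w y0 /\ 'd w y0 = mulmxr ('J phi y0 *m P) :> ('rV_n.+1 -> 'rV_m.+1).
  case: dw => dw dE; split=> //; apply/row_matrixP => i; rewrite !rowE -jacobianE//.
  by rewrite dE.
apply: diff_eps_intro; first exact: mulmx_continuous.
move=> e e0.
(* The first bound in [e1] absorbs half of |dl|, the second makes the error of G at most e / 2 times
   |v|. In [e2], the bound 1 gives |z| <= (l + 1) |v| and the other one accounts for the remaining e
   / 2. *)
pose e1 := Num.min (1 / (2 * k)) (e / (4 * k * k * (l + 1))).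
pose e2 := Num.min 1 (e / (2 * k)).
have l10 : 0 < l + 1 by rewrite addr_gt0.
have e10 : 0 < e1 by rewrite lt_min !divr_gt0// ?mulr_gt0.
have e20 : 0 < e2 by rewrite lt_min ltr01 divr_gt0// ?mulr_gt0.
have near1 := cw _ (diff_epsP dG e10); rewrite nbhs_simpl /= in near1.
have near2 := diff_epsP dphi e20.
have Gw0 := nbhs_singleton Gw.
near=> y.
have Gy : G (w y) = phi y by near: y.
have : `|G (w y) - G (w y0) - 'd G (w y0) (w y - w y0)| <= e1 * `|w y - w y0|.
  by near: y.
have : `|phi y - phi y0 - 'd phi y0 (y - y0)| <= e2 * `|y - y0|.
  by near: y.
rewrite Gy Gw0 !jacobianE// -/J.
set dl := w y - w y0; set z := phi y - phi y0; set v := y - y0 => H2 H.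
have E : dl - z *m P = - ((z - dl *m J) *m P).
  by rewrite (mulmxBl z) -mulmxA mulmxV// mulmx1 opprB.
have le1 : `|dl - z *m P| <= k * (e1 * `|dl|).
  by rewrite E normrN; apply: le_trans (kP _) _; rewrite ler_pM2l.
have le2 : k * (e1 * `|dl|) <= `|dl| / 2.
  rewrite mulrA mulrC ler_wpM2l//.
  apply: le_trans (_ : k * (1 / (2 * k)) <= _); first by rewrite ler_pM2l// ge_min lexx.
  by rewrite mul1r invfM mulrCA mulfV ?gt_eqF// mulr1.
have le3 : `|dl| <= 2 * k * `|z|.
  have : `|dl| <= `|dl - z *m P| + `|z *m P| by rewrite -[X in `|X| <= _](subrK (z *m P)) ler_normD.
  have := kP z; lra.
have le4 : `|z| <= (l + 1) * `|v|.
  have : `|z| <= `|z - v *m 'J phi y0| + `|v *m 'J phi y0|.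
    by rewrite -[X in `|X| <= _](subrK (v *m 'J phi y0)) ler_normD.
  have : e2 * `|v| <= 1 * `|v| by rewrite ler_wpM2r// ge_min lexx.
  have := lP v; lra.
have le5 : k * (e1 * `|dl|) <= e / 2 * `|v|.
  apply: le_trans (_ : k * (e1 * (2 * k * ((l + 1) * `|v|))) <= _).
    rewrite ler_pM2l// ler_pM2l//; apply: le_trans le3 _.
    by rewrite ler_pM2l// mulr_gt0.
  have -> : k * (e1 * (2 * k * ((l + 1) * `|v|))) = e1 * (4 * k * k * (l + 1)) / 2 * `|v| by field.
  rewrite ler_wpM2r// ler_pM2r ?invr_gt0// -ler_pdivlMr ?mulr_gt0//.
  by rewrite ge_min lexx orbT.
have le6 : `|(z - v *m 'J phi y0) *m P| <= e / 2 * `|v|.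
  apply: le_trans (kP _) _; apply: le_trans (_ : k * (e2 * `|v|) <= _).
    by rewrite ler_pM2l.
  rewrite mulrA ler_wpM2r//; apply: le_trans (_ : k * (e / (2 * k)) <= _).
    by rewrite ler_pM2l// ge_min lexx orbT.
  by rewrite le_eqVlt; apply/orP; left; apply/eqP; field; rewrite gt_eqF.
have -> : dl - mulmxr ('J phi y0 *m P) v = (dl - z *m P) + (z - v *m 'J phi y0) *m P.
  by rewrite /= (mulmxBl z (v *m 'J phi y0)) mulmxA addrA subrK.
apply: le_trans (ler_normD _ _) _.
rewrite [e]splitr mulrDl; apply: lerD => //.
exact: le_trans le1 le5.
Unshelve. all: by end_near. Qed.

End MeanValue.

(** * The divergence theorem for compactly supported fields *)

Section Grid.
Variable R : realType.

(** Only x is confined to K: f is continuous at the points of K within the whole space, so y may lie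
    outside and mean value points need no localisation. *)
Lemma compact_unif_cont (V : normedModType R) (K : set V) (f : V -> R) (e : R) :
  compact K -> (forall x, K x -> {for x, continuous f}) -> 0 < e ->
  exists2 d : R, 0 < d & forall x y, K x -> `|x - y| <= d -> `|f x - f y| <= e.
Proof.
move=> /compact_near_coveringP cK fc e0.
have := cK R (0^'+) (fun d x => forall y, `|x - y| <= d -> `|f x - f y| <= e) _ _.
case=> [x Kx|d /= d0 dP].
  have := cont_near_le (fc x Kx) (divr_gt0 e0 (ltr0n _ 2)).
  move=> /nbhs_ballP[r /= r0 rP].
  have r20 : 0 < r / 2 by rewrite divr_gt0.
  near=> x' d => y /= x'y.
  have xx' : ball x (r / 2) x' by near: x'; exact: nbhsx_ballx.
  have dr : d < r / 2 by near: d; exact: nbhs_right_lt.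
  have h1 : `|f x - f x'| <= e / 2.
    by apply: rP; apply: le_ball xx'; lra.
  have h2 : `|f x - f y| <= e / 2.
    apply: rP; rewrite [r]splitr; apply: ball_triangle xx' _.
    by rewrite -ball_normE /=; apply: le_lt_trans dr.
  rewrite (splitr e) -(subrKA (f x)).
  by apply: le_trans (ler_normD _ _) _; rewrite lerD// distrC.
exists (d / 2); first by rewrite divr_gt0.
move=> x y Kx xy; apply: (dP (d / 2)) => //=.
  by rewrite sub0r normrN gtr0_norm ?divr_gt0//; lra.
by rewrite divr_gt0.
Unshelve. all: by end_near. Qed.

Lemma line_sum n (f : 'rV[R]_n.+1 -> R) (i : 'I_n.+1) w (L e : R) (M : nat) :
  (forall y, differentiable f y) -> 0 < L -> (0 < M)%N ->
  f (w - L *: 'e_i) = f (w + L *: 'e_i) ->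
  (forall s t, - L <= s <= L -> `|s - t| <= 2 * L / M%:R ->
    `|pd i f (w + s *: 'e_i) - pd i f (w + t *: 'e_i)| <= e) ->
  `|\sum_(0 <= a < M) pd i f (w + (- L + a%:R * (2 * L / M%:R)) *: 'e_i)| <= M%:R * e.
Proof.
move=> df L0 M0 fL fe; set h := 2 * L / M%:R; pose t (a : nat) := - L + a%:R * h.
have MR0 : 0 < M%:R :> R by rewrite ltr0n.
have h0 : 0 < h by rewrite divr_gt0// mulr_gt0.
have tS a : t a.+1 = t a + h by rewrite /t -addrA -[a.+1]addn1 natrD mulrDl mul1r.
have tM : t M = L by rewrite /t /h mulrC divfK ?gt_eqF//; ring.
have tb a : (a < M)%N -> - L <= t a <= L.
  move=> aM; apply/andP; split; first by rewrite /t lerDl mulr_ge0// ltW.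
  by rewrite -[leRHS]tM /t lerD2l ler_pM2r// ler_nat ltnW.
have step a : exists xi, `|t a - xi| <= h /\
    f (w + t a.+1 *: 'e_i) - f (w + t a *: 'e_i) = h * pd i f (w + xi *: 'e_i).
  have [s s01|c /andP[c0 c1]] := @segment_mvt R _ f (w + t a *: 'e_i) (h *: 'e_i).
    exact: diff_derivable.
  rewrite deriveZdir// -addrA -scalerDl -tS -addrA scalerA -scalerDl => E.
  exists (t a + c * h); split=> //.
  rewrite opprD addNKr normrN gtr0_norm; last exact: mulr_gt0.
  by rewrite ger_pMl// ltW.
have [xi xiP] := choice step.
have sum0 : \sum_(0 <= a < M) pd i f (w + xi a *: 'e_i) = 0.
  apply: (mulfI (lt0r_neq0 h0)); rewrite mulr0 mulr_sumr.
  rewrite (eq_bigr (fun a => f (w + t a.+1 *: 'e_i) - f (w + t a *: 'e_i))); last first.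
    by move=> a _; rewrite (xiP a).2.
  rewrite (telescope_sumr (fun a => f (w + t a *: 'e_i)))// tM /t mul0r addr0 scaleNr fL.
  exact: subrr.
rewrite -[X in `|X|]subr0 -[X in _ - X]sum0 -sumrB.
apply: le_trans (ler_norm_sum _ _ _) _.
apply: le_trans (_ : \sum_(0 <= a < M) e <= _).
  rewrite [leLHS]big_nat [leRHS]big_nat; apply: ler_sum => a /andP[_ aM].
  by apply: fe; [exact: tb|exact: (xiP a).1].
by rewrite big_const_nat subn0 iter_addr_0 mulr_natl.
Qed.

Lemma sum_sub_ge (G : nat -> R) (M k1 k2 : nat) (c : R) :
  (k1 <= k2)%N -> (k2 <= M)%N -> (forall a, 0 <= G a) ->
  (forall a, (k1 <= a < k2)%N -> c <= G a) ->
  (k2 - k1)%N%:R * c <= \sum_(0 <= a < M) G a.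
Proof.
move=> k12 k2M G0 Gc.
have k1M := leq_trans k12 k2M.
rewrite (big_cat_nat (leq0n k1) k1M) (big_cat_nat k12 k2M) /=.
apply: le_trans (_ : \sum_(k1 <= a < k2) G a <= _).
  apply: le_trans (_ : \sum_(k1 <= a < k2) c <= _).
    by rewrite big_const_nat iter_addr_0 mulr_natl.
  by rewrite [leLHS]big_nat [leRHS]big_nat; apply: ler_sum.
have s1 : 0 <= \sum_(0 <= a < k1) G a by apply: sumr_ge0.
have s2 : 0 <= \sum_(k2 <= a < M) G a by apply: sumr_ge0.
rewrite addrCA lerDl; exact: addr_ge0.
Qed.

Lemma sum_norm_le (G : nat -> R) (M : nat) (c : R) :
  (forall a, (a < M)%N -> `|G a| <= c) -> `|\sum_(0 <= a < M) G a| <= M%:R * c.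
Proof.
move=> Gc; apply: le_trans (ler_norm_sum _ _ _) _.
apply: le_trans (_ : \sum_(0 <= a < M) c <= _).
  by rewrite [leLHS]big_nat [leRHS]big_nat; apply: ler_sum => a /andP[_ aM]; exact: Gc.
by rewrite big_const_nat subn0 iter_addr_0 mulr_natl.
Qed.

(** The m K nodes are grouped into K cells of m consecutive nodes. A cell has width 2 L / K whatever
    m is, so refining the grid through m keeps the proportion of nodes near y. *)
Lemma grid_cell (L y : R) (m K : nat) : (0 < m)%N -> (0 < K)%N -> - L <= y < L ->
  exists2 k, (k < K)%N & forall a : nat, (m * k <= a < m * k.+1)%N ->
    `|y - (- L + a%:R * (2 * L / (m * K)%:R))| <= 2 * L / K%:R.
Proof.
move=> m0 K0 /andP[yL Ly]; have L0 : 0 < L by lra.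
have mR : 0 < m%:R :> R by rewrite ltr0n.
have KR : 0 < K%:R :> R by rewrite ltr0n.
pose c := 2 * L / K%:R; have c0 : 0 < c by rewrite divr_gt0// mulr_gt0.
have [z0 zK] : 0 <= (y + L) / c /\ (y + L) / c < K%:R.
  split; first by rewrite divr_ge0 ?(ltW c0)//; lra.
  by rewrite ltr_pdivrMr// /c mulrC divfK ?gt_eqF//; lra.
have /andP[k1 k2] := truncn_itv z0; set k := Num.trunc _ in k1 k2.
exists k; first by rewrite -(ltr_nat R); exact: le_lt_trans zK.
move=> a /andP[ka ak].
have -> : a%:R * (2 * L / (m * K)%:R) = a%:R / m%:R * c.
  by rewrite /c natrM; field; rewrite !gt_eqF.
rewrite -/c; set b := a%:R / m%:R.
have b1 : k%:R <= b by rewrite ler_pdivlMr// -natrM ler_nat mulnC.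
have b2 : b <= k.+1%:R by rewrite ler_pdivrMr// -natrM ler_nat mulnC ltnW.
have k1' : k%:R * c <= y + L by rewrite -ler_pdivlMr.
have k2' : y + L <= k%:R * c + c by rewrite -[X in _ <= _ + X]mul1r -mulrDl natr1 -ler_pdivrMr// ltW.
have b1' : k%:R * c <= b * c by rewrite ler_pM2r.
have b2' : b * c <= k%:R * c + c by rewrite -[X in _ <= _ + X]mul1r -mulrDl natr1 ler_pM2r.
by rewrite ler_norml; apply/andP; split; lra.
Qed.

Definition pt (a b c : R) : 'rV[R]_3 := \row_j [:: a; b; c]`_j.

Lemma ptE0 a b c : pt a b c = pt 0 b c + a *: 'e_(0 : 'I_3).
Proof.
apply/rowP => j; rewrite !mxE eqxx /=.
by case: j => -[|[|[|//]]] ?; rewrite /= ?mulr1 ?mulr0 ?add0r ?addr0.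
Qed.

Lemma ptE1 a b c : pt a b c = pt a 0 c + b *: 'e_(1 : 'I_3).
Proof.
apply/rowP => j; rewrite !mxE eqxx /=.
by case: j => -[|[|[|//]]] ?; rewrite /= ?mulr1 ?mulr0 ?add0r ?addr0.
Qed.

Lemma ptE2 a b c : pt a b c = pt a b 0 + c *: 'e_(2 : 'I_3).
Proof.
apply/rowP => j; rewrite !mxE eqxx /=.
by case: j => -[|[|[|//]]] ?; rewrite /= ?mulr1 ?mulr0 ?add0r ?addr0.
Qed.

End Grid.

Section Divergence.
Variable R : realType.

Definition node (L : R) (M a : nat) : R := - L + a%:R * (2 * L / M%:R).

(* The Riemann sum of a partial derivative of a compactly supported function: the
   values at the nodes of a grid line differ by at most e from those at the mean
   value points, and the latter telescope to 0. *)
Lemma grid_sum0 (f : 'rV[R]_3 -> R) (i : 'I_3) (L e : R) (M : nat) :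
  (forall y, differentiable f y) -> 0 < L -> (0 < M)%N ->
  (forall y, L <= `|y| -> f y = 0) ->
  (forall y z, `|y| <= L -> `|y - z| <= 2 * L / M%:R -> `|pd i f y - pd i f z| <= e) ->
  `|\sum_(0 <= a < M) \sum_(0 <= b < M) \sum_(0 <= c < M) pd i f (pt (node L M a) (node L M b) (node L M c))|
  <= M%:R * (M%:R * (M%:R * e)).
Proof.
move=> df L0 M0 f0 fe; set t := node L M.
have h0 : 0 < 2 * L / M%:R by rewrite divr_gt0 ?ltr0n// mulr_gt0.
have tb a : (a < M)%N -> - L <= t a <= L.
  move=> aM; rewrite /t /node.
  have u0 : 0 <= a%:R / M%:R :> R by rewrite divr_ge0.
  have u1 : a%:R / M%:R <= 1 :> R by rewrite ler_pdivrMr ?ltr0n// mul1r ler_nat ltnW.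
  have -> : a%:R * (2 * L / M%:R) = a%:R / M%:R * (2 * L).
    by rewrite mulrCA mulrC.
  have : 0 <= a%:R / M%:R * (2 * L) by rewrite mulr_ge0//; lra.
  have : a%:R / M%:R * (2 * L) <= 1 * (2 * L) by rewrite ler_wpM2r//; lra.
  by move=> ? ?; apply/andP; split; lra.
have absb s : - L <= s <= L -> `|s| <= L by rewrite -ler_norml.
have line (w : 'rV[R]_3) (k : 'I_3) : k = i -> w 0 k = 0 -> (forall j, `|w 0 j| <= L) ->
    `|\sum_(0 <= a < M) pd i f (w + t a *: 'e_k)| <= M%:R * e.
  move=> -> wi wL.
  have coordE s j : (w + s *: 'e_i) 0 j = if j == i then s else w 0 j.
    rewrite !mxE eqxx /=; case: eqVneq => [->|_]; first by rewrite wi mulr1 add0r.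
    by rewrite mulr0 addr0.
  apply: line_sum => //.
    rewrite !f0//.
      by apply: le_trans (coord_le_norm _ 0 i); rewrite coordE eqxx ler_norm.
    apply: le_trans (coord_le_norm _ 0 i).
    by rewrite -scaleNr coordE eqxx normrN ler_norm.
  move=> s r sL sr; apply: fe.
    apply: norm_le_coord => [|i0 j]; first exact: ltW.
    by rewrite ord1 coordE; case: eqP => _ //; exact: absb.
  rewrite opprD addrA [w + _ - w]addrAC subrr add0r -scalerBl normrZ.
  apply: le_trans sr; rewrite -[leRHS]mulr1 ler_wpM2l//; exact: delta_norm.
have cases : i = 0 \/ i = 1 \/ i = 2.
  by case: i {fe line} => -[|[|[|//]]] ?; [left|right; left|right; right]; apply/val_inj.
have pt0 a b c (j : 'I_3) : `|a| <= L -> `|b| <= L -> `|c| <= L -> `|pt a b c 0 j| <= L.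
  by move=> *; rewrite mxE; case: j => -[|[|[|//]]].
have tn a : (a < M)%N -> `|t a| <= L by move=> /tb; exact: absb.
have L00 : `|0 : R| <= L by rewrite normr0 ltW.
case: cases => [i0|[i1|i2]].
- under eq_bigr do rewrite exchange_big_nat /=.
  rewrite exchange_big_nat /=; apply: sum_norm_le => b bM.
  rewrite exchange_big_nat /=; apply: sum_norm_le => c cM.
  under eq_bigr do rewrite ptE0.
  by apply: line => //; [rewrite mxE|move=> j; apply: pt0 => //; exact: tn].
- apply: sum_norm_le => a aM.
  rewrite exchange_big_nat /=; apply: sum_norm_le => c cM.
  under eq_bigr do rewrite ptE1.
  by apply: line => //; [rewrite mxE|move=> j; apply: pt0 => //; exact: tn].
- apply: sum_norm_le => a aM; apply: sum_norm_le => b bM.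
  under eq_bigr do rewrite ptE2.
  by apply: line => //; [rewrite mxE|move=> j; apply: pt0 => //; exact: tn].
Qed.

(** In each coordinate the cell of y0 contains m nodes, all within d of y0. These m^3 nodes
    contribute at least dl each, and the others are nonnegative. *)
Lemma grid_sum_ge (D : 'rV[R]_3 -> R) (y0 : 'rV[R]_3) (L d dl : R) (m K : nat) :
  (forall y, 0 <= D y) -> 0 <= dl -> (forall y, `|y0 - y| <= d -> dl <= D y) ->
  `|y0| < L -> 2 * L / K%:R <= d -> (0 < m)%N -> (0 < K)%N ->
  m%:R * (m%:R * (m%:R * dl)) <=
  \sum_(0 <= a < m * K) \sum_(0 <= b < m * K) \sum_(0 <= c < m * K) D (pt (node L (m * K) a) (node L (m * K) b) (node L (m * K) c)).
Proof.
move=> D0 dl0 Ddl y0L Kd m0 K0; set t := node L (m * K).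
have cell j : exists2 k, (k < K)%N & forall a : nat, (m * k <= a < m * k.+1)%N ->
    `|y0 0 j - t a| <= d.
  have [|k kK kP] := @grid_cell R L (y0 0 j) m K m0 K0.
    have := le_lt_trans (coord_le_norm y0 0 j) y0L.
    by rewrite ltr_norml => /andP[/ltW -> ->].
  by exists k => // a /kP /le_trans; apply.
have d0 : 0 <= d by apply: le_trans Kd; rewrite divr_ge0// mulr_ge0//; have := normr_ge0 y0; lra.
have [k0 k0K k0P] := cell 0; have [k1 k1K k1P] := cell 1; have [k2 k2K k2P] := cell 2.
have mk k : (m * k.+1 - m * k)%N = m by rewrite mulnS addnK.
have mk1 k : (m * k <= m * k.+1)%N by rewrite leq_mul2l leqnSn orbT.
have mk2 k : (k < K)%N -> (m * k.+1 <= m * K)%N by move=> kK; rewrite leq_mul2l kK orbT.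
have sum3 (G : nat -> R) k (c : R) : (k < K)%N -> (forall a, 0 <= G a) ->
    (forall a, (m * k <= a < m * k.+1)%N -> c <= G a) ->
    m%:R * c <= \sum_(0 <= a < m * K) G a.
  by move=> kK G0 Gc; rewrite -[X in X%:R * _](mk k); apply: sum_sub_ge => //; exact: mk2.
apply: (sum3 _ _ _ k0K) => [a|a ak]; first by do 2! apply: sumr_ge0 => ? _.
apply: (sum3 _ _ _ k1K) => [b|b bk]; first by apply: sumr_ge0 => ? _.
apply: (sum3 _ _ _ k2K) => [c|c ck]; first exact: D0.
apply: Ddl; apply: norm_le_coord => // i j; rewrite ord1 !mxE.
case: j => -[|[|[|//]]] jP /=.
- by rewrite (_ : Ordinal jP = 0); [exact: k0P|exact/val_inj].
- by rewrite (_ : Ordinal jP = 1); [exact: k1P|exact/val_inj].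
- by rewrite (_ : Ordinal jP = 2); [exact: k2P|exact/val_inj].
Qed.

Lemma natr_dominates (x : R) : exists2 n : nat, (0 < n)%N & x < n%:R.
Proof.
exists (Num.trunc `|x|).+1 => //; apply: le_lt_trans (ler_norm x) _.
by have /andP[] := truncn_itv (normr_ge0 x).
Qed.

(* If the divergence were positive at y0, its Riemann sums over the cube would stay
   above a fixed multiple of the number of nodes, against grid_sum0. *)
Lemma compact_divergence (X : 'I_3 -> 'rV[R]_3 -> R) (L0 : R) :
  (forall i, Ck 1 setT (X i)) -> (forall i y, L0 <= `|y| -> X i y = 0) ->
  (forall y, 0 <= \sum_i pd i (X i) y) -> forall y, \sum_i pd i (X i) y = 0.
Proof.
move=> X1 X0 D0 y0; set D := fun y => \sum_i pd i (X i) y in D0 *.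
have [//|/eqP Dn] := eqVneq (D y0) 0; exfalso.
have Dp : 0 < D y0 by rewrite lt_def D0 andbT; apply/eqP.
have Xd i y : differentiable (X i) y by apply: Ck_diff (X1 i) _.
have cX i y : {for y, continuous (pd i (X i))} by apply: Ck_continuous (Ck_pd i (X1 i)) _.
have cD : {for y0, continuous D} by apply: (@cvg_sumR R _ _ (nbhs y0)) => i _; exact: cX.
pose dl := D y0 / 2; have dl0 : 0 < dl by rewrite divr_gt0.
have /nbhs_ballP[r /= r0 rP] := cont_near_le cD dl0.
pose d := r / 2; have d0 : 0 < d by rewrite divr_gt0.
have Ddl y : `|y0 - y| <= d -> dl <= D y.
  move=> yd; have : `|D y0 - D y| <= dl.
    by apply: rP; rewrite -ball_normE /=; apply: le_lt_trans yd _; rewrite /d; lra.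
  by rewrite ler_norml => /andP[_]; rewrite /dl; lra.
pose L := `|L0| + `|y0| + 1.
have L0p : 0 < L by rewrite /L; have := normr_ge0 L0; have := normr_ge0 y0; lra.
have y0L : `|y0| < L by rewrite /L; have := normr_ge0 L0; lra.
have XL i y : L <= `|y| -> X i y = 0.
  move=> Ly; apply: X0; apply: le_trans Ly; rewrite /L.
  by have := ler_norm L0; have := normr_ge0 y0; lra.
have [K K0 KP] := natr_dominates (2 * L / d).
have Kd : 2 * L / K%:R <= d.
  by rewrite ler_pdivrMr ?ltr0n// [d * _]mulrC -ler_pdivrMr// ltW.
(* [ka] is the lower bound m^3 dl divided by the number (m K)^3 of nodes. With error ka / 6 for each
   of the three partial derivatives the sum is at most half the lower bound. The order of choices
   matters: K depends on d, e on K, the modulus h on e, and m comes last. *)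
pose ka := dl / (K%:R * (K%:R * K%:R)).
have KR : 0 < K%:R :> R by rewrite ltr0n.
have ka0 : 0 < ka by rewrite divr_gt0// !mulr_gt0.
pose e := ka / 6; have e0 : 0 < e by rewrite divr_gt0.
pose cube := [set y : 'rV[R]_3 | forall j, `[- L, L]%classic (y 0 j)].
have cc : compact cube by apply: (@rV_compact R 3 (fun=> `[- L, L]%classic)) => i; exact: segment_compact.
have unif i : exists2 h : R, 0 < h & forall x y, cube x -> `|x - y| <= h ->
    `|pd i (X i) x - pd i (X i) y| <= e.
  by apply: compact_unif_cont => // x _; exact: cX.
have [h0 h00 h0P] := unif 0; have [h1 h10 h1P] := unif 1; have [h2 h20 h2P] := unif 2.
pose h := Num.min h0 (Num.min h1 h2).
have hp : 0 < h by rewrite !lt_min h00 h10 h20.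
have hP i y z : `|y| <= L -> `|y - z| <= h -> `|pd i (X i) y - pd i (X i) z| <= e.
  move=> yL; rewrite !le_min => /and3P[l0 l1 l2].
  have cy : cube y.
    move=> j /=; rewrite in_itv /= -ler_norml.
    exact: le_trans (coord_le_norm y 0 j) yL.
  case: i => -[|[|[|//]]] ip.
  - by rewrite (_ : Ordinal ip = 0); [exact: h0P|exact/val_inj].
  - by rewrite (_ : Ordinal ip = 1); [exact: h1P|exact/val_inj].
  - by rewrite (_ : Ordinal ip = 2); [exact: h2P|exact/val_inj].
have [m m0 mP] := natr_dominates (2 * L / h).
have mR : 0 < m%:R :> R by rewrite ltr0n.
have M0 : (0 < m * K)%N by rewrite muln_gt0 m0.
have Mh : 2 * L / (m * K)%:R <= h.
  rewrite ler_pdivrMr ?ltr0n// [h * _]mulrC -ler_pdivrMr//; apply: le_trans (ltW mP) _.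
  by rewrite ler_nat leq_pmulr.
have lo := grid_sum_ge D0 (ltW dl0) Ddl y0L Kd m0 K0.
have up i := grid_sum0 (Xd i) L0p M0 (XL i) (fun y z yL yz => hP i y z yL (le_trans yz Mh)).
move: lo up; set t := node _ _ => lo up; move: lo.
have -> : \sum_(0 <= a < m * K) \sum_(0 <= b < m * K) \sum_(0 <= c < m * K) D (pt (t a) (t b) (t c))
  = \sum_i \sum_(0 <= a < m * K) \sum_(0 <= b < m * K) \sum_(0 <= c < m * K)
      pd i (X i) (pt (t a) (t b) (t c)).
  rewrite [RHS]exchange_big; apply: eq_bigr => a _.
  rewrite [RHS]exchange_big; apply: eq_bigr => b _.
  by rewrite [RHS]exchange_big; apply: eq_bigr => c _.
rewrite !big_ord_recl big_ord0 addr0 => lo.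
have u0 := le_trans (ler_norm _) (up ord0).
have u1 := le_trans (ler_norm _) (up (lift ord0 ord0)).
have u2 := le_trans (ler_norm _) (up (lift ord0 (lift ord0 ord0))).
have := le_trans lo (lerD u0 (lerD u1 u2)).
rewrite natrM; set B := _ + _.
have -> : B = m%:R * (m%:R * (m%:R * dl)) / 2.
  by rewrite /B /e /ka; field; rewrite gt_eqF.
have : 0 < m%:R * (m%:R * (m%:R * dl)) by rewrite !mulr_gt0.
lra.
Qed.

End Divergence.

(** * Newton tensor of a symmetric form of rank two *)

Section Algebra3.
Variable R : realFieldType.
Implicit Types (Q : 'I_3 -> 'I_3 -> R) (y w : 'I_3 -> R).

Lemma sum3 (V : nmodType) (F : 'I_3 -> V) : \sum_i F i = F 0 + (F 1 + F 2).
Proof.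
rewrite !big_ord_recl big_ord0 addr0; congr (F _ + (F _ + F _)); exact/val_inj.
Qed.

Definition tr3 Q := \sum_i Q i i.
Definition sq3 Q := \sum_i \sum_j Q i j * Q i j.
(** Second elementary symmetric function of the eigenvalues. For symmetric Q with Q y = 0 and y != 0
    it is the determinant of Q on the plane orthogonal to y. *)
Definition e2 Q := (tr3 Q ^+ 2 - sq3 Q) / 2.

(** Orthogonal projection onto the plane orthogonal to y. *)
Definition perp y (i j : 'I_3) : R := (i == j)%:R - y i * y j / \sum_k y k ^+ 2.

(** Expand the square: the projection has squared norm 2, and its product with Q is tr Q because Q y
    = 0. Nonnegativity of the left-hand side is K <= H^2, and its vanishing is umbilicity. *)
Lemma sq3_perp Q y : \sum_k y k ^+ 2 != 0 ->
  (forall i j, Q i j = Q j i) -> (forall i, \sum_j Q i j * y j = 0) ->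
  \sum_i \sum_j (Q i j - tr3 Q / 2 * perp y i j) ^+ 2 = sq3 Q - tr3 Q ^+ 2 / 2.
Proof.
move=> r0 Qs Qy.
pose pp : R := \sum_i \sum_j perp y i j ^+ 2.
have PP : pp = 2.
  rewrite /pp.
  by rewrite /perp !sum3 /= in r0 *; field.
pose qp : R := \sum_i \sum_j Q i j * perp y i j.
have QP : qp = tr3 Q.
  have -> : qp = tr3 Q -
     (\sum_k y k ^+ 2)^-1 * \sum_i y i * \sum_j Q i j * y j.
    by rewrite /qp /perp /tr3 !sum3 /= in r0 *; field.
  by rewrite [X in _ * X]big1 ?mulr0 ?subr0// => i _; rewrite Qy mulr0.
have -> : \sum_i \sum_j (Q i j - tr3 Q / 2 * perp y i j) ^+ 2 =
   sq3 Q - tr3 Q * qp + tr3 Q ^+ 2 / 4 * pp.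
  rewrite /sq3 /qp /pp; move: (tr3 Q) (perp y) => t P; by rewrite !sum3; field.
by rewrite PP QP; field.
Qed.

(** Lagrange's identity: the difference is half a sum of squares of minors. *)
Lemma cauchy_schwarz (I : finType) (a b : I -> R) :
  (\sum_i a i * b i) ^+ 2 <= (\sum_i a i ^+ 2) * (\sum_i b i ^+ 2).
Proof.
rewrite -subr_ge0.
have -> : (\sum_i a i ^+ 2) * (\sum_i b i ^+ 2) - (\sum_i a i * b i) ^+ 2 =
    2^-1 * \sum_i \sum_j (a i * b j - a j * b i) ^+ 2.
  have -> : \sum_i \sum_j (a i * b j - a j * b i) ^+ 2 =
      \sum_i \sum_j a i ^+ 2 * b j ^+ 2 + \sum_i \sum_j a j ^+ 2 * b i ^+ 2
      - 2 * \sum_i \sum_j (a i * b i) * (a j * b j).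
    rewrite mulr_sumr -big_split -sumrB; apply: eq_bigr => i _.
    rewrite mulr_sumr -big_split -sumrB; apply: eq_bigr => j _.
    by rewrite /=; ring.
  have E1 : \sum_i \sum_j a i ^+ 2 * b j ^+ 2 = (\sum_i a i ^+ 2) * \sum_j b j ^+ 2.
    by rewrite big_distrlr.
  have -> : \sum_i \sum_j a j ^+ 2 * b i ^+ 2 = \sum_i \sum_j a i ^+ 2 * b j ^+ 2.
    by rewrite exchange_big.
  have -> : \sum_i \sum_j a i * b i * (a j * b j) = (\sum_i a i * b i) ^+ 2.
    by rewrite expr2 big_distrlr.
  by rewrite E1; field.
by rewrite mulr_ge0 ?invr_ge0// !sumr_ge0// => i _; apply: sumr_ge0 => j _; exact: sqr_ge0.
Qed.

(** No eigenvalues are used: [e2 Q] being nonnegative says that the Euclidean norm of Q is at most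
    tr Q, and Cauchy-Schwarz over pairs of indices bounds w Q w by that norm times |w|^2. *)
Lemma newton_psd Q w : 0 <= tr3 Q -> 0 <= e2 Q ->
  0 <= \sum_i \sum_j w i * (tr3 Q * (i == j)%:R - Q i j) * w j.
Proof.
move=> t0 e0; pose n := \sum_k w k ^+ 2; pose B := \sum_i \sum_j Q i j * (w i * w j).
have -> : \sum_i \sum_j w i * (tr3 Q * (i == j)%:R - Q i j) * w j = tr3 Q * n - B.
  by rewrite /n /B; move: (tr3 Q) => t; rewrite !sum3 /=; ring.
rewrite subr_ge0; apply: le_trans (ler_norm B) _.
have n0 : 0 <= n by apply: sumr_ge0 => k _; exact: sqr_ge0.
rewrite -(@ler_pXn2r _ 2)// ?nnegrE ?mulr_ge0// real_normK ?num_real//.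
have := @cauchy_schwarz ('I_3 * 'I_3)%type (fun ij => Q ij.1 ij.2) (fun ij => w ij.1 * w ij.2).
rewrite -!(pair_bigA _ (fun i j => Q i j * (w i * w j))) -!(pair_bigA _ (fun i j => Q i j ^+ 2))
  -!(pair_bigA _ (fun i j => (w i * w j) ^+ 2)) /= -/B => /le_trans; apply.
have -> : \sum_i \sum_j Q i j ^+ 2 = sq3 Q by [].
have -> : \sum_i \sum_j (w i * w j) ^+ 2 = n ^+ 2 by rewrite /n !sum3; ring.
rewrite exprMn ler_wpM2r ?sqr_ge0//.
by move: e0; rewrite /e2; lra.
Qed.

(** The second factor is the derivative of [Wf] found in [pd_Wf], with w for the point of S and r
    for |y|^2. Since Q annihilates y on both sides, only tr (T Q) = 2 e2 Q and tr T = 2 tr Q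
    survive, apart from multiples of h tr Q. *)
Lemma newton_contraction Q y w (r h : R) :
  (forall i, \sum_j Q i j * y j = 0) -> (forall j, \sum_i y i * Q i j = 0) ->
  h = \sum_j w j * y j ->
  \sum_k \sum_j (tr3 Q * (k == j)%:R - Q k j) *
    (2 * y k * w j + r * Q k j - w k * y j - h * (k == j)%:R) =
  2 * r * e2 Q - h * tr3 Q.
Proof.
move=> Qy yQ hE; set t := tr3 Q.
have -> : \sum_k \sum_j (t * (k == j)%:R - Q k j) *
    (2 * y k * w j + r * Q k j - w k * y j - h * (k == j)%:R) =
  2 * \sum_j w j * (t * y j - \sum_i y i * Q i j) - \sum_k w k * (t * y k - \sum_j Q k j * y j)
  + r * (t * tr3 Q - sq3 Q) - h * (3 * t - tr3 Q).
  by rewrite /sq3 /tr3; move: t => t; rewrite !sum3 /=; ring.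
have -> : \sum_j w j * (t * y j - \sum_i y i * Q i j) = t * h.
  by rewrite hE mulr_sumr; apply: eq_bigr => j _; rewrite yQ; ring.
have -> : \sum_k w k * (t * y k - \sum_j Q k j * y j) = t * h.
  by rewrite hE mulr_sumr; apply: eq_bigr => j _; rewrite Qy; ring.
by rewrite /e2 -/t; field.
Qed.

(** Divergence of an umbilic Hessian tau / 2 (delta - n n^T) with n = y / |y|, where w stands for
    the gradient of tau and t for tau / (2 |y|). *)
Lemma umbilic_contraction (n w : 'I_3 -> R) k t : \sum_i n i * n i = 1 ->
  \sum_i (2^-1 * w i * ((i == k)%:R - n i * n k) -
    t * (n k * (1 - n i * n i) + n i * ((i == k)%:R - n i * n k))) =
  2^-1 * (w k - (\sum_i n i * w i) * n k) - 2 * t * n k.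
Proof.
move=> n1; have -> : 2 * t * n k = t * (4 * n k - 2 * n k * \sum_i n i * n i).
  by rewrite n1; ring.
have cases : k = 0 \/ k = 1 \/ k = 2.
  by case: k => -[|[|[|//]]] ?; [left|right; left|right; right]; apply/val_inj.
by case: cases => [->|[->|->]]; rewrite !sum3 /=; ring.
Qed.

Lemma newton_orth Q y w :
  \sum_i (\sum_j (tr3 Q * (i == j)%:R - Q i j) * w j) * y i =
  tr3 Q * \sum_j w j * y j - \sum_j w j * \sum_i y i * Q i j.
Proof. by move: (tr3 Q) => t; rewrite !sum3 /=; ring. Qed.

(* With H = t / (2 E) and K = 1 / E, the left-hand side is
   2 E (r (H - p) + h (p H - K)). *)
Lemma integrand_split (E t r h p : R) : 0 < E -> 0 < r -> 0 < h ->
  p <= t / (2 * E) -> E^-1 <= p * (t / (2 * E)) ->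
  exists a b, [/\ 0 <= a, 0 <= b, r * t - 2 * h - p * (2 * r * E - h * t) = a + b &
    a + b = 0 -> t ^+ 2 = 4 * E].
Proof.
move=> E0 r0 h0 p1 p2.
pose a := 2 * E * r * (t / (2 * E) - p); pose b := 2 * E * h * (p * (t / (2 * E)) - E^-1).
have a0 : 0 <= a by rewrite /a mulr_ge0 ?subr_ge0// mulr_ge0 ?(ltW r0)// mulr_ge0// ltW.
have b0 : 0 <= b by rewrite /b mulr_ge0 ?subr_ge0// mulr_ge0 ?(ltW h0)// mulr_ge0// ltW.
exists a, b; split=> //; first by rewrite /a /b; field; rewrite gt_eqF.
move=> /eqP; rewrite paddr_eq0// => /andP[].
rewrite !mulf_eq0 !pnatr_eq0 (gt_eqF E0) (gt_eqF r0) (gt_eqF h0) /= !subr_eq0.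
move=> /eqP <- /eqP E1.
have -> : t ^+ 2 = (t / (2 * E) * (t / (2 * E))) * (4 * E ^+ 2) by field; rewrite gt_eqF.
by rewrite E1; field; rewrite gt_eqF.
Qed.

End Algebra3.

(** * Derivatives at maxima, and the function x |x| *)

Section OneSided.
Variable R : realType.

Lemma derive_pos_right (V : normedModType R) (g : V -> R) y v :
  derivable g y v -> 0 < 'D_v g y ->
  exists2 d : R, 0 < d & forall t, 0 < t < d -> g y < g (y + t *: v).
Proof.
move=> gd D0.
have gc : (fun h : R => h^-1 *: ((g \o shift y) (h *: v) - g y)) @ 0^' --> 'D_v g y by exact: gd.
move/cvgrPdist_lt : gc => /(_ _ D0)[d /= d0 dP]; exists d => // t /andP[t0 td].
have := dP t; rewrite /= sub0r normrN gtr0_norm// => /(_ td (lt0r_neq0 t0)).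
rewrite ltr_distlC => /andP[]; rewrite subrr => H _.
by move: H; rewrite /= pmulr_rgt0 ?invr_gt0// subr_gt0 addrC.
Qed.

Lemma local_max_derive_le0 (V : normedModType R) (g : V -> R) y v :
  derivable g y v -> (\forall z \near y, g z <= g y) -> 'D_v g y <= 0.
Proof.
move=> gd /nbhs_normP[r /= r0 rP]; rewrite leNgt; apply/negP => D0.
have [d d0 dP] := derive_pos_right gd D0.
(* Small enough both for the strict increase and for staying in the ball; the added 1 allows v =
   0. *)
pose t := Num.min (d / 2) (r / (2 * (`|v| + 1))).
have v1 : 0 < `|v| + 1 by rewrite ltr_wpDl.
have t0 : 0 < t by rewrite lt_min !divr_gt0// mulr_gt0.
have td : t < d by rewrite gt_min; apply/orP; left; lra.
have := dP t; rewrite t0 td => /(_ isT).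
apply/negP; rewrite -leNgt; apply: rP; rewrite /ball_ /=.
rewrite opprD addNKr normrN normrZ gtr0_norm//.
apply: le_lt_trans (_ : r / (2 * (`|v| + 1)) * `|v| < _).
  by rewrite ler_wpM2r// ge_min lexx orbT.
rewrite mulrAC ltr_pdivrMr ?mulr_gt0// ltr_pM2l//.
by have := normr_ge0 v; lra.
Qed.

Lemma local_max_derive n (g : 'rV[R]_n.+1 -> R) y v :
  differentiable g y -> (\forall z \near y, g z <= g y) -> 'D_v g y = 0.
Proof.
move=> dg gm; apply/eqP; rewrite eq_le.
rewrite local_max_derive_le0 ?andTb//; last exact: diff_derivable.
have := @local_max_derive_le0 _ g y (- v) (diff_derivable dg) gm.
by rewrite -scaleN1r deriveZdir// mulN1r oppr_le0.
Qed.

(** Away from 0 this is the derivative of a square up to sign. At 0 the differential is 0, because x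
    |x| is at most e |x| in absolute value once |x| <= e. *)
Lemma sgn_sq_derive (x : R) : is_derive x 1 (fun x : R => x * `|x|) (2 * `|x|).
Proof.
have [x0|x0|->] := ltrgtP x 0.
- apply: (@near_eq_is_derive _ _ _ (fun x : R => - (x * x))).
    near=> z; have z0 : z < 0 by near: z; exact: lt_nbhsl.
    by rewrite ltr0_norm// mulrN.
  by apply: is_derive_eq; rewrite ltr0_norm// /GRing.scale /=; ring.
- apply: (@near_eq_is_derive _ _ _ (fun x : R => x * x)).
    near=> z; have z0 : 0 < z by near: z; exact: lt_nbhsr.
    by rewrite gtr0_norm.
  by apply: is_derive_eq; rewrite gtr0_norm// /GRing.scale /=; ring.
- rewrite normr0 mulr0.
  have dc : differentiable (cst 0 : R -> R) (0 : R) by exact: differentiable_cst.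
  have [|e e0|df dE] := @diff_eps_intro R R R (fun x : R => x * `|x|) 0 ('d (cst 0 : R -> R) (0 : R)).
  + exact: diff_continuous.
  + near=> y; have -> : 'd (cst 0 : R -> R) (0 : R) (y - 0) = 0 :> R by rewrite diff_cst.
    rewrite normr0 mulr0 !subr0 normrM normr_id ler_wpM2r//.
  by split; [exact: diff_derivable|rewrite deriveE// dE diff_cst].
Unshelve. all: by end_near. Qed.

End OneSided.

(** * Exponential and logarithm of C^1 functions *)

Section ExpLn.
Variables (R : realType) (n : nat) (U : set 'rV[R]_n.+1) (f : 'rV[R]_n.+1 -> R).
Hypotheses (oU : open U) (f1 : Ck 1 U f).

Lemma expR_C1 : Ck 1 U (fun u => expR (f u)) /\
  forall i u, U u -> pd i (fun u => expR (f u)) u = expR (f u) * pd i f u.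
Proof.
have H1 u : U u -> is_derive (f u) 1 expR (expR (f u)) by move=> _; exact: is_derive_expR.
have H2 u : U u -> {for f u, continuous (@expR R)} by move=> _; exact: continuous_expR.
exact: (C1_comp1 oU f1 H1 H2).
Qed.

Lemma ln_C1 : (forall u, U u -> 0 < f u) -> Ck 1 U (fun u => ln (f u)) /\
  forall i u, U u -> pd i (fun u => ln (f u)) u = (f u)^-1 * pd i f u.
Proof.
move=> f0.
have H1 u : U u -> is_derive (f u) 1 (@ln R) (f u)^-1.
  by move=> Uu; apply: is_derive1_ln; exact: f0.
have H2 u : U u -> {for f u, continuous (fun x : R => x^-1)}.
  by move=> Uu; apply: inv_continuous; rewrite gt_eqF// f0.
exact: (C1_comp1 (g' := fun x : R => x^-1) oU f1 H1 H2).
Qed.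

End ExpLn.

(** * The scalar product and the punctured space *)

Section Punctured.
Variable R : realType.

Lemma segment_const n (F : 'rV[R]_n.+1 -> R) y v :
  (forall t, 0 <= t <= 1 -> differentiable F (y + t *: v)) ->
  (forall t i, 0 <= t <= 1 -> pd i F (y + t *: v) = 0) -> F y = F (y + v).
Proof.
move=> dF F0; apply/esym/eqP; rewrite -subr_eq0.
have [t t01|c /andP[c0 c1] ->] := @segment_mvt R _ F y v; first exact/diff_derivable/dF.
have c01 : 0 <= c <= 1 by rewrite !ltW.
rewrite derive_coordE ?big1//; last exact: dF.
by move=> i _; rewrite -/(pd i F _) F0// mulr0.
Qed.

Lemma dotC n (u v : 'rV[R]_n) : dot u v = dot v u.
Proof. by apply: eq_bigr => i _; rewrite mulrC. Qed.

Lemma dotDl n (u v w : 'rV[R]_n) : dot (u + v) w = dot u w + dot v w.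
Proof. by rewrite -big_split; apply: eq_bigr => i _; rewrite mxE mulrDl. Qed.

Lemma dotZl n (a : R) (u v : 'rV[R]_n) : dot (a *: u) v = a * dot u v.
Proof. by rewrite /dot mulr_sumr; apply: eq_bigr => i _; rewrite mxE mulrA. Qed.

Lemma dotNl n (u v : 'rV[R]_n) : dot (- u) v = - dot u v.
Proof. by rewrite -scaleN1r dotZl mulN1r. Qed.

Lemma dotBl n (u v w : 'rV[R]_n) : dot (u - v) w = dot u w - dot v w.
Proof. by rewrite dotDl dotNl. Qed.

Lemma dot0l n (u : 'rV[R]_n) : dot 0 u = 0.
Proof. by rewrite -(scale0r 0) dotZl mul0r. Qed.

Lemma dot_mulmx n (u v : 'rV[R]_n) : dot u v = (u *m v^T) 0 0.
Proof. by rewrite mxE; apply: eq_bigr => i _; rewrite mxE. Qed.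

Lemma dot_ge0 n (u : 'rV[R]_n) : 0 <= dot u u.
Proof. by apply: sumr_ge0 => j _; rewrite -expr2 sqr_ge0. Qed.

Lemma dot_eq0 n (u : 'rV[R]_n) : (dot u u == 0) = (u == 0).
Proof.
apply/idP/eqP => [|->]; last by rewrite dot0l.
rewrite /dot psumr_eq0 => [/allP y0|j _]; last by rewrite -expr2 sqr_ge0.
apply/rowP => j; rewrite mxE.
by have := y0 j; rewrite mem_index_enum => /(_ isT); rewrite -expr2 sqrf_eq0 => /eqP.
Qed.

Lemma dot_gt0 n (u : 'rV[R]_n) : (0 < dot u u) = (u != 0).
Proof. by rewrite lt_def dot_ge0 andbT dot_eq0. Qed.

Lemma common_orthogonal (y z : 'rV[R]_3) : exists w, [/\ w != 0, dot w y = 0 & dot w z = 0].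
Proof.
pose M : 'M[R]_(3, 1 + 1) := row_mx y^T z^T.
have : kermx M != 0.
  by rewrite kermx_eq0 /row_free neq_ltn (leq_ltn_trans (rank_leq_col M)).
move=> /rowV0Pn[w /sub_kermxP wM wn0]; exists w; rewrite mul_mx_row in wM; split=> //.
  by rewrite dot_mulmx -[w *m y^T](row_mxKl _ (w *m z^T)) wM !mxE.
by rewrite dot_mulmx -[w *m z^T](row_mxKr (w *m y^T)) wM !mxE.
Qed.

(* Two points of the punctured space are joined by two segments through a
   vector orthogonal to both. *)
Lemma punctured_const (F : 'rV[R]_3 -> R) :
  (forall y, y != 0 -> differentiable F y) -> (forall y i, y != 0 -> pd i F y = 0) ->
  forall y z, y != 0 -> z != 0 -> F y = F z.
Proof.
move=> dF F0 y z yn0 zn0; have [w [wn0 wy wz]] := common_orthogonal y z.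
have leg v : v != 0 -> dot w v = 0 -> F v = F w.
  move=> vn0 wv; have E : w = v + (w - v) by rewrite addrC subrK.
  (* Pairing a point of the segment with w gives t times [dot w w]. If the point is 0, then t = 0
     and the point is v. *)
  have seg t : 0 <= t <= 1 -> v + t *: (w - v) != 0.
    move=> /andP[t0 t1]; apply: contra_neq vn0 => s0.
    have : dot (v + t *: (w - v)) w = 0 by rewrite s0 dot0l.
    rewrite dotDl dotZl dotBl [dot v w]dotC wv add0r subr0 => /eqP.
    rewrite mulf_eq0 dot_eq0 (negbTE wn0) orbF => /eqP tE.
    by rewrite -[LHS]addr0 -[RHS]s0 tE scale0r.
  by rewrite [in RHS]E; apply: segment_const => [t t01|t i t01]; [apply/dF/seg|apply/F0/seg].
by rewrite (leg y)// (leg z).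
Qed.

End Punctured.

(** * Support function and inverse Gauss map *)

Section Core.
Variables (R : realType) (q : 'rV[R]_3 -> 'rV[R]_3) (Om : set 'rV[R]_3).
Hypotheses (oO : open Om) (Om_neq0 : forall y, Om y -> y != 0).
Hypothesis q2 : forall j, Ck 2 Om (fun y => q y 0 j).
Hypothesis qmax : forall y z, Om y -> Om z -> dot (q z) y <= dot (q y) y.

(* q y is the point of the surface with outward normal direction y; it is the
   gradient of supp, and hess is the Hessian of supp. *)
Definition hess i j (y : 'rV[R]_3) : R := pd i (fun u => q u 0 j) y.
Definition supp (y : 'rV[R]_3) : R := \sum_j q y 0 j * y 0 j.
Definition rad2 (y : 'rV[R]_3) : R := \sum_j y 0 j * y 0 j.
Local Notation Q := hess.
Local Notation h := supp.
Local Notation r2 := rad2.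

Lemma rad2_ge0 y : 0 <= r2 y. Proof. exact: dot_ge0. Qed.

Lemma rad2_gt0 y : Om y -> 0 < r2 y.
Proof. by move=> /Om_neq0; rewrite -dot_gt0. Qed.

Lemma hess_C1 i j : Ck 1 Om (Q i j). Proof. exact: (Ck_pd i (q2 j)). Qed.

Lemma q_diff j y : Om y -> differentiable (fun u => q u 0 j) y.
Proof. by move=> Oy; exact: Ck_diff (q2 j) Oy. Qed.

Lemma coord_diff n j (y : 'rV[R]_n.+1) : differentiable (fun u : 'rV[R]_n.+1 => u 0 j : R) y.
Proof. exact: differentiable_coord. Qed.

Lemma supp_C2 : Ck 2 Om h.
Proof.
rewrite /supp; apply: (Ck_sum _ oO) => j _; apply: (Ck_mul oO); first exact: q2.
exact: Ck_coord.
Qed.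

Lemma rad2_Ck k U : open U -> Ck k U r2.
Proof. by move=> oU; rewrite /rad2; apply: Ck_sum => // j _; apply: Ck_mul => //; exact: Ck_coord. Qed.

Lemma pd_rad2 i y : pd i r2 y = 2 * y 0 i.
Proof.
rewrite /rad2 pd_sum => [|j]; last by apply: differentiableM; exact: coord_diff.
rewrite (bigD1 i)//= big1 => [|j ji].
  rewrite pdM ?pd_coord ?eqxx; [rewrite /=; ring|exact: coord_diff|exact: coord_diff].
rewrite pdM ?pd_coord ?(negbTE ji) 1?eq_sym ?(negbTE ji) ?mulr0 ?addr0//; exact: coord_diff.
Qed.

Lemma near_Om y : Om y -> \forall z \near y, Om z.
Proof. by move=> Oy; apply: (near_open oO Oy). Qed.

(** By [qmax], z |-> <q z, y> has a maximum at z = y, and its gradient there is the left-hand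
    side. *)
Lemma hess_mulr i y : Om y -> \sum_j Q i j y * y 0 j = 0.
Proof.
move=> Oy.
pose g z := \sum_j q z 0 j * y 0 j.
have dg j : differentiable (fun z => q z 0 j * y 0 j) y.
  by apply: differentiableM; [exact: q_diff|exact: differentiable_cst].
have gd : differentiable g y.
  apply: (@Ck_diff R 2 1 Om) => //; apply: (Ck_sum _ oO) => j _; apply: (Ck_mul oO); first exact: q2.
  exact: Ck_cst.
have gE : pd i g y = 0.
  by apply: local_max_derive => //; apply: filterS (near_Om Oy) => z Oz; exact: qmax.
rewrite -[RHS]gE /g pd_sum//; apply: eq_bigr => j _.
rewrite pdM; [|exact: q_diff|exact: differentiable_cst].
by rewrite pd_cst mulr0 add0r mulrC.
Qed.

(** Envelope argument: the product rule leaves q plus a term with the derivative of q, which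
    [hess_mulr] cancels. *)
Lemma pd_supp i y : Om y -> pd i h y = q y 0 i.
Proof.
move=> Oy; rewrite /supp pd_sum => [|j]; last first.
  by apply: differentiableM; [exact: q_diff|exact: coord_diff].
have -> : q y 0 i = \sum_j (q y 0 j * (i == j)%:R + Q i j y * y 0 j).
  rewrite big_split /= hess_mulr// addr0 (bigD1 i)//= eqxx mulr1 big1 ?addr0// => j ji.
  by rewrite eq_sym (negbTE ji) mulr0.
apply: eq_bigr => j _; rewrite pdM; [|exact: q_diff|exact: coord_diff].
by rewrite pd_coord [X in _ + X]mulrC.
Qed.

(** By [pd_supp], Q consists of the second partial derivatives of the C^2 function [supp]. *)
Lemma hess_sym i j y : Om y -> Q i j y = Q j i y.
Proof.
move=> Oy; have := pdC i j oO Oy supp_C2; congr (_ = _); apply: pd_near_eq.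
  by apply: filterS (near_Om Oy) => z; exact: pd_supp.
by apply: filterS (near_Om Oy) => z; exact: pd_supp.
Qed.

Lemma hess_mull j y : Om y -> \sum_i y 0 i * Q i j y = 0.
Proof.
by move=> Oy; rewrite -[RHS](hess_mulr j Oy); apply: eq_bigr => i _; rewrite mulrC hess_sym.
Qed.

(** A gradient of a convex function is monotone: adding [qmax] for y and y + t e_i, in both orders,
    shows that the i-th coordinate of q does not decrease along e_i. Diagonal entries suffice for
    the sign of the trace. *)
Lemma hess_diag_ge0 i y : Om y -> 0 <= Q i i y.
Proof.
move=> Oy; rewrite leNgt; apply/negP => Qn.
have dN : differentiable (fun u => - q u 0 i) y by apply: differentiableN; exact: q_diff.
have DN : 0 < 'D_'e_i (fun u => - q u 0 i) y.
  by rewrite -/(pd i _ y) pdN ?oppr_gt0//; exact: q_diff.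
have [d d0 dP] := derive_pos_right (diff_derivable dN) DN.
have /nbhs_normP[r /= r0 rP] := near_Om Oy.
pose t := Num.min (d / 2) (r / 2).
have t0 : 0 < t by rewrite lt_min !divr_gt0.
have td : t < d by rewrite gt_min; apply/orP; left; lra.
have tr : t < r by rewrite gt_min; apply/orP; right; lra.
have Oz : Om (y + t *: 'e_i).
  apply: rP; rewrite /ball_ /= opprD addNKr normrN normrZ gtr0_norm//.
  by apply: le_lt_trans tr; rewrite -[leRHS]mulr1 ler_pM2l// delta_norm.
have := dP t; rewrite t0 td => /(_ isT); rewrite ltrN2 => lt1.
have dotE u v : dot u (v + t *: 'e_i) = dot u v + t * u 0 i.
  rewrite /dot (eq_bigr (fun k => u 0 k * v 0 k + t * (u 0 k * (k == i)%:R))); last first.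
    by move=> k _; rewrite !mxE eqxx /=; ring.
  rewrite big_split -mulr_sumr /=; congr (_ + _ * _).
  by rewrite (bigD1 i)//= eqxx mulr1 big1 ?addr0// => k /negbTE ->; rewrite mulr0.
have m1 := qmax Oy Oz; have := qmax Oz Oy; rewrite !dotE => m2.
by have : t * q (y + t *: 'e_i) 0 i < t * q y 0 i; [rewrite ltr_pM2l|lra].
Qed.

Local Notation tau := (fun y => tr3 (fun i j => Q i j y)).
Local Notation E2 := (fun y => e2 (fun i j => Q i j y)).

Hypothesis E2_gt0 : forall y, Om y -> 0 < E2 y.

Lemma tr_ge0 y : Om y -> 0 <= tau y.
Proof. by move=> Oy; apply: sumr_ge0 => i _; exact: hess_diag_ge0. Qed.

Lemma tr_gt0 y : Om y -> 0 < tau y.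
Proof.
move=> Oy; rewrite lt_def tr_ge0// andbT; apply: contraTneq (E2_gt0 Oy) => t0.
rewrite -leNgt /e2 t0 expr0n /= sub0r.
have : 0 <= sq3 (fun i j => Q i j y).
  by do 2! apply: sumr_ge0 => ? _; rewrite -expr2 sqr_ge0.
lra.
Qed.

Lemma tr_C1 : Ck 1 Om tau.
Proof. by apply: (Ck_sum _ oO) => i _; exact: hess_C1. Qed.

Lemma E2_C1 : Ck 1 Om E2.
Proof.
rewrite /e2; apply: (Ck_mul oO); last exact: Ck_cst.
apply: (Ck_sub oO).
  rewrite (_ : (fun u => _) = fun u => tau u * tau u); last by apply/funext => u; rewrite expr2.
  by apply: (Ck_mul oO); exact: tr_C1.
apply: (Ck_sum _ oO) => i _; apply: (Ck_sum _ oO) => j _.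
by apply: (Ck_mul oO); exact: hess_C1.
Qed.

(** Codazzi's equation in homogeneous form. After one use of symmetry, only the second derivatives
    of a single coordinate of q have to be exchanged, so q of class C^2 is enough. *)
Lemma pd_hess_div j y : Om y -> \sum_i pd i (Q i j) y = pd j tau y.
Proof.
move=> Oy; rewrite /tr3 pd_sum => [|i]; last exact: Ck_diff (hess_C1 i i) Oy.
apply: eq_bigr => i _; rewrite -[RHS](pdC i j oO Oy (q2 i)).
apply: pd_near_eq; apply: filterS (near_Om Oy) => z Oz.
by rewrite hess_sym.
Qed.

(* 1 / |y|, which is 1 at y = 0 because ln 0 = 0. *)
Definition irad (y : 'rV[R]_3) : R := expR (- 2^-1 * ln (r2 y)).
Local Notation ir := irad.

Lemma irad_gt0 y : 0 < ir y. Proof. exact: expR_gt0. Qed.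

Lemma irad_sqr y : Om y -> ir y * ir y * r2 y = 1.
Proof.
move=> /rad2_gt0 r0; rewrite /ir -expRD -[X in _ * X]lnK ?posrE// -expRD.
by rewrite -[RHS]expR0; congr expR; field.
Qed.

Lemma irad_C1 : Ck 1 Om ir /\ forall i y, Om y -> pd i ir y = - ir y * y 0 i / r2 y.
Proof.
have r1 : Ck 1 Om r2 by apply: rad2_Ck; exact: oO.
have [l1 lE] := ln_C1 oO r1 (fun y Oy => rad2_gt0 Oy).
have m1 : Ck 1 Om (fun y => - 2^-1 * ln (r2 y)).
  by apply: (Ck_mul oO); [exact: Ck_cst|].
have [e1 eE] := expR_C1 oO m1; split=> // i y Oy.
rewrite eE// pdM; [|exact: differentiable_cst|exact: Ck_diff l1 Oy].
rewrite pd_cst mulr0 addr0 lE// pd_rad2 -/(ir y); field.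
by rewrite gt_eqF// rad2_gt0.
Qed.

Variable sigma : R.
Hypotheses (sigma_ge : -1 <= sigma) (sigma_le : sigma <= 1).

(* At |y| = 1 the principal radii of curvature are the nonzero eigenvalues of the
   Hessian, so H = tau / (2 E2), K = 1 / E2 and psi = H^sigma sqrt(K)^(1 - sigma);
   lnA and lnB are ln H and ln (sqrt K). *)
Definition lnA y := ln (tau y) - ln 2 - ln (E2 y).
Definition lnB y := - 2^-1 * ln (E2 y).
Definition psi y := expR (sigma * lnA y + (1 - sigma) * lnB y).

Lemma lnE2_C1 : Ck 1 Om (fun y => ln (E2 y)).
Proof. by have [] := ln_C1 oO E2_C1 E2_gt0. Qed.

Lemma psi_C1 : Ck 1 Om psi.
Proof.
rewrite /psi; apply: (proj1 (expR_C1 oO _)).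
have A1 : Ck 1 Om lnA.
  rewrite /lnA; apply: (Ck_sub oO); last exact: lnE2_C1.
  apply: (Ck_sub oO); last exact: Ck_cst.
  by have [] := ln_C1 oO tr_C1 tr_gt0.
have B1 : Ck 1 Om lnB by rewrite /lnB; apply: (Ck_mul oO); [exact: Ck_cst|exact: lnE2_C1].
by apply: (Ck_add oO); apply: (Ck_mul oO); do ?exact: Ck_cst.
Qed.

Lemma expR_lnA y : Om y -> expR (lnA y) = tau y / (2 * E2 y).
Proof.
move=> Oy; have t0 := tr_gt0 Oy; have e0 := E2_gt0 Oy.
by rewrite /lnA !expRB !lnK ?posrE// -mulrA -invfM.
Qed.

Lemma expR_lnB y : Om y -> expR (lnB y) * expR (lnB y) = (E2 y)^-1.
Proof.
move=> Oy; have e0 := E2_gt0 Oy.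
rewrite -expRD -[RHS]lnK ?posrE ?invr_gt0// lnV ?posrE//=; congr expR.
by rewrite /lnB; field.
Qed.

Lemma sq3_perp_hess y : Om y ->
  \sum_i \sum_j (Q i j y - tau y / 2 * perp (fun i => y 0 i) i j) ^+ 2 =
  sq3 (fun i j => Q i j y) - tau y ^+ 2 / 2.
Proof.
move=> Oy; rewrite sq3_perp//.
- rewrite (eq_bigr (fun j => y 0 j * y 0 j)); first by rewrite gt_eqF// rad2_gt0.
  by move=> j _; rewrite expr2.
- by move=> i j; exact: hess_sym.
- by move=> i; exact: hess_mulr.
Qed.

(** The inequality K <= H^2 written with radii of curvature. *)
Lemma E2_le_tr y : Om y -> 4 * E2 y <= tau y ^+ 2.
Proof.
move=> Oy; have : 0 <= sq3 (fun i j => Q i j y) - tau y ^+ 2 / 2.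
  by rewrite -sq3_perp_hess//; do 2! apply: sumr_ge0 => ? _; rewrite sqr_ge0.
rewrite /e2; lra.
Qed.

Lemma lnB_le_lnA y : Om y -> lnB y <= lnA y.
Proof.
move=> Oy.
have aux (E t : R) : 0 < E -> 0 < t -> 4 * E <= t ^+ 2 ->
    - 2^-1 * ln E <= ln t - ln 2 - ln E.
  move=> e0 t0; have -> : 4 * E = 2 * (2 * E) by ring.
  have e02 : 0 < 2 * E by rewrite mulr_gt0.
  rewrite expr2 -ler_ln ?posrE; [|exact: mulr_gt0|exact: mulr_gt0].
  by rewrite !lnM ?posrE//; lra.
by apply: aux; [exact: E2_gt0|exact: tr_gt0|exact: E2_le_tr].
Qed.

(** After taking logarithms the gap is (1 - sigma) (lnA - lnB); this is where sigma <= 1 enters. *)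
Lemma psi_le y : Om y -> psi y <= tau y / (2 * E2 y).
Proof.
move=> Oy; rewrite -expR_lnA// /psi ler_expR.
have : 0 <= (1 - sigma) * (lnA y - lnB y) by rewrite mulr_ge0 ?subr_ge0// lnB_le_lnA.
lra.
Qed.

(** After taking logarithms the gap is (1 + sigma) (lnA - lnB); this is where -1 <= sigma enters. *)
Lemma psi_ge y : Om y -> (E2 y)^-1 <= psi y * (tau y / (2 * E2 y)).
Proof.
move=> Oy; rewrite -expR_lnA// -expR_lnB// -!expRD ler_expR.
have : 0 <= (1 + sigma) * (lnA y - lnB y).
  by rewrite mulr_ge0 ?subr_ge0 ?lnB_le_lnA// addrC -lerBlDr sub0r.
lra.
Qed.

(* Wf = |y|^3 grad (supp / |y|) is tangent to the spheres centred at 0, and Tf is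
   the first Newton tensor of the Hessian, whose rows have divergence 0. *)
Definition Wf i y := r2 y * q y 0 i - h y * y 0 i.
Definition Tf i j y := tau y * (i == j)%:R - Q i j y.
Definition Vf i y := \sum_j Tf i j y * Wf j y.
Definition Zf i y := Wf i y - psi y * Vf i y.

Lemma q1 j : Ck 1 Om (fun y => q y 0 j). Proof. exact: CkS. Qed.

Lemma supp_C1 : Ck 1 Om h. Proof. by apply: CkS; exact: supp_C2. Qed.

Lemma Wf_C1 i : Ck 1 Om (Wf i).
Proof.
rewrite /Wf; apply: (Ck_sub oO); apply: (Ck_mul oO).
- by apply: rad2_Ck; exact: oO.
- exact: q1.
- exact: supp_C1.
- exact: Ck_coord.
Qed.

Lemma Tf_C1 i j : Ck 1 Om (Tf i j).
Proof.
rewrite /Tf; apply: (Ck_sub oO); last exact: hess_C1.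
by apply: (Ck_mul oO); [exact: tr_C1|exact: Ck_cst].
Qed.

Lemma Vf_C1 i : Ck 1 Om (Vf i).
Proof.
rewrite /Vf; apply: (Ck_sum _ oO) => j _.
by apply: (Ck_mul oO); [exact: Tf_C1|exact: Wf_C1].
Qed.

Lemma Zf_C1 i : Ck 1 Om (Zf i).
Proof.
rewrite /Zf; apply: (Ck_sub oO); first exact: Wf_C1.
by apply: (Ck_mul oO); [exact: psi_C1|exact: Vf_C1].
Qed.

Lemma pd_Wf k j y : Om y -> pd k (Wf j) y =
  2 * y 0 k * q y 0 j + r2 y * Q k j y - q y 0 k * y 0 j - h y * (k == j)%:R.
Proof.
move=> Oy; have dr : differentiable r2 y by exact: (@Ck_diff R 2 0 Om r2 y (rad2_Ck 1 oO) Oy).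
have dh : differentiable h y by exact: Ck_diff supp_C1 Oy.
have dq := q_diff j Oy; have dy := coord_diff j y.
rewrite /Wf pdD; [|exact: differentiableM|by apply: differentiableN; exact: differentiableM].
rewrite pdN; last exact: differentiableM.
rewrite !pdM// pd_coord pd_rad2 pd_supp// -/(Q k j y); ring.
Qed.

Lemma Wf_orth y : \sum_i Wf i y * y 0 i = 0.
Proof. by rewrite /Wf /h /r2 !sum3; ring. Qed.

Lemma Vf_orth y : Om y -> \sum_i Vf i y * y 0 i = 0.
Proof.
move=> Oy; rewrite /Vf.
rewrite (newton_orth (fun i j => Q i j y) (fun i => y 0 i) (fun j => Wf j y)).
by rewrite Wf_orth mulr0 sub0r big1 ?oppr0// => j _; rewrite hess_mull// mulr0.
Qed.

Lemma pd_Tf k i j y : Om y -> pd k (Tf i j) y = (i == j)%:R * pd k tau y - pd k (Q i j) y.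
Proof.
move=> Oy; have dt : differentiable tau y by exact: Ck_diff tr_C1 Oy.
have dQ : differentiable (Q i j) y by exact: Ck_diff (hess_C1 i j) Oy.
have dc : differentiable (fun=> (i == j)%:R : R) y by exact: differentiable_cst.
rewrite /Tf pdD; [|exact: differentiableM|exact: differentiableN].
by rewrite pdN// pdM// pd_cst mulr0 add0r.
Qed.

(** The divergence of W is r2 tau - 2 h and that of T W is 2 r2 E2 - h tau. In the latter the
    derivatives of T cancel by [pd_hess_div], and [newton_contraction] evaluates what remains. *)
Lemma div_Zf y : Om y -> \sum_k pd k (Zf k) y =
  r2 y * tau y - 2 * h y - psi y * (2 * r2 y * E2 y - h y * tau y)
  - \sum_k pd k psi y * Vf k y.
Proof.
move=> Oy.
have dW j : differentiable (Wf j) y by exact: Ck_diff (Wf_C1 j) Oy.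
have dV j : differentiable (Vf j) y by exact: Ck_diff (Vf_C1 j) Oy.
have dT i j : differentiable (Tf i j) y by exact: Ck_diff (Tf_C1 i j) Oy.
have dp : differentiable psi y by exact: Ck_diff psi_C1 Oy.
have ZE k : pd k (Zf k) y = pd k (Wf k) y - psi y * pd k (Vf k) y - pd k psi y * Vf k y.
  rewrite /Zf pdD//; last by apply: differentiableN; exact: differentiableM.
  by rewrite pdN ?pdM//; [ring|exact: differentiableM].
have VE k : pd k (Vf k) y = \sum_j (Tf k j y * pd k (Wf j) y + Wf j y * pd k (Tf k j) y).
  rewrite /Vf pd_sum => [|j]; last exact: differentiableM.
  by apply: eq_bigr => j _; rewrite pdM.
rewrite (eq_bigr _ (fun k _ => ZE k)) 2!sumrB -mulr_sumr.
congr (_ - _ * _ - _).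
  rewrite (eq_bigr _ (fun k _ => pd_Wf k k Oy)).
  by rewrite /h /r2 /tr3 !sum3 /=; ring.
rewrite (eq_bigr _ (fun k _ => VE k)).
rewrite (eq_bigr (fun k => \sum_j Tf k j y * pd k (Wf j) y + \sum_j Wf j y * pd k (Tf k j) y));
  last by move=> k _; rewrite big_split.
rewrite big_split /= [X in _ + X]exchange_big /= [X in _ + X]big1 => [|j _]; last first.
  rewrite -mulr_sumr (eq_bigr _ (fun k _ => pd_Tf k k j Oy)) sumrB pd_hess_div//.
  rewrite (bigD1 j)//= eqxx mul1r big1 ?addr0 ?subrr ?mulr0// => k /negbTE ->.
  by rewrite mul0r.
rewrite addr0 -(newton_contraction (r2 y) (fun i => hess_mulr i Oy) (fun j => hess_mull j Oy) (erefl (h y))).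
by apply: eq_bigr => k _; apply: eq_bigr => j _; rewrite pd_Wf.
Qed.

Variable f : R -> R.
Hypothesis f_gt0 : forall s, 0 < s -> 0 < f s.
Hypothesis f_decr : forall s t, 0 < s -> s < t -> f t <= f s.
(** For the inverse Gauss map, [supp] and [psi] have degree 1, as tau and E2 have degrees -1 and -2.
    Division by |y| gives the degree 0 extensions of rho and of the argument of f. *)
Hypothesis rel : forall y, Om y -> h y * ir y = f (psi y * ir y).

Lemma phi_gt0 y : 0 < psi y * ir y.
Proof. by apply: mulr_gt0; exact: expR_gt0. Qed.

Lemma supp_gt0 y : Om y -> 0 < h y.
Proof. by move=> Oy; rewrite -(pmulr_lgt0 _ (irad_gt0 y)) rel//; exact/f_gt0/phi_gt0. Qed.

Lemma pd_nsupp k y : Om y -> pd k (fun y => h y * ir y) y = ir y / r2 y * Wf k y.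
Proof.
move=> Oy; have [i1 iE] := irad_C1.
rewrite pdM; [|exact: Ck_diff supp_C1 Oy|exact: Ck_diff i1 Oy].
rewrite iE// pd_supp// /Wf; field.
by rewrite gt_eqF// rad2_gt0.
Qed.

Lemma pd_phi k y : Om y ->
  pd k (fun y => psi y * ir y) y = ir y * pd k psi y - psi y * ir y / r2 y * y 0 k.
Proof.
move=> Oy; have [i1 iE] := irad_C1.
rewrite pdM; [|exact: Ck_diff psi_C1 Oy|exact: Ck_diff i1 Oy].
rewrite iE//; field.
by rewrite gt_eqF// rad2_gt0.
Qed.

(** A short step along v would strictly increase both functions, while [rel] and the monotonicity of
    f forbid this. Only values of f at two points are compared, so f may be discontinuous. *)
Lemma phi_supp_opposite y v : Om y ->
  0 < 'D_v (fun y => psi y * ir y) y -> 0 < 'D_v (fun y => h y * ir y) y -> False.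
Proof.
move=> Oy D1 D2; have [i1 _] := irad_C1.
have d1 : differentiable (fun y => psi y * ir y) y.
  by apply: differentiableM; [exact: Ck_diff psi_C1 Oy|exact: Ck_diff i1 Oy].
have d2 : differentiable (fun y => h y * ir y) y.
  by apply: differentiableM; [exact: Ck_diff supp_C1 Oy|exact: Ck_diff i1 Oy].
have [e1 e10 e1P] := derive_pos_right (diff_derivable d1) D1.
have [e2 e20 e2P] := derive_pos_right (diff_derivable d2) D2.
have /nbhs_normP[r /= r0 rP] := near_Om Oy.
have v1 : 0 < `|v| + 1 by rewrite ltr_wpDl.
pose t := Num.min (Num.min (e1 / 2) (e2 / 2)) (r / (`|v| + 1)).
have t0 : 0 < t by rewrite !lt_min !divr_gt0.
have te1 : t < e1 by rewrite !gt_min; apply/orP; left; apply/orP; left; lra.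
have te2 : t < e2 by rewrite !gt_min; apply/orP; left; apply/orP; right; lra.
have Oz : Om (y + t *: v).
  apply: rP; rewrite /ball_ /= opprD addNKr normrN normrZ gtr0_norm//.
  apply: le_lt_trans (_ : r / (`|v| + 1) * `|v| < _).
    by rewrite ler_wpM2r// ge_min lexx orbT.
  by rewrite mulrAC ltr_pdivrMr// ltr_pM2l// ltrDl.
have := e1P t; rewrite t0 te1 => /(_ isT) lt1.
have := e2P t; rewrite t0 te2 => /(_ isT); rewrite !rel// ltNge => /negP; apply.
by apply: f_decr => //; exact: phi_gt0.
Qed.

Lemma Vf_Wf_ge0 y : Om y -> 0 <= \sum_k Vf k y * Wf k y.
Proof.
move=> Oy; have := newton_psd (fun k => Wf k y) (tr_ge0 Oy) (ltW (E2_gt0 Oy)).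
congr (_ <= _); apply: eq_bigr => i _.
by rewrite /Vf mulr_suml; apply: eq_bigr => j _; rewrite /Tf; ring.
Qed.

(* Tf is positive semidefinite, so h / |y| has a nonnegative derivative along
   Vf = Tf Wf; if psi / |y| increased along Vf, both functions would increase along
   Vf + e Wf for small e > 0, and f would not be decreasing. *)
Lemma psi_Vf_le0 y : Om y -> \sum_k pd k psi y * Vf k y <= 0.
Proof.
move=> Oy; have [i1 _] := irad_C1.
pose p k := pd k (fun y => psi y * ir y) y.
have SE : \sum_k p k * Vf k y = ir y * \sum_k pd k psi y * Vf k y.
  rewrite (eq_bigr (fun k => ir y * (pd k psi y * Vf k y) - psi y * ir y / r2 y * (Vf k y * y 0 k))).
    by rewrite sumrB -!mulr_sumr Vf_orth// mulr0 subr0.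
  by move=> k _; rewrite /p pd_phi//; ring.
rewrite leNgt; apply/negP; rewrite -(pmulr_rgt0 _ (irad_gt0 y)) -SE => S0.
have d1 : differentiable (fun y => psi y * ir y) y.
  by apply: differentiableM; [exact: Ck_diff psi_C1 Oy|exact: Ck_diff i1 Oy].
have d2 : differentiable (fun y => h y * ir y) y.
  by apply: differentiableM; [exact: Ck_diff supp_C1 Oy|exact: Ck_diff i1 Oy].
pose n := \sum_k Wf k y * Wf k y.
(* If W vanished at y, so would V = T W and with it the sum S, which is assumed positive. *)
have n0 : 0 < n.
  rewrite lt_def; apply/andP; split; last by apply: sumr_ge0 => k _; rewrite -expr2 sqr_ge0.
  apply: contraTneq S0 => /eqP.
  rewrite psumr_eq0 => [/allP W0|k _]; last by rewrite -expr2 sqr_ge0.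
  have {}W0 k : Wf k y = 0.
    by have := W0 k; rewrite mem_index_enum => /(_ isT); rewrite -expr2 sqrf_eq0 => /eqP.
  rewrite big1 ?ltxx// => k _; rewrite /Vf big1 ?mulr0// => j _.
  by rewrite W0 mulr0.
pose m := \sum_k p k * Wf k y.
pose S := \sum_k p k * Vf k y.
(* Makes |e m| at most S / 2, so the W part cannot spoil the sign of S; the added 1 allows m = 0. *)
pose e := S / (2 * (`|m| + 1)).
have m1 : 0 < `|m| + 1 by rewrite ltr_wpDl.
have e0 : 0 < e by rewrite divr_gt0// mulr_gt0.
pose v : 'rV[R]_3 := \row_k (Vf k y + e * Wf k y).
apply: (@phi_supp_opposite y v Oy).
  rewrite derive_coordE//.
  have -> : \sum_i v 0 i * 'D_'e_i (fun y => psi y * ir y) y = S + e * m.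
    rewrite /S /m mulr_sumr -big_split; apply: eq_bigr => k _.
    by rewrite mxE -/(pd k _ y) -/(p k) /=; ring.
  have : `|e * m| <= S / 2.
    rewrite normrM gtr0_norm// /e mulrAC ler_pdivrMr ?mulr_gt0//.
    have := ltW S0; rewrite -/S => S0'.
    have -> : S / 2 * (2 * (`|m| + 1)) = S * (`|m| + 1) by field.
    by rewrite ler_wpM2l// lerDl.
  rewrite ler_norml => /andP[l1 _]; move: S0; rewrite -/S => S0; lra.
rewrite derive_coordE//.
have -> : \sum_i v 0 i * 'D_'e_i (fun y => h y * ir y) y =
    ir y / r2 y * (\sum_k Vf k y * Wf k y + e * n).
  rewrite /n mulr_sumr -big_split mulr_sumr; apply: eq_bigr => k _.
  by rewrite mxE -/(pd k _ y) pd_nsupp//=; ring.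
apply: mulr_gt0; first by apply: divr_gt0; [exact: irad_gt0|exact: rad2_gt0].
by rewrite ltr_wpDl ?Vf_Wf_ge0// mulr_gt0.
Qed.

Lemma div_Zf_split y : Om y -> exists a b c : R, [/\ 0 <= a, 0 <= b, 0 <= c,
  \sum_k pd k (Zf k) y = a + b + c & a + b = 0 -> tau y ^+ 2 = 4 * E2 y].
Proof.
move=> Oy.
have [a [b [a0 b0 abE ab0]]] := integrand_split (E2_gt0 Oy) (rad2_gt0 Oy) (supp_gt0 Oy)
  (psi_le Oy) (psi_ge Oy).
exists a, b, (- \sum_k pd k psi y * Vf k y); split=> //; first by rewrite oppr_ge0 psi_Vf_le0.
by rewrite div_Zf// abE.
Qed.

(** Pointwise facts such as [hess_sym] and [psi_le] are also applied on the directions of inner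
    contact points before these are known to be all directions. The integral argument below needs
    them all. *)
Hypothesis Om_full : forall y, y != 0 -> Om y.

Section CutOff.
Variable y0 : 'rV[R]_3.
Hypothesis Oy0 : Om y0.

(* A C^1 cutoff: 2 x^2 for x >= 0 and 0 for x <= 0.  Zf is tangent to the spheres, so
   multiplying it by a radial function only multiplies its divergence. *)
Let g (x : R) := x * x + x * `|x|.
(** Positive exactly on the shell |y0|^2 / 2 < |y|^2 < 2 |y0|^2, which contains y0. *)
Let bf y := (r2 y - r2 y0 / 2) * (2 * r2 y0 - r2 y).
Let eta y := g (bf y).
Let X k y := eta y * Zf k y.

Let g_ge0 x : 0 <= g x.
Proof.
rewrite /g -mulrDr; have [x0|x0] := leP 0 x; first by rewrite mulr_ge0// addr_ge0.
by rewrite ltr0_norm// subrr mulr0.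
Qed.

Let g_neg x : x <= 0 -> g x = 0.
Proof. by move=> x0; rewrite /g ler0_norm// mulrN subrr. Qed.

Let bf_C1 U : open U -> Ck 1 U bf.
Proof.
move=> oU; rewrite /bf; apply: (Ck_mul oU); apply: (Ck_sub oU).
- exact: rad2_Ck.
- exact: Ck_cst.
- exact: Ck_cst.
- exact: rad2_Ck.
Qed.

Let eta_C1 : Ck 1 setT eta /\ forall k y, pd k eta y = (2 * bf y + 2 * `|bf y|) * pd k bf y.
Proof.
have H1 u : setT u -> is_derive (bf u) 1 g (2 * bf u + 2 * `|bf u|).
  move=> _; apply: is_deriveD; last exact: sgn_sq_derive.
  by apply: is_derive_eq; rewrite /GRing.scale /=; ring.
have H2 u : setT u -> {for bf u, continuous (fun x : R => 2 * x + 2 * `|x|)}.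
  move=> _; apply: cont_add; apply: cont_mul; do ?exact: cst_continuous.
    exact: cvg_id.
  exact: norm_continuous.
have [e1 eE] := C1_comp1 (g' := fun x : R => 2 * x + 2 * `|x|) openT (bf_C1 openT) H1 H2.
by split=> // k y; exact: eE.
Qed.

Let pd_bf k y : pd k bf y = 2 * y 0 k * (5 / 2 * r2 y0 - 2 * r2 y).
Proof.
have dr : differentiable r2 y by exact: (@Ck_diff R 2 0 setT r2 y (rad2_Ck 1 openT) I).
have d1 : differentiable (fun y => r2 y - r2 y0 / 2) y.
  by apply: differentiableB => //; exact: differentiable_cst.
have d2 : differentiable (fun y => 2 * r2 y0 - r2 y) y.
  by apply: differentiableB => //; exact: differentiable_cst.
have E1 : pd k (fun y => r2 y - r2 y0 / 2) y = 2 * y 0 k.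
  rewrite (@pdD _ _ k r2 (fun=> - (r2 y0 / 2)))//.
  by rewrite pd_cst addr0 pd_rad2.
have E3 : pd k (fun y => 2 * r2 y0 - r2 y) y = - (2 * y 0 k).
  rewrite (@pdD _ _ k (fun=> 2 * r2 y0) (fun z => - r2 z)).
  - by rewrite pd_cst add0r pdN// pd_rad2.
  - exact: differentiable_cst.
  - exact: differentiableN.
by rewrite /bf pdM// E1 E3; field.
Qed.

(** The only point outside Om is 0, and the shell stays away from it. This makes X a C^1 field on
    the whole space although nothing is known of Z at 0. *)
Let X_zero y : ~ Om y -> \forall z \near y, forall k, X k z = 0.
Proof.
move=> nO; have cr : {for y, continuous r2}.
  exact: (@Ck_continuous R 2 1 setT r2 y (rad2_Ck 1 openT) I).
have r00 := rad2_gt0 Oy0.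
have ry : r2 y = 0.
  have -> : y = 0 by apply: contra_notP nO => /eqP; exact: Om_full.
  by rewrite /rad2 big1// => j _; rewrite mxE mul0r.
have := cont_near_le cr (divr_gt0 r00 (ltr0n _ 4)).
apply: filterS => z; rewrite ry sub0r normrN ger0_norm ?rad2_ge0// => rz k.
rewrite /X /eta g_neg ?mul0r// /bf mulr_le0_ge0//; first by lra.
lra.
Qed.

Let X_C1 k : Ck 1 setT (X k).
Proof.
apply: Ck_local => y _; have [Oy|nO] := pselect (Om y).
  exists Om => //; apply: (Ck_mul oO); last exact: Zf_C1.
  by apply: Ck_subset (proj1 eta_C1).
have [V [oV Vy VP]] := near_ex_open (X_zero nO).
exists V => //; apply: (@Ck_ext _ _ 1 V (fun=> 0)) => //; last exact: Ck_cst.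
by move=> z Vz; rewrite VP.
Qed.

Let div_X y : \sum_k pd k (X k) y = if y == 0 then 0 else eta y * \sum_k pd k (Zf k) y.
Proof.
case: eqP => [yE|/eqP/Om_full Oy].
  rewrite big1// => k _.
  rewrite (@pd_near_eq _ _ _ _ (fun=> 0)) ?pd_cst//.
  by apply: filterS (X_zero _) => // /Om_neq0; rewrite yE eqxx.
have [e1 eE] := eta_C1.
rewrite mulr_sumr (eq_bigr (fun k => eta y * pd k (Zf k) y +
   2 * (2 * bf y + 2 * `|bf y|) * (5 / 2 * r2 y0 - 2 * r2 y) * (Zf k y * y 0 k))).
  rewrite big_split /= -!mulr_sumr.
  have -> : \sum_k Zf k y * y 0 k = 0.
    rewrite /Zf (eq_bigr (fun k => Wf k y * y 0 k - psi y * (Vf k y * y 0 k))).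
      by rewrite sumrB -mulr_sumr Wf_orth Vf_orth// mulr0 subr0.
    by move=> k _; ring.
  by rewrite mulr0 addr0.
move=> k _; rewrite /X pdM; first by rewrite eE pd_bf; ring.
  exact: (@Ck_diff R 2 0 setT eta y e1 I).
exact: Ck_diff (Zf_C1 k) Oy.
Qed.

Lemma umbilic : tau y0 ^+ 2 = 4 * E2 y0.
Proof.
have r00 := rad2_gt0 Oy0.
have ge0 y : 0 <= \sum_k pd k (X k) y.
  rewrite div_X; case: eqP => // /eqP/Om_full Oy; rewrite mulr_ge0 ?g_ge0//.
  by have [a [b [c [a0 b0 c0 -> _]]]] := div_Zf_split Oy; rewrite !addr_ge0.
(* The norm is the sup norm, which is at most the Euclidean one; so |y|^2 is at least (1 + 2 a)^2 >=
   2 a with a = |y0|^2, beyond the outer sphere of the shell. *)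
have far k y : 1 + 2 * r2 y0 <= `|y| -> X k y = 0.
  move=> yL; rewrite /X /eta g_neg ?mul0r// /bf.
  have : `|y| ^+ 2 <= r2 y.
    have rs : 0 <= Num.sqrt (r2 y) by exact: sqrtr_ge0.
    rewrite -(sqr_sqrtr (rad2_ge0 y)) ler_pXn2r ?nnegrE//.
    apply: norm_le_coord => // i j; rewrite ord1 -sqrtr_sqr ler_wsqrtr//.
    rewrite /rad2 (bigD1 j)//= -expr2 lerDl.
    by apply: sumr_ge0 => l _; rewrite -expr2 sqr_ge0.
  have : (1 + 2 * r2 y0) ^+ 2 <= `|y| ^+ 2 by rewrite ler_pXn2r ?nnegrE//; lra.
  move=> l1 l2; have l3 : 2 * r2 y0 <= r2 y.
    apply: le_trans l2; apply: le_trans l1; rewrite expr2.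
    have : 0 <= r2 y0 * r2 y0 by rewrite mulr_ge0// ltW.
    lra.
  by rewrite mulr_ge0_le0//; lra.
have := compact_divergence X_C1 far ge0 y0.
rewrite div_X; case: eqP => [yE|_]; first by move: (Om_neq0 Oy0); rewrite yE eqxx.
have [a [b [c [a0 b0 c0 -> abE]]]] := div_Zf_split Oy0.
have eta0 : 0 < eta y0.
  have b0' : 0 < bf y0 by rewrite /bf mulr_gt0//; lra.
  by rewrite /eta /g gtr0_norm// addr_gt0// mulr_gt0.
move=> /eqP; rewrite mulf_eq0 gt_eqF//= => /eqP abc; apply: abE; lra.
Qed.

End CutOff.

Let nrm (k : 'I_3) (y : 'rV[R]_3) : R := y 0 k * ir y.

Let sum_nrm y : Om y -> \sum_k nrm k y * nrm k y = 1.
Proof.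
move=> Oy; rewrite -[RHS](irad_sqr Oy) /rad2 mulr_sumr.
by apply: eq_bigr => k _; rewrite /nrm; ring.
Qed.

Lemma perp_nrm y i j : Om y -> perp (fun i => y 0 i) i j = (i == j)%:R - nrm i y * nrm j y.
Proof.
move=> Oy; rewrite /perp; congr (_ - _).
have -> : \sum_k y 0 k ^+ 2 = r2 y by apply: eq_bigr => k _; rewrite expr2.
have r0 := rad2_gt0 Oy; have := irad_sqr Oy; rewrite /nrm => iE.
have -> : y 0 i * ir y * (y 0 j * ir y) = y 0 i * y 0 j * (ir y * ir y * r2 y) / r2 y.
  by field; rewrite gt_eqF.
by rewrite iE mulr1.
Qed.

Lemma hess_umbilic y i j : Om y -> Q i j y = tau y / 2 * ((i == j)%:R - nrm i y * nrm j y).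
Proof.
move=> Oy; rewrite -perp_nrm//; apply/eqP; rewrite -subr_eq0 -sqrf_eq0; apply/eqP.
have sqz : \sum_i \sum_j (Q i j y - tau y / 2 * perp (fun i => y 0 i) i j) ^+ 2 = 0.
  by rewrite sq3_perp_hess//; have := umbilic Oy; rewrite /e2; lra.
have ge0 k l : 0 <= (Q k l y - tau y / 2 * perp (fun i => y 0 i) k l) ^+ 2 by rewrite sqr_ge0.
move: sqz => /eqP; rewrite psumr_eq0 => [/allP H|k _]; last exact: sumr_ge0.
have := H i; rewrite mem_index_enum => /(_ isT) /=.
rewrite psumr_eq0 => [/allP H2|k _]; last exact: ge0.
by have := H2 j; rewrite mem_index_enum => /(_ isT) /eqP.
Qed.

Let nrm_diff k y : Om y -> differentiable (nrm k) y.
Proof.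
by move=> Oy; apply: differentiableM; [exact: coord_diff|exact: Ck_diff (proj1 irad_C1) Oy].
Qed.

Let pd_nrm i k y : Om y -> pd i (nrm k) y = ir y * ((i == k)%:R - nrm i y * nrm k y).
Proof.
move=> Oy; have [i1 iE] := irad_C1.
rewrite /nrm pdM ?pd_coord ?iE//; last 2 first.
- exact: coord_diff.
- exact: Ck_diff i1 Oy.
have r0 := rad2_gt0 Oy; have E := irad_sqr Oy.
have -> : ir y * ((i == k)%:R - y 0 i * ir y * (y 0 k * ir y)) =
   ir y * (i == k)%:R - ir y * y 0 i * y 0 k * (ir y * ir y * r2 y) / r2 y.
  by field; rewrite gt_eqF.
by rewrite E; field; rewrite gt_eqF.
Qed.

(** A form of Schur's lemma. [pd_hess_div] says that the gradient w of tau is the divergence of the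
    Hessian; computing this divergence from the umbilic form gives a second expression, and
    comparing the two shows that w is radial. *)
Let pd_tr j y : Om y -> pd j tau y = - tau y * ir y * nrm j y.
Proof.
move=> Oy; have dt : differentiable tau y by exact: Ck_diff tr_C1 Oy.
pose w k := pd k tau y; pose s := \sum_k nrm k y * w k.
have wE k : w k = - (s + 2 * tau y * ir y) * nrm k y.
  have := pd_hess_div k Oy; rewrite -/(w k).
  have -> : \sum_i pd i (Q i k) y = 2^-1 * (w k - s * nrm k y) - tau y * ir y * nrm k y.
    have QE i : pd i (Q i k) y = 2^-1 * w i * ((i == k)%:R - nrm i y * nrm k y) -
       tau y / 2 * ir y * (nrm k y * (1 - nrm i y * nrm i y)
        + nrm i y * ((i == k)%:R - nrm i y * nrm k y)).
      have -> : pd i (Q i k) y = pd i (fun z => tau z * (2^-1 * ((i == k)%:R - nrm i z * nrm k z))) y.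
        apply: pd_near_eq; apply: filterS (near_Om Oy) => z Oz.
        by rewrite hess_umbilic//; ring.
      have dn : differentiable (fun z => nrm i z * nrm k z) y by apply: differentiableM; exact: nrm_diff.
      have dN : differentiable (fun z => - (nrm i z * nrm k z)) y by exact: differentiableN.
      have dC : differentiable (fun z => (i == k)%:R - nrm i z * nrm k z) y.
        by apply: differentiableD => //; exact: differentiable_cst.
      have d2 : differentiable (fun=> 2^-1 : R) y by exact: differentiable_cst.
      have dik : differentiable (fun=> (i == k)%:R : R) y by exact: differentiable_cst.
      have d3 : differentiable (fun z => 2^-1 * ((i == k)%:R - nrm i z * nrm k z)) y.
        exact: differentiableM.
      have dni := nrm_diff i Oy; have dnk := nrm_diff k Oy.
      rewrite pdM// (pdM i d2 dC) (pdD i dik dN) (pdN i dn) (pdM i dni dnk).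
      by rewrite !pd_cst !pd_nrm// eqxx /w /=; field.
    rewrite (eq_bigr _ (fun i _ => QE i)) umbilic_contraction ?sum_nrm// -/s.
    by congr (_ - _ * _); field.
  by lra.
(* Pairing [wE] with the unit vector y / |y| turns it into a linear equation for s alone. *)
have sE : s = - tau y * ir y.
  have : s = - (s + 2 * tau y * ir y).
    rewrite {1}/s (eq_bigr (fun k => - (s + 2 * tau y * ir y) * (nrm k y * nrm k y))).
      by rewrite -mulr_sumr sum_nrm// mulr1.
    by move=> k _; rewrite wE; ring.
  lra.
by rewrite -/(w j) wE sE; ring.
Qed.

Theorem gauss_inverse_sphere : exists (c : 'rV[R]_3) (r : R), 0 < r /\
  forall y, Om y -> q y = c + (r * ir y) *: y.
Proof.
have [i1 iE] := irad_C1.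
have r2d y : differentiable r2 y by exact: (@Ck_diff R 2 0 setT r2 y (rad2_Ck 1 openT) I).
have td y : Om y -> differentiable tau y by exact: Ck_diff tr_C1.
have idf y : Om y -> differentiable ir y by exact: Ck_diff i1.
(* The factor [r2 y * ir y] is |y|. It compensates the degree -1 of tau, so [pd_tr] makes m
   constant. *)
pose m y := tau y * (r2 y * ir y).
have rid y : Om y -> differentiable (fun z => r2 z * ir z) y.
  by move=> Oy; apply: differentiableM => //; exact: idf.
have mconst y z : Om y -> Om z -> m y = m z.
  move=> Oy Oz; apply: punctured_const; [| |exact: Om_neq0|exact: Om_neq0] => [u /Om_full Ou|u k /Om_full Ou].
    by apply: differentiableM; [exact: td|exact: rid].
  rewrite /m pdM; [|exact: td|exact: rid].
  rewrite pdM//; last exact: idf.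
  have r0 := rad2_gt0 Ou; have E := irad_sqr Ou.
  rewrite pd_tr// iE// pd_rad2 /nrm.
  have -> : r2 u * ir u * (- tau u * ir u * (u 0 k * ir u)) =
     - tau u * (u 0 k * ir u) * (ir u * ir u * r2 u) by ring.
  by rewrite E; field; rewrite gt_eqF.
pose e : 'rV[R]_3 := 'e_0.
have Oe : Om e.
  by apply: Om_full; apply/eqP => /rowP/(_ 0); rewrite !mxE !eqxx => /eqP; rewrite oner_eq0.
(* At |y| = 1 both radii of curvature equal tau / 2. *)
pose r := m e / 2.
have r0 : 0 < r by rewrite divr_gt0// !mulr_gt0 ?irad_gt0 ?rad2_gt0 ?tr_gt0.
pose F k y := q y 0 k - r * nrm k y.
have Fconst k y : Om y -> F k y = F k e.
  move=> Oy; have dF u : Om u -> differentiable (F k) u.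
    move=> Ou; apply: differentiableB; first exact: q_diff.
    by apply: differentiableM; [exact: differentiable_cst|exact: nrm_diff].
  apply: punctured_const; [| |exact: Om_neq0|exact: Om_neq0] => [u /Om_full|u i /Om_full Ou]; first exact: dF.
  have dn := nrm_diff k Ou.
  have drn : differentiable (fun z => r * nrm k z) u.
    by apply: differentiableM => //; exact: differentiable_cst.
  rewrite (@pdD _ _ i (fun z => q z 0 k) (fun z => - (r * nrm k z)));
    [|exact: q_diff|exact: differentiableN].
  have dr : differentiable (fun=> r) u by exact: differentiable_cst.
  rewrite (pdN i drn) (pdM i dr dn).
  rewrite pd_cst mulr0 addr0 pd_nrm// -/(Q i k u) hess_umbilic//.
  rewrite /r -(mconst u)// /m; have E := irad_sqr Ou.
  have -> : tau u * (r2 u * ir u) / 2 * (ir u * ((i == k)%:R - nrm i u * nrm k u)) =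
    tau u / 2 * ((i == k)%:R - nrm i u * nrm k u) * (ir u * ir u * r2 u) by field.
  by rewrite E mulr1 subrr.
exists (\row_k F k e), r; split=> // y Oy; apply/rowP => k.
by rewrite !mxE -(Fconst k y)// /F /nrm; ring.
Qed.

End Core.

(** * Linear algebra of the tangent plane *)

Section Linear.
Variable R : realType.

Lemma dot_le_norm n (u v : 'rV[R]_n) : `|dot u v| <= n%:R * `|u| * `|v|.
Proof.
apply: le_trans (ler_norm_sum _ _ _) _.
apply: le_trans (_ : \sum_(k < n) `|u| * `|v| <= _).
  by apply: ler_sum => k _; rewrite normrM ler_pM// coord_le_norm.
by rewrite sumr_const card_ord -mulrA mulr_natl.
Qed.

Lemma dot_continuousl n (v : 'rV[R]_n.+1) : continuous (fun u : 'rV[R]_n.+1 => dot u v).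
Proof.
move=> u; apply: (@cvg_sumR R _ _ (nbhs u)) => i _.
by apply: cont_mul; [exact: coord_continuous|exact: cst_continuous].
Qed.

Lemma dotDr n (u v w : 'rV[R]_n) : dot u (v + w) = dot u v + dot u w.
Proof. by rewrite dotC dotDl !(dotC _ u). Qed.

Lemma dotZr n (a : R) (u v : 'rV[R]_n) : dot u (a *: v) = a * dot u v.
Proof. by rewrite dotC dotZl (dotC v). Qed.

Lemma dotNr n (u v : 'rV[R]_n) : dot u (- v) = - dot u v.
Proof. by rewrite dotC dotNl (dotC v). Qed.

Lemma dotBr n (u v w : 'rV[R]_n) : dot u (v - w) = dot u v - dot u w.
Proof. by rewrite dotDr dotNr. Qed.

Variables (B : 'M[R]_(2, 3)) (n : 'rV[R]_3).
Hypotheses (rfB : row_free B) (Bn : B *m n^T = 0) (nn : dot n n = 1).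

Lemma normal_line v : B *m v^T = 0 -> v = dot v n *: n.
Proof.
move=> Bv.
have kn (u : 'rV_3) : B *m u^T = 0 -> (u <= kermx B^T)%MS.
  by move=> Bu; apply/sub_kermxP; rewrite -[u]trmxK -trmx_mul Bu trmx0.
have n0 : n != 0 by rewrite -dot_eq0 nn oner_eq0.
have rk : \rank (kermx B^T) = 1%N.
  by rewrite mxrank_ker mxrank_tr; move: rfB; rewrite /row_free => /eqP ->.
have : (kermx B^T <= n)%MS.
  by rewrite -(geq_leqif (mxrank_leqif_sup (kn _ Bn))) rk rank_rV n0.
move=> /(submx_trans (kn _ Bv))/sub_rVP[a ->].
by rewrite dotZl nn mulr1.
Qed.

(** Dimension count: the vectors orthogonal to n form a plane, which must be the row space of B.
    Hence passing to coordinates with [pinvmx B] loses nothing on such vectors. *)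
Lemma tangent_sub p (M : 'M[R]_(p, 3)) : M *m n^T = 0 -> (M <= B)%MS.
Proof.
move=> Mn; have sub m (N : 'M[R]_(m, 3)) : N *m n^T = 0 -> (N <= kermx n^T)%MS by move/sub_kermxP.
apply: submx_trans (sub _ _ Mn) _.
rewrite -(geq_leqif (mxrank_leqif_sup (sub _ _ Bn))) mxrank_ker mxrank_tr.
have n0 : n != 0 by rewrite -dot_eq0 nn oner_eq0.
by rewrite rank_rV n0; move: rfB; rewrite /row_free => /eqP ->.
Qed.

End Linear.

Section DotDiff.
Variables (R : realType) (m n : nat).
Implicit Types F G : 'rV[R]_m.+1 -> 'rV[R]_n.+1.

Lemma diff_dot F G u : differentiable F u -> differentiable G u ->
  differentiable (fun u => dot (F u) (G u)) u.
Proof.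
move=> dF dG; apply: diff_sum => j.
exact: (differentiableM (diff_rV_coord j dF) (diff_rV_coord j dG)).
Qed.

Lemma jacobian_cst (v : 'rV[R]_n.+1) (u : 'rV[R]_m.+1) : 'J (fun=> v) u = 0.
Proof.
have dv : differentiable (fun=> v : 'rV[R]_n.+1) u by exact: differentiable_cst.
apply/matrixP => i j; apply: etrans (jacobian_coord i j dv) _.
by rewrite mxE; exact: pd_cst.
Qed.

Lemma pd_dot F G u i : differentiable F u -> differentiable G u ->
  pd i (fun u => dot (F u) (G u)) u =
  ('J F u *m (G u)^T) i 0 + ('J G u *m (F u)^T) i 0.
Proof.
move=> dF dG; have dFj j := diff_rV_coord j dF; have dGj j := diff_rV_coord j dG.
have dj j : differentiable (fun u => F u 0 j * G u 0 j) u by exact: differentiableM.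
rewrite /dot (pd_sum i _ dj) [X in _ = X + _]mxE [X in _ = _ + X]mxE -big_split.
apply: eq_bigr => j _; rewrite (pdM i (dFj j) (dGj j)) /=.
apply: etrans (_ : pd i (fun u => F u 0 j) u * G u 0 j + pd i (fun u => G u 0 j) u * F u 0 j = _).
  by rewrite addrC; congr (_ + _); exact: mulrC.
congr (_ * _ + _ * _).
- exact: esym (jacobian_coord i j dF).
- by rewrite mxE.
- exact: esym (jacobian_coord i j dG).
- by rewrite mxE.
Qed.

End DotDiff.

(** * Matrices of order two and the inverse of a matrix function *)

Section SmallMatrices.
Variable R : realType.

Lemma unit_normalP (S : set 'rV[R]_3) p n :
  unit_normal S p n <-> dot n n = 1 /\ tangent_basis S p *m n^T = 0.
Proof.
split=> -[nn nB]; split=> //.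
  apply/row_matrixP => i; rewrite row_mul row0; apply/rowP => j.
  by rewrite ord1 -dot_mulmx nB ?row_sub// mxE.
by move=> v /submxP[D ->]; rewrite dot_mulmx -mulmxA nB mulmx0 mxE.
Qed.

Lemma sum2 (V : nmodType) (F : 'I_2 -> V) : \sum_i F i = F 0 + F 1.
Proof. by rewrite !big_ord_recl big_ord0 addr0; congr (F _ + F _); exact/val_inj. Qed.

Lemma det2 (M : 'M[R]_2) : \det M = M 0 0 * M 1 1 - M 0 1 * M 1 0.
Proof.
rewrite (expand_det_row _ 0) sum2 /cofactor !det_mx11 !mxE /= expr0 expr1 mul1r mulN1r mulrN.
by congr (M _ _ * M _ _ - M _ _ * M _ _); exact/val_inj.
Qed.

Lemma tr2 (M : 'M[R]_2) : \tr M = M 0 0 + M 1 1.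
Proof. exact: sum2. Qed.

(** The shape of [e2]: the determinant of the Hessian on the tangent plane can be read from traces,
    which do not depend on a basis. *)
Lemma det2_tr (M : 'M[R]_2) : \det M = ((\tr M) ^+ 2 - \tr (M *m M)) / 2.
Proof. by rewrite det2 !tr2 !mxE !sum2; field. Qed.

(** Used with X the Hessian on the tangent plane, A the shape operator and a = 1 / |y|. Multiplying
    X A = a by the adjugate of X gives det X times A as a times that adjugate, whose trace is tr X
    in order 2. *)
Lemma scalar_mul2 (X A : 'M[R]_2) (a : R) : X *m A = a%:M ->
  \det X * \det A = a ^+ 2 /\ \det X * \tr A = a * \tr X.
Proof.
move=> E; split; first by rewrite -det_mulmx E det_scalar.
have e i j : (X *m A) i j = (a%:M : 'M[R]_2) i j by rewrite E.
have := e 0 0; have := e 0 1; have := e 1 0; have := e 1 1.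
rewrite !mxE !sum2 /= !mulr1n !mulr0n det2 !tr2 => e11 e10 e01 e00.
have -> : (X 0 0 * X 1 1 - X 0 1 * X 1 0) * (A 0 0 + A 1 1) =
  X 1 1 * (X 0 0 * A 0 0 + X 0 1 * A 1 0) - X 0 1 * (X 1 0 * A 0 0 + X 1 1 * A 1 0) +
  X 0 0 * (X 1 0 * A 0 1 + X 1 1 * A 1 1) - X 1 0 * (X 0 0 * A 0 1 + X 0 1 * A 1 1) by ring.
by rewrite e00 e01 e10 e11; ring.
Qed.

Lemma Ck_det m n k (U : set 'rV[R]_m.+1) (M : 'rV[R]_m.+1 -> 'M[R]_n) : open U ->
  (forall i j, Ck k U (fun u => M u i j)) -> Ck k U (fun u => \det (M u)).
Proof.
move=> oU MC; rewrite /determinant; apply: Ck_sum => // s _; apply: Ck_mul => //.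
  exact: Ck_cst.
by apply: Ck_prod.
Qed.

(** Cramer's rule: cofactors and the determinant are polynomials in the entries. *)
Lemma C1_invmx m n (U : set 'rV[R]_m.+1) (M : 'rV[R]_m.+1 -> 'M[R]_n) i j : open U ->
  (forall i j, Ck 1 U (fun u => M u i j)) -> (forall u, U u -> M u \in unitmx) ->
  Ck 1 U (fun u => invmx (M u) i j).
Proof.
move=> oU MC Mu.
have dC := Ck_det oU MC.
have d0 u : U u -> \det (M u) != 0 by move=> /Mu; rewrite unitmxE unitfE.
have [iC _] : Ck 1 U (fun u => (\det (M u))^-1) /\ forall i u, U u ->
    pd i (fun u => (\det (M u))^-1) u = - (\det (M u)) ^- 2 * pd i (fun u => \det (M u)) u.
  have H1 u : U u -> is_derive (\det (M u)) 1 (fun x : R => x^-1) (- (\det (M u)) ^- 2).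
    move=> /d0 nz; split; first by apply: derivableV => //; exact: derivable_id.
    by rewrite deriveV// derive_id /GRing.scale /= mulr1.
  have H2 u : U u -> {for \det (M u), continuous (fun x : R => - x ^- 2)}.
    move=> /d0 nz; apply: cont_opp; apply: (@continuous_comp _ _ _ (fun x : R => x ^+ 2) (fun x => x^-1)).
      exact: exprn_continuous.
    by apply: inv_continuous; rewrite expf_neq0.
  exact: (C1_comp1 (g := fun x : R => x^-1) (g' := fun x : R => - x ^- 2) oU dC H1 H2).
have cC : Ck 1 U (fun u => cofactor (M u) j i).
  rewrite /cofactor; apply: (Ck_mul oU (Ck_cst 1 U _)); apply: (Ck_det oU) => k l.
  rewrite (_ : (fun u => _) = fun u => M u (lift j k) (lift i l)); first exact: MC.
  by apply/funext => u; rewrite !mxE.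
apply: (Ck_ext oU _ (Ck_mul oU iC cC)) => u Uu.
by rewrite /invmx Mu// !mxE.
Qed.

End SmallMatrices.

(** * Charts and unit normal fields *)

Section Charts.
Variables (R : realType) (S : set 'rV[R]_3).
Hypothesis emb : embedded_surface S.
Local Notation B p := (tangent_basis S p).

(** The last clause is the continuity of the inverse chart, together with the fact that points of S
    close to a chart point are themselves in the chart. It is stated at every u0, since the inverse
    Gauss map read in the chart must be continuous near a point and not only at it. *)
Lemma chart_spec p : S p -> exists (U : set 'rV[R]_2) (inv : 'rV[R]_3 -> 'rV[R]_2),
  [/\ open U, U 0, chart S p 0 = p & row_free (B p)] /\
  [/\ forall k j, Ck k U (fun u => chart S p u 0 j),
      forall u, U u -> S (chart S p u),
      forall u, U u -> inv (chart S p u) = u &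
      forall u0 V, U u0 -> open V -> V u0 -> \forall q \near chart S p u0,
        S q -> [/\ V (inv q), U (inv q) & chart S p (inv q) = q]].
Proof.
move=> Sp; have : local_parametrization S p (chart S p).
  by rewrite /chart; case: xgetP => [x -> //|nx]; have [x xP] := emb Sp; case: (nx x).
set x := chart S p => -[x0 [U [W [y [[oU U0 oW] [xs xrf xUW yx yc]]]]]].
exists U, y; split; first by split=> //; exact: xrf.
split=> // [k j|u Uu|u0 V Uu0 oV Vu0].
- exact: C_k_coord.
- by have [] : (S `&` W) (x u) by rewrite -xUW; exists u.
have SW : (S `&` W) (x u0) by rewrite -xUW; exists u0.
have /subspace_continuousP/(_ _ SW) cy := yc.
have nV : nbhs (y (x u0)) V by rewrite yx//; exact: open_nbhs_nbhs.
have near1 : \forall q \near x u0, (S `&` W) q -> V (y q) by exact: cy _ nV.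
have near2 : \forall q \near x u0, W q by apply: open_nbhs_nbhs; split=> //; case: SW.
apply: filterS2 near1 near2 => q qV Wq Sq.
have SWq : (S `&` W) q by [].
have Vq := qV SWq; move: SWq; rewrite -xUW => -[u Uu xu].
by rewrite -xu yx//; rewrite -xu yx// in Vq.
Qed.

Lemma chart0 p : S p -> chart S p 0 = p.
Proof. by move=> /chart_spec[U [inv [[]]]]. Qed.

Lemma tangent_basis_free p : S p -> row_free (B p).
Proof. by move=> /chart_spec[U [inv [[]]]]. Qed.

Lemma chart_diff p : S p -> differentiable (chart S p) 0.
Proof.
move=> /chart_spec[U [inv [[oU U0 _ _] [xC _ _ _]]]].
by apply: diff_rV_intro => j; exact: Ck_diff (xC 1%N j) U0.
Qed.

Lemma chart_cont p : S p -> {for 0, continuous (chart S p)}.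
Proof. by move=> /chart_diff; exact: differentiable_continuous. Qed.

Lemma chart_near p (P : 'rV[R]_3 -> Prop) : S p -> (\forall q \near p, P q) ->
  \forall u \near (0 : 'rV[R]_2), P (chart S p u).
Proof. by move=> Sp Pp; apply: (chart_cont Sp); rewrite /= chart0. Qed.

Lemma chart_in p : S p -> \forall u \near (0 : 'rV[R]_2), S (chart S p u).
Proof.
move=> /chart_spec[U [inv [[oU U0 _ _] [_ xS _ _]]]].
exact: (near_open oU U0).
Qed.

Lemma near_chart p (P : 'rV[R]_2 -> Prop) : S p -> (\forall u \near (0 : 'rV[R]_2), P u) ->
  \forall q \near p, S q -> exists2 u, P u & chart S p u = q.
Proof.
move=> /chart_spec[U [inv [[oU U0 x0 _] [_ _ _ cinv]]]] /near_ex_open[V [oV V0 VP]].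
have := cinv 0 V U0 oV V0; rewrite x0; apply: filterS => q H /H[Vq _ xq].
by exists (inv q) => //; exact: VP.
Qed.

Definition normal_field p (M : 'rV[R]_3 -> 'rV[R]_3) := exists W : set 'rV[R]_3, [/\ open W, W p,
  forall k j, Ck k W (fun z => M z 0 j) & forall q, S q -> W q -> unit_normal S q (M q)].

Lemma normal_fieldN p M : normal_field p M -> normal_field p (fun z => - M z).
Proof.
move=> [W [oW Wp MC Mn]]; exists W; split=> // [k j|q Sq Wq].
  apply: (Ck_ext oW _ (Ck_opp oW (MC k j))) => u _; by rewrite mxE.
have /unit_normalP[nn Bn] := Mn _ Sq Wq; apply/unit_normalP.
by rewrite dotNl dotNr opprK linearN /= mulmxN Bn oppr0.
Qed.

Lemma normal_field_near p M : normal_field p M ->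
  \forall q \near p, S q -> unit_normal S q (M q).
Proof. by move=> [W [oW Wp MC Mn]]; apply: (near_open oW Wp) => q Wq Sq; exact: Mn. Qed.

Lemma normal_field_cont p M : normal_field p M -> {for p, continuous M}.
Proof.
move=> [W [oW Wp MC _]]; apply: (@continuous_rVP R 'rV[R]_3) => j.
exact: Ck_continuous (MC 0%N j) Wp.
Qed.

Lemma normal_field_unit p M : S p -> normal_field p M -> unit_normal S p (M p).
Proof. by move=> Sp /normal_field_near/nbhs_singleton; exact. Qed.

Lemma normal_field_move p M : normal_field p M -> \forall q \near p, normal_field q M.
Proof. by move=> [W [oW Wp MC Mn]]; apply: (near_open oW Wp) => q Wq; exists W. Qed.

Lemma field_chart_C p M : S p -> normal_field p M -> exists V : set 'rV[R]_2, [/\ open V, V 0,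
  forall k j, Ck k V (fun u => M (chart S p u) 0 j) &
  forall u, V u -> S (chart S p u) /\ unit_normal S (chart S p u) (M (chart S p u))].
Proof.
move=> Sp [W [oW Wp MC Mn]]; have [U [inv [[oU U0 x0 _] [xC xS _ _]]]] := chart_spec Sp.
have nU : \forall u \near (0 : 'rV[R]_2), U u by exact: (near_open oU U0).
have nW : \forall u \near (0 : 'rV[R]_2), W (chart S p u).
  by apply: chart_near => //; exact: (near_open oW Wp).
have [V [oV V0 VP]] := near_ex_open (filterI nU nW).
exists V; split=> // [k j|u /VP[Uu Wu]]; last by split; [exact: xS|apply: Mn => //; exact: xS].
apply: (@Ck_comp _ _ _ k V W (chart S p) (fun z => M z 0 j)) => // [i|u /VP[]//].
by apply: Ck_subset (xC k i) => u /VP[].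
Qed.

Lemma field_chart_diff p M : S p -> normal_field p M -> differentiable (M \o chart S p) 0.
Proof.
move=> Sp /(field_chart_C Sp)[V [oV V0 VC _]].
by apply: diff_rV_intro => j; exact: Ck_diff (VC 1%N j) V0.
Qed.

(** Differentiate <M, M> = 1 along the chart. *)
Lemma field_chart_normal p M : S p -> normal_field p M ->
  'J (M \o chart S p) 0 *m (M p)^T = 0.
Proof.
move=> Sp fM; have dM := field_chart_diff Sp fM; have [V [oV V0 VC Vn]] := field_chart_C Sp fM.
apply/matrixP => i k; rewrite ord1 !mxE {k}.
pose c (j : 'I_3) u := M (chart S p u) 0 j.
have dc j : differentiable (c j) 0 by exact: Ck_diff (VC 1%N j) V0.
have : pd i (fun u => \sum_j c j u * c j u) 0 = 0.
  rewrite (@pd_near_eq _ _ _ _ (fun=> 1)) ?pd_cst//.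
  by apply: (near_open oV V0) => u /Vn[_ [nn _]].
rewrite pd_sum => [H|j]; last exact: differentiableM.
have : 2 * \sum_j c j 0 * pd i (c j) 0 = 0.
  rewrite -[RHS]H mulr_sumr; apply: eq_bigr => j _; rewrite pdM//; ring.
move=> /eqP; rewrite mulf_eq0 pnatr_eq0 /= => /eqP E; rewrite -[RHS]E.
apply: eq_bigr => j _; rewrite [X in _ * X]mxE jacobian_coord// mulrC /c chart0//.
Qed.

(** Weingarten's equation: the derivatives of M are tangent, so multiplying their coordinates by the
    tangent basis gives them back. *)
Lemma shape_operatorE p M : S p -> normal_field p M ->
  'J (M \o chart S p) 0 = - (shape_operator S M p *m B p).
Proof.
move=> Sp fM; have [nn Bn] := (unit_normalP _ _ _).1 (normal_field_unit Sp fM).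
have := tangent_sub (tangent_basis_free Sp) Bn nn (field_chart_normal Sp fM).
by move=> JB; rewrite /shape_operator mulNmx opprK mulmxKpV.
Qed.

Lemma jacobian_near_eq m n (F G : 'rV[R]_m.+1 -> 'rV[R]_n.+1) u :
  (\forall v \near u, F v = G v) -> differentiable F u -> 'J G u = 'J F u.
Proof.
move=> FG dF; have dG := differentiable_near_eq FG dF.
have E i j : 'J G u i j = 'J F u i j.
  apply: etrans (jacobian_coord i j dG) _.
  apply: etrans _ (esym (jacobian_coord i j dF)).
  by apply/esym; apply: near_eq_derive; apply: filterS FG => v ->.
by apply/matrixP => i j.
Qed.

(** Only the germ of the field on S matters. A smooth local field can thus replace [inward_normal],
    whatever the values of the latter off S. *)
Lemma shape_operator_near p M N : S p -> normal_field p M ->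
  (\forall q \near p, S q -> M q = N q) -> shape_operator S N p = shape_operator S M p.
Proof.
move=> Sp fM MN.
have E : 'J (N \o chart S p) 0 = 'J (M \o chart S p) 0.
  apply: jacobian_near_eq (field_chart_diff Sp fM).
  by apply: filterS2 (chart_near Sp MN) (chart_in Sp) => u /= H /H.
by rewrite /shape_operator E.
Qed.

Lemma shape_operatorN p M : S p -> normal_field p M ->
  shape_operator S (fun z => - M z) p = - shape_operator S M p.
Proof.
move=> Sp fM; rewrite /shape_operator; have dM := field_chart_diff Sp fM.
have dN := field_chart_diff Sp (normal_fieldN fM).
have E i j : 'J ((fun z => - M z) \o chart S p) 0 i j = - 'J (M \o chart S p) 0 i j.
  apply: etrans (jacobian_coord i j dN) _.
  apply: etrans _ (congr1 -%R (esym (jacobian_coord i j dM))).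
  apply: etrans _ (pdN i (diff_rV_coord j dM)).
  by rewrite /pd; congr (derive _ _ _); apply/funext => u /=; rewrite mxE.
have -> : 'J ((fun z => - M z) \o chart S p) 0 = - 'J (M \o chart S p) 0.
  by apply/matrixP => i j; rewrite [RHS]mxE.
by rewrite mulNmx.
Qed.

Lemma unit_normal_pm q n m : S q -> unit_normal S q n -> unit_normal S q m ->
  n = m \/ n = - m.
Proof.
move=> Sq /unit_normalP[nn Bn] /unit_normalP[mm Bm].
have E := normal_line (tangent_basis_free Sq) Bm mm Bn.
have : dot n m ^+ 2 = 1.
  by rewrite -nn [in RHS]E dotZl dotZr mm mulr1.
by move=> /eqP; rewrite sqrf_eq1 => /orP[]/eqP d; rewrite E d ?scale1r ?scaleN1r; [left|right].
Qed.

End Charts.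

(** * Points of contact with supporting planes *)

Section Contact.
Variables (R : realType) (S : set 'rV[R]_3).
Hypothesis ovS : ovaloid S.
Local Notation B p := (tangent_basis S p).

Let emb : embedded_surface S. Proof. by case: ovS. Qed.
Let Sne : S !=set0. Proof. by case: ovS. Qed.
Let Scompact : compact S. Proof. by case: ovS. Qed.

Definition contact (y p : 'rV[R]_3) := S p /\ forall s, S s -> dot s y <= dot p y.

Definition inward (p n : 'rV[R]_3) :=
  unit_normal S p n /\ forall q, S q -> 0 <= dot (q - p) n.

Definition good_field p M := normal_field S p M /\ 0 < gaussian_curvature S M p.

Lemma good_fieldN p M : S p -> good_field p M -> good_field p (fun z => - M z).
Proof.
move=> Sp [fM K0]; split; first exact: normal_fieldN.
by rewrite /gaussian_curvature shape_operatorN// -scaleN1r detZ expr2 mulN1r opprK mul1r.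
Qed.

Lemma good_field_ex p : S p -> exists M, good_field p M.
Proof.
move=> Sp; have [_ _ _ _ /(_ p Sp)[M [W [oW Wp MC Mn]] K0]] := ovS.
exists M; split=> //; exists W; split=> // k j; exact: C_k_coord.
Qed.

Lemma shape_unit p M : good_field p M -> shape_operator S M p \in unitmx.
Proof. by move=> [_ K0]; rewrite unitmxE unitfE gt_eqF. Qed.

Lemma contact_ex y : exists p, contact y p.
Proof.
have [|p Sp pmax] := @compact_EVT_max _ R (fun s => dot s y) S Sne Scompact.
  by apply: continuous_subspaceT => s; exact: dot_continuousl.
exists p; split=> [|s Ss]; first by rewrite inE in Sp.
by apply: pmax; rewrite inE.
Qed.

Lemma contact_tangent y p : contact y p -> B p *m y^T = 0.
Proof.
move=> [Sp ymax]; have dx := chart_diff emb Sp.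
have dy : differentiable (fun=> y : 'rV[R]_3) (0 : 'rV[R]_2) by exact: differentiable_cst.
apply/matrixP => i k; rewrite ord1 [RHS]mxE {k}.
have gmax : \forall u \near (0 : 'rV[R]_2), dot (chart S p u) y <= dot (chart S p 0) y.
  by apply: filterS (chart_in emb Sp) => u; rewrite chart0//; exact: ymax.
have := local_max_derive 'e_i (diff_dot dx dy) gmax.
rewrite -/(pd i _ _) pd_dot// jacobian_cst mul0mx.
by rewrite [X in _ + X]mxE addr0.
Qed.

Lemma irad_unit (y : 'rV[R]_3) : y != 0 -> dot (irad y *: y) (irad y *: y) = 1.
Proof.
move=> y0; rewrite dotZl dotZr mulrA.
exact: (@irad_sqr R [set y | y != 0] (fun _ => id) y y0).
Qed.

Lemma contact_inward y p : y != 0 -> contact y p -> inward p (- (irad y *: y)).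
Proof.
move=> y0 cy; split; last first.
  move=> q Sq; rewrite dotNr dotZr oppr_ge0 mulr_ge0_le0 ?(ltW (irad_gt0 y))//.
  by rewrite dotBl subr_le0; case: cy => _; apply.
apply/unit_normalP; split; first by rewrite dotNl dotNr opprK irad_unit.
by rewrite linearN linearZ /= mulmxN -scalemxAr contact_tangent// scaler0 oppr0.
Qed.

Lemma inward_contact p n : S p -> inward p n -> contact (- n) p.
Proof.
move=> Sp [_ nS]; split=> // s /nS; rewrite dotBl !dotNr.
lra.
Qed.

Lemma inward_neq0 p n : inward p n -> n != 0.
Proof. by move=> [[nn _] _]; rewrite -dot_eq0 nn oner_eq0. Qed.

Lemma field_pos p M : S p -> normal_field S p M -> \forall q \near p, 0 < dot (M q) (M p).
Proof.
move=> Sp fM; have [nn _] := normal_field_unit Sp fM.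
have c : {for p, continuous (fun q => dot (M q) (M p))}.
  apply: (@continuous_comp _ _ _ M (fun z => dot z (M p))); first exact: normal_field_cont fM.
  exact: dot_continuousl.
have := cont_near_le c (divr_gt0 (ltr01 : 0 < 1 :> R) (ltr0n _ 2)).
by apply: filterS => q; rewrite nn ler_norml => /andP[_]; lra.
Qed.

(** If S lay in the plane, n would be normal to S everywhere, so M would be constant on S near p:
    the sign cannot switch because <M q, M p> > 0. Then the shape operator vanishes, against K >
    0. *)
Lemma not_planar p n : S p -> dot n n = 1 -> ~ (forall q, S q -> dot (q - p) n = 0).
Proof.
move=> Sp nn pl; have [M [fM K0]] := good_field_ex Sp.
have un q : S q -> unit_normal S q n.
  move=> Sq; apply/unit_normalP; split=> //; apply: contact_tangent; split=> // s Ss.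
  by have := pl _ Ss; have := pl _ Sq; rewrite !dotBl; lra.
have near1 : \forall q \near p, S q -> M q = M p.
  apply: filterS2 (normal_field_near fM) (field_pos Sp fM) => q uq pos Sq.
  have uM := normal_field_unit Sp fM.
  have [E|E] := unit_normal_pm emb Sq (un _ Sq) (uq Sq);
  have [E'|E'] := unit_normal_pm emb Sp (un _ Sp) uM.
  - by rewrite -E -E'.
  - by move: pos; rewrite -E E' dotNl oppr_gt0 ltNge dot_ge0.
  - by move: pos; rewrite -[M q]opprK -E E' dotNl oppr_gt0 ltNge dot_ge0.
  - by rewrite -[M q]opprK -E E' opprK.
have E : 'J (M \o chart S p) 0 = 0.
  rewrite -(jacobian_cst (M p) 0); apply/esym.
  apply: jacobian_near_eq (field_chart_diff emb Sp fM).
  by apply: filterS2 (chart_near emb Sp near1) (chart_in emb Sp) => u H /H.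
by move: K0; rewrite /gaussian_curvature /shape_operator E mul0mx oppr0 det0 ltxx.
Qed.

(** If n and - n were both inward, S would lie in the tangent plane. *)
Lemma inward_unique p n m : S p -> inward p n -> inward p m -> n = m.
Proof.
move=> Sp [un nS] [um mS]; have [//|E] := unit_normal_pm emb Sp un um.
exfalso; apply: (@not_planar p n Sp); first by case: un.
move=> q Sq; have := nS _ Sq; have := mS _ Sq; rewrite E dotNr => m0 n0.
by apply/eqP; rewrite oppr_eq0 eq_le m0 andbT -oppr_ge0.
Qed.

Lemma dot_field_cont p M (s : 'rV[R]_3) : normal_field S p M ->
  {for p, continuous (fun q : 'rV[R]_3 => dot (s - q) (M q))}.
Proof.
move=> fM; have cM := normal_field_cont fM.
apply: (@cvg_sumR R _ _ (nbhs p)) => i _.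
apply: cont_mul; last by apply: (@cvg_coord R _ (nbhs p) 1 3 M (M p) 0 i); exact: cM.
rewrite (_ : (fun q => _) = fun q : 'rV[R]_3 => s 0 i + - q 0 i); last first.
  by apply/funext => q; rewrite !mxE.
apply: cont_add; first exact: cst_continuous.
by apply: cont_opp; exact: coord_continuous.
Qed.

(** A point s of S strictly on the wrong side of the tangent plane at p remains so for nearby
    tangent planes. *)
Lemma not_inward_near p M : S p -> normal_field S p M -> ~ inward p (M p) ->
  \forall q \near p, S q -> ~ inward q (M q).
Proof.
move=> Sp fM nin.
have [s Ss neg] : exists2 s, S s & dot (s - p) (M p) < 0.
  apply: contra_notP nin => H; split; first exact: normal_field_unit.
  by move=> q Sq; rewrite leNgt; apply/negP => neg; apply: H; exists q.
have neg2 : 0 < - dot (s - p) (M p) / 2 by rewrite divr_gt0// oppr_gt0.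
have := cont_near_le (dot_field_cont (s := s) fM) neg2.
apply: filterS => q; rewrite ler_norml => /andP[l1 _] Sq [_ /(_ s Ss)].
lra.
Qed.

(** By uniqueness - M is not inward at p, hence not at nearby points either; only M is left. *)
Lemma inward_field p M : S p -> normal_field S p M -> inward p (M p) ->
  \forall q \near p, forall n, S q -> inward q n -> n = M q.
Proof.
move=> Sp fM inM; have fN := normal_fieldN fM.
have nin : ~ inward p (- M p).
  move=> inN; have E := inward_unique Sp inM inN.
  by have [[nn _] _] := inM; move: nn; rewrite {2}E dotNr; have [[-> _] _] := inM; lra.
have n1 := not_inward_near Sp fN nin.
apply: filterS2 n1 (normal_field_near fM) => q H1 H2 n Sq inn.
have [//|E] := unit_normal_pm emb Sq (proj1 inn) (H2 Sq).
by exfalso; apply: (H1 Sq); rewrite -E.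
Qed.

Definition support_pts := [set p | S p /\ exists n, inward p n].
Local Notation C := support_pts.

Lemma inward_normalP p : C p -> inward p (inward_normal S p).
Proof.
move=> [Sp [n inn]]; rewrite /inward_normal.
by case: xgetP => [m -> //|/(_ n)]; case.
Qed.

Lemma inward_normal_eq p n : S p -> inward p n -> inward_normal S p = n.
Proof.
move=> Sp inn; have Cp : C p by split=> //; exists n.
exact: inward_unique Sp (inward_normalP Cp) inn.
Qed.

Lemma inward_normal0 p : S p -> ~ C p -> inward_normal S p = 0.
Proof.
move=> Sp nC; rewrite /inward_normal; apply: xgetPN => n inn.
by apply: nC; split=> //; exists n.
Qed.

Lemma support_pts_closed p : S p -> ~ C p -> \forall q \near p, S q -> ~ C q.
Proof.
move=> Sp nC; have [M [fM _]] := good_field_ex Sp; have fN := normal_fieldN fM.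
have n1 : ~ inward p (M p) by move=> H; apply: nC; split=> //; exists (M p).
have n2 : ~ inward p (- M p) by move=> H; apply: nC; split=> //; exists (- M p).
apply: filterS3 (not_inward_near Sp fM n1) (not_inward_near Sp fN n2) (normal_field_near fM).
move=> q H1 H2 H3 Sq [_ [n inn]].
have [E|E] := unit_normal_pm emb Sq (proj1 inn) (H3 Sq).
  by apply: (H1 Sq); rewrite -E.
by apply: (H2 Sq); rewrite -E.
Qed.

(** This is how the inward normal, defined by choice, becomes smooth: along the support points near
    p it is the restriction of a smooth field with the right sign. *)
Lemma support_field p : C p -> exists M, [/\ good_field p M, inward p (M p) &
  \forall q \near p, C q -> inward_normal S q = M q].
Proof.
move=> Cp; have [Sp _] := Cp; have inN := inward_normalP Cp.
suff [M gM EM] : exists2 M, good_field p M & M p = inward_normal S p.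
  exists M; have inM : inward p (M p) by rewrite EM.
  have [fM _] := gM; split=> //.
  apply: filterS (inward_field Sp fM inM) => q H Cq.
  by have [Sq _] := Cq; apply: H => //; exact: inward_normalP.
have [M gM] := good_field_ex Sp; have [fM _] := gM.
have [E|E] := unit_normal_pm emb Sp (proj1 inN) (normal_field_unit Sp fM).
  by exists M.
by exists (fun z => - M z); [exact: good_fieldN|exact: esym E].
Qed.

(* Showing that this set is open and closed in S replaces Hadamard's theorem. *)
Definition inner_pts := [set p | S p /\ \forall q \near p, S q -> C q].
Local Notation I := inner_pts.

Lemma inner_support p : I p -> C p.
Proof. by move=> [Sp /nbhs_singleton]; exact. Qed.

Lemma inner_open p : I p -> \forall q \near p, S q -> I q.
Proof.
move=> [Sp /near_ex_open[V [oV Vp VP]]]; apply: (near_open oV Vp) => q Vq Sq.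
by split=> //; exact: (near_open oV Vq).
Qed.

(* If c is another contact point, q |-> <q - c, N q> is maximal at p; its derivative
   is <q - c, dN>, and dN is invertible, so p - c is normal to S. *)
Lemma contact_unique p c y : I p -> y != 0 -> contact y p -> contact y c -> c = p.
Proof.
move=> Ip y0 cp cc; have [Sp nC] := Ip; have [Sc _] := cc.
have [M [gM inM MN]] := support_field (inner_support Ip); have [fM K0] := gM.
have dx := chart_diff emb Sp; have dM := field_chart_diff emb Sp fM.
have dc : differentiable (fun=> c : 'rV[R]_3) (0 : 'rV[R]_2) by exact: differentiable_cst.
have dF : differentiable (fun u => chart S p u - c) 0 by exact: differentiableB.
have Mp : M p = - (irad y *: y) by apply: inward_unique inM (contact_inward y0 cp).
have dotcp : dot (c - p) y = 0.
  have [_ /(_ c Sc)] := cp; have [_ /(_ p Sp)] := cc.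
  by rewrite dotBl => h1 h2; apply/eqP; rewrite subr_eq0 eq_le h1 h2.
have x0 := chart0 emb Sp.
(* At p the value is 0, as c and p have the same height in direction y. Near p every point of S has
   an inward normal, which makes the value nonpositive. *)
have gmax : \forall u \near (0 : 'rV[R]_2),
    dot (chart S p u - c) (M (chart S p u)) <= dot (chart S p 0 - c) (M (chart S p 0)).
  apply: filterS3 (chart_near emb Sp nC) (chart_near emb Sp MN) (chart_in emb Sp).
  move=> u /= HC HM xS; rewrite -HM; last exact: HC.
  have E0 : dot (p - c) (M p) = 0.
    by rewrite -opprB dotNl Mp dotNr dotZr dotcp mulr0 !oppr0.
  rewrite x0 E0.
  have [_ /(_ c Sc)] := inward_normalP (HC xS).
  by rewrite -opprB dotNl oppr_ge0.
have B0 : B p *m (M p)^T = 0 by case/unit_normalP: (normal_field_unit Sp fM).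
have JF : 'J (fun u => chart S p u - c) 0 = B p.
  apply/matrixP => i j; apply: etrans (jacobian_coord i j dF) _.
  apply: etrans _ (esym (jacobian_coord i j dx)).
  have dxj := diff_rV_coord j dx.
  have dcj : differentiable (fun=> - c 0 j : R) (0 : 'rV[R]_2) by exact: differentiable_cst.
  rewrite (_ : (fun u => _) = fun u => chart S p u 0 j + - c 0 j); last first.
    by apply/funext => u; rewrite !mxE.
  by apply: etrans (pdD i dxj dcj) _; rewrite pd_cst addr0.
have AB : shape_operator S M p *m (B p *m (c - p)^T) = 0.
  have AE : shape_operator S M p *m B p = - 'J (M \o chart S p) 0.
    exact: canRL opprK (esym (shape_operatorE emb Sp fM)).
  rewrite mulmxA AE mulNmx.
  have Z : 'J (fun u => chart S p u - c) 0 *m (M p)^T = 0.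
    exact: etrans (congr1 (fun X => X *m (M p)^T) JF) B0.
  have Y i : ('J (M \o chart S p) 0 *m (p - c)^T) i 0 = 0.
    have h1 := pd_dot i dF dM; have h2 := local_max_derive 'e_i (diff_dot dF dM) gmax.
    move: (etrans (esym h1) h2) => /=; rewrite x0.
    by move: (congr1 (fun X : 'cV_2 => X i 0) Z) => /= ->; rewrite [X in X + _]mxE add0r.
  have Y0 : 'J (M \o chart S p) 0 *m (p - c)^T = 0.
    by apply/matrixP => i k; rewrite ord1 [RHS]mxE; exact: Y.
  have E2 : (c - p)^T = - (p - c)^T by rewrite -linearN opprB.
  by rewrite E2 mulmxN opprK.
have Bcp : B p *m (c - p)^T = 0.
  by rewrite -[LHS](mulKmx (shape_unit gM)) AB mulmx0.
have [nn _] := normal_field_unit Sp fM.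
have := normal_line (tangent_basis_free emb Sp) B0 nn Bcp.
rewrite Mp dotNr dotZr dotcp mulr0 oppr0 scale0r => /eqP.
by rewrite subr_eq0 => /eqP.
Qed.

Lemma bounded_S : exists2 b : R, 0 < b & forall s, S s -> `|s| <= b.
Proof.
have [|p Sp pmax] := @compact_EVT_max _ R (fun s : 'rV[R]_3 => `|s|) S Sne Scompact.
  by apply: continuous_subspaceT => s; exact: norm_continuous.
exists (`|p| + 1); first by rewrite ltr_wpDl.
by move=> s Ss; rewrite (@le_trans _ _ `|p|) ?lerDl//; apply: pmax; rewrite inE.
Qed.

(** On the compact part of S outside W the height in direction y stays below that of p by a definite
    gap, because p is the only contact point; a small change of y cannot close this gap. *)
Lemma contact_near y p W : contact y p -> (forall c, contact y c -> c = p) ->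
  open W -> W p -> \forall z \near y, forall c, contact z c -> W c.
Proof.
move=> cp uniq oW Wp; have [Sp pm] := cp.
have cK : compact (S `&` ~` W) by apply: compact_closedI => //; exact: open_closedC.
have [K0|/set0P Kn] := eqVneq (S `&` ~` W) set0.
  near=> z => c [Sc _]; apply: contrapT => nW.
  by have : (S `&` ~` W) c by []; rewrite K0.
have [|k kK kmax] := @compact_EVT_max _ R (fun s => dot s y) _ Kn cK.
  by apply: continuous_subspaceT => s; exact: dot_continuousl.
rewrite inE in kK; have [Sk nWk] := kK.
have gap : dot k y < dot p y.
  rewrite lt_def pm// andbT; apply/eqP => E; apply: nWk.
  have -> // : k = p by apply: uniq; split=> // s; rewrite -E; exact: pm.
have [b b0 bS] := bounded_S.
(* By [dot_le_norm] in dimension 3, heights on S change by at most 3 b d when y moves by less than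
   d, and this is a quarter of the gap. *)
pose d := (dot p y - dot k y) / (12 * b).
have d0 : 0 < d by rewrite divr_gt0 ?subr_gt0// mulr_gt0.
have nd : \forall z \near y, `|y - z| < d by exact: (nbhs_normP _ _).2 (ex_intro2 _ _ d d0 (fun _ => id)).
apply: filterS nd => z zd c [Sc cm]; apply: contrapT => nW.
have ck : dot c y <= dot k y by apply: kmax; rewrite inE.
have h1 := cm _ Sp.
have bd s : S s -> `|dot s (y - z)| <= (dot p y - dot k y) / 4.
  move=> Ss; apply: le_trans (dot_le_norm _ _) _.
  apply: le_trans (_ : 3%:R * b * d <= _).
    by rewrite ler_pM ?mulr_ge0 ?(ltW zd)// ler_wpM2l// bS.
  by rewrite le_eqVlt; apply/orP; left; apply/eqP; rewrite /d; field; rewrite gt_eqF.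
have := bd _ Sc; have := bd _ Sp; rewrite !dotBr !ler_norml => /andP[a1 a2] /andP[a3 a4].
lra.
Unshelve. all: by end_near. Qed.

End Contact.

(** * Existence of an inner point *)

Section Inner.
Variables (R : realType) (S : set 'rV[R]_3).
Hypothesis ovS : ovaloid S.
Local Notation B p := (tangent_basis S p).
Local Notation C := (support_pts S).
Local Notation I := (inner_pts S).
Local Notation contact := (contact S).
Local Notation inward := (inward S).

Let emb : embedded_surface S. Proof. by case: ovS. Qed.
Let Sne : S !=set0. Proof. by case: ovS. Qed.
Let Scompact : compact S. Proof. by case: ovS. Qed.

Lemma contact_inward1 y c : dot y y = 1 -> contact y c -> inward c (- y).
Proof.
move=> yy cy; split; last first.
  move=> q Sq; rewrite dotNr oppr_ge0 dotBl subr_le0.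
  by case: cy => _; apply.
apply/unit_normalP; split; first by rewrite dotNl dotNr opprK.
by rewrite linearN /= mulmxN (contact_tangent ovS cy) oppr0.
Qed.

Lemma contactZ (a : R) y p : 0 < a -> contact (a *: y) p <-> contact y p.
Proof.
by move=> a0; split=> -[Sp pm]; split=> // s /pm; rewrite !dotZr ler_pM2l.
Qed.

Lemma gauss_free p M : S p -> good_field S p M -> row_free ('J (M \o chart S p) 0).
Proof.
move=> Sp gM; have [fM _] := gM.
have Au := shape_unit gM; have Bf := tangent_basis_free emb Sp.
have JE := shape_operatorE emb Sp fM.
suff : row_free (- (shape_operator S M p *m B p)) by apply: etrans; congr row_free.
rewrite /row_free eqmx_opp; move: Au; rewrite -row_full_unit => Af.
by rewrite (eqmxMfull _ Af).
Qed.

(** Expand |s - a|^2 <= |p - a|^2 with y = p - a. The quadratic right-hand side gives more than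
    contact: p is the only contact point in direction y. *)
Lemma farthest_point : exists p y, [/\ S p, y != 0 &
  forall s, S s -> 2 * dot (s - p) y <= - dot (s - p) (s - p)].
Proof.
have [b b0 bS] := bounded_S ovS.
(* A point outside the bounding cube, so that p - a is not 0. *)
pose a : 'rV[R]_3 := (b + 1) *: 'e_0.
have aS : ~ S a.
  move=> /bS; apply/negP; rewrite -ltNge.
  apply: lt_le_trans (coord_le_norm a 0 0).
  by rewrite !mxE !eqxx /= mulr1 gtr0_norm ?ltrDl// addr_gt0.
have [|p Sp pmax] := @compact_EVT_max _ R (fun s : 'rV[R]_3 => dot (s - a) (s - a)) S Sne Scompact.
  apply: continuous_subspaceT => s; apply: (@cvg_sumR R _ _ (nbhs s)) => i _.
  have c : {for s, continuous (fun s : 'rV[R]_3 => (s - a) 0 i)}.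
    rewrite (_ : (fun s => _) = fun s : 'rV[R]_3 => s 0 i + - a 0 i).
      by apply: cont_add; [exact: coord_continuous|exact: cst_continuous].
    by apply/funext => z; rewrite !mxE.
  exact: cont_mul.
rewrite inE in Sp; exists p, (p - a); split=> //.
  by rewrite subr_eq0; apply/eqP => E; apply: aS; rewrite -E.
move=> s Ss; have : dot (s - a) (s - a) <= dot (p - a) (p - a) by apply: pmax; rewrite inE.
have -> : s - a = (s - p) + (p - a) by rewrite addrA subrK.
move: (s - p) (p - a) => u v; rewrite dotDl !dotDr [dot v u]dotC; lra.
Qed.

(** Let p be the farthest point, q a point of S near p, and c a contact point in direction - M q. By
    [contact_near] c is close to p too. Its normal is M c or - M c, and [field_pos] leaves only M c
    = M q. Since K is not 0 the Gauss map is an immersion, so c = q by [immersion_inj], and q has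
    the inward normal M q. *)
Lemma inner_nonempty : exists p, I p.
Proof.
have [p [y [Sp y0 far]]] := farthest_point.
have cp : contact y p.
  split=> // s /far; rewrite dotBl; have := dot_ge0 (s - p); lra.
have uniq c : contact y c -> c = p.
  move=> [Sc /(_ p Sp) h1]; have := far _ Sc.
  rewrite [dot (c - p) y]dotBl => h2; apply/eqP; rewrite -subr_eq0 -dot_eq0 eq_le dot_ge0 andbT.
  lra.
pose nu := irad y *: y; have nn : dot nu nu = 1 by exact: irad_unit.
have cnu : contact nu p by apply/contactZ => //; exact: irad_gt0.
have unu c : contact nu c -> c = p by move=> /contactZ H; apply/uniq/H; exact: irad_gt0.
have Cp : C p by split=> //; exists (- nu); exact: contact_inward1.
have [M [gM inM _]] := support_field ovS Cp; have [fM _] := gM.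
have Mp : M p = - nu by exact: (inward_unique ovS Sp inM (contact_inward1 nn cnu)).
have [V [oV V0 VC Vn]] := field_chart_C emb Sp fM.
have [d d0 inj] := immersion_inj oV V0 (VC 1%N) (gauss_free Sp gM).
have nb : \forall u \near (0 : 'rV[R]_2), ball 0 d u by exact: nbhsx_ballx.
have [W [oW Wp WP]] := near_ex_open (near_chart emb Sp nb).
have cM : {for p, continuous (fun q => - M q)}.
  have [W' [oW' Wp' MC _]] := fM.
  apply: (@continuous_rVP R 'rV[R]_3) => j.
  rewrite (_ : (fun q => _) = fun q => - M q 0 j); last by apply/funext => q; rewrite mxE.
  by apply: cont_opp; exact: Ck_continuous (MC 0%N j) Wp'.
have n1 := contact_near ovS cnu unu oW Wp.
have pull (P : 'rV[R]_3 -> Prop) : (\forall z \near nu, P z) -> \forall q \near p, P (- M q).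
  by move=> nP; apply: (cM P); rewrite /= Mp opprK.
have n2 := pull _ n1.
have n3 : \forall q \near p, W q by exact: (near_open oW Wp).
have n4 := field_pos Sp fM; have n5 := normal_field_near fM.
have [W2 [oW2 Wp2 WP2]] := near_ex_open (filterI n4 n5).
have n6 := contact_near ovS cnu unu oW2 Wp2.
have n7 := pull _ n6.
have n8 : \forall q \near p, W2 q by exact: (near_open oW2 Wp2).
exists p; split=> //.
have [W3 [oW3 Wp3 WP3]] := near_ex_open (filterI (filterI n2 n7) (filterI n3 n8)).
apply: (near_open oW3 Wp3) => q /WP3[[H2 H7] [Wq Wq2]] Sq.
have [pq unq] := WP2 _ Wq2.
have [c cc] := contact_ex ovS (- M q); have [Sc _] := cc.
have [mm _] := unq Sq.
have inc : inward c (M q).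
  by rewrite -[M q]opprK; apply: contact_inward1 => //; rewrite dotNl dotNr opprK.
have [pc unc] := WP2 _ (H7 _ cc).
have [u ub xu] := WP _ Wq Sq; have [v vb xv] := WP _ (H2 _ cc) Sc.
suff E : c = q by split=> //; exists (M q); rewrite -{1}E.
rewrite -xu -xv; congr (chart S p _); apply: inj => //=; rewrite xu xv.
have [E|E] := unit_normal_pm emb Sc (proj1 inc) (unc Sc); first by rewrite E.
by exfalso; move: pc pq; rewrite E dotNl; lra.
Qed.

End Inner.

(** * Regularity of implicitly defined maps *)

Section Implicit.
Variable R : realType.

(** Bootstrap on the formula for the Jacobian of w: if w is of class C^k, so is the inverse Jacobian
    of F taken at w, hence w is of class C^(k+1). Starting from continuity this is done for k = 0
    and k = 1. *)
Lemma implicit_C2 m n (U : set 'rV[R]_m.+1) (V : set 'rV[R]_n.+1)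
    (F : 'rV[R]_m.+1 -> 'rV[R]_m.+1) (w phi : 'rV[R]_n.+1 -> 'rV[R]_m.+1) :
  open U -> open V -> (forall j, Ck 2 U (fun u => F u 0 j)) ->
  (forall j, Ck 2 V (fun z => phi z 0 j)) ->
  (forall u, U u -> 'J F u \in unitmx) -> (forall z, V z -> U (w z)) ->
  (forall z, V z -> {for z, continuous w}) -> (forall z, V z -> F (w z) = phi z) ->
  forall j, Ck 2 V (fun z => w z 0 j).
Proof.
move=> oU oV FC phiC Ju wU wc Fw.
have dF u : U u -> differentiable F u.
  by move=> Uu; apply: diff_rV_intro => j; exact: Ck_diff (FC j) Uu.
have dphi z : V z -> differentiable phi z.
  by move=> Vz; apply: diff_rV_intro => j; exact: Ck_diff (phiC j) Vz.
have wd z : V z -> differentiable w z /\ 'J w z = 'J phi z *m invmx ('J F (w z)).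
  move=> Vz; apply: implicit_diff; [exact/dF/wU|exact/Ju/wU|exact: wc|exact: dphi|].
  exact: (near_open oV Vz).
pose JF u : 'M[R]_m.+1 := \matrix_(i, j) pd i (fun v => F v 0 j) u.
have JFE u : U u -> 'J F u = JF u.
  move=> Uu; apply/matrixP => i j; rewrite [RHS]mxE.
  exact: jacobian_coord (dF u Uu).
have EC i j : Ck 1 U (fun u => invmx (JF u) i j).
  apply: (C1_invmx i j oU) => [k l|u Uu]; last by rewrite -JFE//; exact: Ju.
  rewrite (_ : (fun u => _) = pd k (fun v => F v 0 l)); first exact: (Ck_pd k (FC l)).
  by apply/funext => u; rewrite mxE.
have pdw i j z : V z -> \sum_k pd i (fun z => phi z 0 k) z * invmx (JF (w z)) k j =
    pd i (fun z => w z 0 j) z.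
  move=> Vz; have [dw Jw] := wd z Vz.
  apply: etrans _ (jacobian_coord i j dw).
  apply: etrans _ (esym (congr1 (fun X : 'M[R]_(n.+1, m.+1) => X i j) Jw)).
  rewrite [RHS]mxE; apply: eq_bigr => k _; congr (_ * _).
    exact: esym (jacobian_coord i k (dphi z Vz)).
  by congr (invmx _ k j); apply: esym; apply: JFE; exact: wU.
have step k : (k <= 1)%N -> (forall j, Ck k V (fun z => w z 0 j)) ->
    forall j, Ck k.+1 V (fun z => w z 0 j).
  move=> k1 wk j; split=> [z Vz|i]; first by apply: diff_rV_coord; case: (wd z Vz).
  apply: (Ck_ext oV (pdw i j)); apply: (Ck_sum _ oV) => l _; apply: (Ck_mul oV).
    have := Ck_pd i (phiC l); case: k k1 {wk} => [|[|//]] _ // H; exact: CkS.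
  apply: (@Ck_comp _ _ _ k V U w (fun u => invmx (JF u) l j) oV wk wU); have := EC l j.
  by case: k k1 {wk} => [|[|//]] _ // H; exact: CkS.
have w0 j : Ck 0 V (fun z => w z 0 j).
  by move=> z Vz; apply: (@cvg_coord R _ (nbhs z) 1 m.+1 w (w z) 0 j); exact: wc.
exact: step (step 0%N _ w0).
Qed.

End Implicit.

Section InvRadius.
Variable R : realType.
Let Om : set 'rV[R]_3 := [set y | y != 0].

Lemma open_neq0 : open Om.
Proof.
have -> : Om = ~` [set 0 : 'rV[R]_3] by apply/seteqP; split => y /=; move/eqP.
apply: closed_openC; apply: (@compact_closed 'rV[R]_3); last exact: compact_set1.
exact: norm_hausdorff.
Qed.

(** The gradient of 1 / |y| is - y / |y|^3, a product of functions already known to be C^1. *)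
Lemma irad_C2 : Ck 2 Om (@irad R).
Proof.
have [i1 iE] := @irad_C1 R Om open_neq0 (fun _ => id).
split=> [y Oy|i]; first exact: Ck_diff i1 Oy.
apply: (@Ck_ext _ _ 1 Om (fun y => - (irad y * y 0 i * (irad y * irad y)))) => //.
- exact: open_neq0.
- move=> y Oy; have E := @irad_sqr R Om (fun _ => id) y Oy.
  have r0 : rad2 y != 0 by rewrite gt_eqF// (@rad2_gt0 R Om (fun _ => id)).
  have V : (rad2 y)^-1 = irad y * irad y by apply: (mulIf r0); rewrite mulVf// E.
  by rewrite iE// V; ring.
- have oO := open_neq0; apply: (Ck_opp oO); apply: (Ck_mul oO); apply: (Ck_mul oO) => //.
  exact: Ck_coord.
Qed.

Lemma dir_C2 (j : 'I_3) : Ck 2 Om (fun y => (- (irad y *: y)) 0 j).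
Proof.
have oO := open_neq0.
have C : Ck 2 Om (fun y => - (irad y * y 0 j)).
  by apply: (Ck_opp oO); apply: (Ck_mul oO); [exact: irad_C2|exact: Ck_coord].
by apply: (Ck_ext oO _ C) => y _; rewrite !mxE.
Qed.

End InvRadius.

(** * The inverse Gauss map of an ovaloid *)

Section GaussInverse.
Variables (R : realType) (S : set 'rV[R]_3).
Hypothesis ovS : ovaloid S.
Local Notation B p := (tangent_basis S p).
Local Notation C := (support_pts S).
Local Notation I := (inner_pts S).
Local Notation contact := (contact S).
Local Notation inward := (inward S).

Let emb : embedded_surface S. Proof. by case: ovS. Qed.

Definition inner_dirs : set 'rV[R]_3 := [set y | y != 0 /\ exists2 p, I p & contact y p].
Local Notation Om := inner_dirs.

(** Some contact point is chosen for every y; it is the only one when y belongs to [inner_dirs]. *)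
Definition gauss_inv y : 'rV[R]_3 := xget 0 [set p | contact y p].
Local Notation q := gauss_inv.

Lemma gauss_contact y : contact y (q y).
Proof.
rewrite /gauss_inv; case: xgetP => [p -> //|np].
by have [p cp] := contact_ex ovS y; case: (np p).
Qed.

Lemma gauss_in y : S (q y). Proof. by case: (gauss_contact y). Qed.

Lemma gauss_unique y c : Om y -> contact y c -> c = q y.
Proof.
move=> [y0 [p Ip cp]] cc.
by rewrite (contact_unique ovS Ip y0 cp cc) (contact_unique ovS Ip y0 cp (gauss_contact y)).
Qed.

Lemma gauss_inner y : Om y -> I (q y).
Proof. by move=> Oy; have [_ [p Ip cp]] := Oy; rewrite -(gauss_unique Oy cp). Qed.

(** Continuity of the inverse Gauss map, stated for whatever contact point is chosen at directions
    close to y. *)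
Lemma gauss_near y (P : 'rV[R]_3 -> Prop) : Om y -> (\forall p \near q y, P p) ->
  \forall z \near y, P (q z).
Proof.
move=> Oy /near_ex_open[W [oW Wq WP]].
have := contact_near ovS (gauss_contact y) (fun c => gauss_unique Oy) oW Wq.
by apply: filterS => z H; apply: WP; apply: H; exact: gauss_contact.
Qed.

Lemma open_inner_dirs : open Om.
Proof.
rewrite openE => y Oy; have [y0 _] := Oy.
have n1 : \forall z \near y, z != 0 by exact: (near_open (@open_neq0 R) y0).
have n2 := gauss_near Oy (inner_open (gauss_inner Oy)).
apply: filterS2 n1 n2 => z z0 Iz; split=> //; exists (q z); last exact: gauss_contact.
by apply: Iz; exact: gauss_in.
Qed.

Lemma inner_dirs_neq0 y : Om y -> y != 0. Proof. by case. Qed.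

Lemma gauss_normal y : Om y -> inward_normal S (q y) = - (irad y *: y).
Proof.
move=> Oy; apply: (inward_normal_eq ovS (gauss_in y)).
exact: (contact_inward ovS (inner_dirs_neq0 Oy) (gauss_contact y)).
Qed.

Lemma gauss_field y : Om y -> exists M, [/\ good_field S (q y) M,
  \forall p \near q y, C p -> inward_normal S p = M p &
  \forall z \near y, M (q z) = - (irad z *: z)].
Proof.
move=> Oy; have [M [gM inM MN]] := support_field ovS (inner_support (gauss_inner Oy)).
exists M; split=> //; apply: filterS2 (gauss_near Oy MN) (near_open open_inner_dirs Oy (fun _ => id)).
move=> z Mz Oz; rewrite -gauss_normal// -Mz//.
exact: inner_support (gauss_inner Oz).
Qed.

(** In a chart x at q y, the coordinates w z of q z solve M (x (w z)) = - z / |z|. [implicit_C2]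
    applies because the Jacobian of the left-hand side in tangent coordinates is minus the shape
    operator, whose determinant K is positive. *)
Lemma gauss_inv_C2 j : Ck 2 Om (fun y => q y 0 j).
Proof.
apply: Ck_local => y Oy; have [M [gM MN Mq]] := gauss_field Oy; have [fM K0] := gM.
set p := q y in gM MN Mq fM K0; have Sp : S p by exact: gauss_in.
have [V1 [oV1 V10 MC Mn]] := field_chart_C emb Sp fM.
have [U [inv [[oU U0 x0 Bf] [xC xS invx cinv]]]] := chart_spec emb Sp.
set x := chart S p in MC Mn x0 xC xS invx cinv.
(* The equation has three components for two unknowns. Multiplication by P keeps the two tangent
   coordinates at p, which determine u because the resulting Jacobian is invertible. *)
pose P := pinvmx (B p); pose F u : 'rV[R]_2 := M (x u) *m P.
have FC k i : Ck k V1 (fun u => F u 0 i).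
  rewrite (_ : (fun u => _) = fun u => \sum_l M (x u) 0 l * P l i).
    by apply: (Ck_sum _ oV1) => l _; apply: (Ck_mul oV1); [exact: MC|exact: Ck_cst].
  by apply/funext => u; rewrite mxE.
have dF u : V1 u -> differentiable F u.
  by move=> Vu; apply: diff_rV_intro => i; exact: Ck_diff (FC 1%N i) Vu.
have dMx u : V1 u -> differentiable (M \o x) u.
  by move=> Vu; apply: diff_rV_intro => i; exact: Ck_diff (MC 1%N i) Vu.
have JF0 : 'J F 0 = - shape_operator S M p.
  have -> : 'J F 0 = 'J (M \o x) 0 *m P.
    apply/matrixP => i l; apply: etrans (jacobian_coord i l (dF 0 V10)) _.
    rewrite [RHS]mxE (_ : (fun u => _) = fun u => \sum_l' M (x u) 0 l' * P l' l); last first.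
      by apply/funext => u; rewrite mxE.
    have dl l' : differentiable (fun u => M (x u) 0 l') 0 by exact: Ck_diff (MC 1%N l') V10.
    have dc l' : differentiable (fun=> P l' l : R) (0 : 'rV[R]_2) by exact: differentiable_cst.
    apply: etrans (pd_sum i _ (fun l' => differentiableM (dl l') (dc l'))) _.
    apply: eq_bigr => l' _; apply: etrans (pdM i (dl l') (dc l')) _.
    rewrite pd_cst mulr0 add0r mulrC; congr (_ * _).
    exact: esym (jacobian_coord i l' (dMx 0 V10)).
  by rewrite (shape_operatorE emb Sp fM) mulNmx -mulmxA mulmxVp// mulmx1.
pose JF u : 'M[R]_2 := \matrix_(i, l) pd i (fun v => F v 0 l) u.
have JFE u : V1 u -> 'J F u = JF u.
  move=> Vu; apply/matrixP => i l; rewrite [RHS]mxE.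
  exact: jacobian_coord (dF u Vu).
have near_unit : \forall u \near (0 : 'rV[R]_2), 'J F u \in unitmx.
  have dC : Ck 0 V1 (fun u => \det (JF u)).
    apply: (Ck_det oV1) => i l.
    rewrite (_ : (fun u => _) = pd i (fun v => F v 0 l)); first exact: (Ck_pd i (FC 1%N l)).
    by apply/funext => u; rewrite mxE.
  have d0 : \det (JF 0) != 0.
    rewrite -JFE// JF0 -scaleN1r detZ sqrrN expr1n mul1r.
    by rewrite gt_eqF//.
  have c0 : {for 0, continuous (fun u => \det (JF u))} by exact: dC.
  have e0 : 0 < `|\det (JF 0)| / 2 by rewrite divr_gt0// normr_gt0.
  apply: filterS2 (cont_near_le c0 e0) (near_open oV1 V10 (fun _ => id)) => u du Vu.
  rewrite JFE// unitmxE unitfE; apply/eqP => z; move: du; rewrite z subr0.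
  by apply/negP; rewrite -ltNge ltr_pdivrMr// ltr_pMr ?normr_gt0// ltr1n.
have n1 : \forall u \near (0 : 'rV[R]_2), U u by exact: (near_open oU U0).
have n2 : \forall u \near (0 : 'rV[R]_2), V1 u by exact: (near_open oV1 V10).
have [U2 [oU2 U20 U2P]] := near_ex_open (filterI (filterI n1 n2) near_unit).
pose w z := inv (q z).
have near_w : \forall z \near y, U2 (w z) /\ x (w z) = q z.
  have := cinv 0 U2 U0 oU2 U20; rewrite x0 => /(gauss_near Oy).
  by apply: filterS => z /(_ (gauss_in z))[].
have [V [oV Vy VP]] := near_ex_open
  (filterI (filterI near_w Mq) (near_open open_inner_dirs Oy (fun _ => id))).
have wC := @implicit_C2 R 1 2 U2 V F w (fun z => (- (irad z *: z)) *m P) oU2 oV.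
exists V => //.
have {}wC i : Ck 2 V (fun z => w z 0 i).
  apply: wC => [l|l|u /U2P[]//|z /VP[[[]]]//|z Vz|z Vz].
  - by apply: Ck_subset (FC 2%N l) => u /U2P[[]].
  - rewrite (_ : (fun z => _) = fun z => \sum_l' (- (irad z *: z)) 0 l' * P l' l); last first.
      by apply/funext => z; rewrite mxE.
    apply: (Ck_sum _ oV) => l' _; apply: (Ck_mul oV); last exact: Ck_cst.
    by apply: Ck_subset (@dir_C2 R l') => z /VP[_ /inner_dirs_neq0].
  (* Continuity of w at z combines that of the Gauss inverse with that of the inverse chart at w z,
     a point other than the centre in general. *)
  - have [[[Uw xw] _] Oz] := VP _ Vz; have [[UUw _] _] := U2P _ Uw.
    move=> N; rewrite nbhsE => -[N' [oN' N'w] N'N].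
    have := cinv (w z) N' UUw oN' N'w; rewrite xw => /(gauss_near Oz).
    by apply: filterS => z' /(_ (gauss_in z'))[/N'N].
  - by have [[[_ xw] Mz] _] := VP _ Vz; rewrite /F xw Mz.
have xwC : Ck 2 V (fun z => x (w z) 0 j).
  apply: (@Ck_comp _ _ _ 2 V U w (fun u => x u 0 j)) => // z /VP[[[/U2P[[]]]]]//.
by apply: (Ck_ext oV _ xwC) => z /VP[[[_ ->]]].
Qed.

Lemma gauss_max y z : Om y -> Om z -> dot (q z) y <= dot (q y) y.
Proof. by move=> _ _; have [_] := gauss_contact y; apply; exact: gauss_in. Qed.

End GaussInverse.

(** * Curvatures in terms of the Hessian of the support function *)

Section Curvatures.
Variables (R : realType) (S : set 'rV[R]_3).
Hypothesis ovS : ovaloid S.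
Local Notation B p := (tangent_basis S p).
Local Notation C := (support_pts S).
Local Notation I := (inner_pts S).
Local Notation contact := (contact S).
Local Notation inward := (inward S).
Local Notation Om := (inner_dirs S).
Local Notation q := (gauss_inv S).
Local Notation N := (inward_normal S).
Local Notation hq y := (fun i j => hess q i j y).

Let emb : embedded_surface S. Proof. by case: ovS. Qed.
Let oO := open_inner_dirs ovS.
Let On := @inner_dirs_neq0 R S.
Let q2 := gauss_inv_C2 ovS.
Let qm := gauss_max ovS.

Lemma gauss_diff y : Om y -> differentiable q y.
Proof. by move=> Oy; apply: diff_rV_intro => j; exact: Ck_diff (q2 j) Oy. Qed.

Lemma jacobian_gauss y : Om y -> 'J q y = \matrix_(i, j) hess q i j y.
Proof.
move=> Oy; apply/matrixP => i j; rewrite [RHS]mxE.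
exact: jacobian_coord (gauss_diff Oy).
Qed.

Lemma jacobian_dir (y : 'rV[R]_3) : y != 0 ->
  'J (fun z : 'rV[R]_3 => - (irad z *: z)) y = - (irad y *: (1%:M - (irad y *: y)^T *m (irad y *: y))).
Proof.
move=> y0; have dC (j : 'I_3) := @dir_C2 R j.
have dd : differentiable (fun z : 'rV[R]_3 => - (irad z *: z)) y.
  by apply: diff_rV_intro => j; exact: Ck_diff (dC j) y0.
apply/matrixP => i j; apply: etrans (jacobian_coord i j dd) _.
have [i1 iE] := @irad_C1 R _ (@open_neq0 R) (fun _ => id).
have di : differentiable (@irad R) y by exact: Ck_diff i1 y0.
have dj : differentiable (fun z : 'rV[R]_3 => z 0 j : R) y by exact: coord_diff.
rewrite (_ : (fun z => _) = fun z => - (irad z * z 0 j)); last by apply/funext => z; rewrite !mxE.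
apply: etrans (pdN i (differentiableM di dj)) _; rewrite (pdM i di dj) pd_coord iE//.
have E := @irad_sqr R [set y | y != 0] (fun _ => id) y y0.
have r0 : rad2 y != 0 by rewrite gt_eqF// (@rad2_gt0 R [set y | y != 0] (fun _ => id)).
have V : (rad2 y)^-1 = irad y * irad y by apply: (mulIf r0); rewrite mulVf// E.
by rewrite V !mxE big_ord1 !mxE; ring.
Qed.

Lemma normal_dot0 (n : 'rV[R]_3) m (X : 'M[R]_(m, 3)) : X *m n^T = 0 -> X *m (n^T *m n) = 0.
Proof. by move=> X0; rewrite mulmxA X0 mul0mx. Qed.

Lemma field_jacobian p M : S p -> normal_field S p M ->
  B p *m 'J M p = - (shape_operator S M p *m B p).
Proof.
move=> Sp fM; rewrite -(shape_operatorE emb Sp fM).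
have [W [oW Wp MC _]] := fM.
have dM : differentiable M (chart S p 0).
  by rewrite chart0//; apply: diff_rV_intro => j; exact: Ck_diff (MC 1%N j) Wp.
have := jacobian_comp (chart_diff emb Sp) dM; rewrite chart0//.
Qed.

Lemma half_solve (e a i t : R) : 0 < e -> e * a = i * t -> 2^-1 * a = t / (2 * e) * i.
Proof.
move=> e1 E; have -> : a = i * t / e by rewrite -E mulrC mulKf// gt_eqF.
by field; rewrite gt_eqF.
Qed.

Lemma div_solve (e a i : R) : 0 < e -> e * a = i -> a = i / e.
Proof. by move=> e1 <-; rewrite mulrC mulKf// gt_eqF. Qed.

(** Differentiating M (q z) = - z / |z| at y expresses Q dM as - 1 / |y| times the projection
    orthogonal to y. In the tangent basis this reads X A = 1 / |y|, where X is the matrix of the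
    Hessian, so the shape operator is inverse to the Hessian up to the factor 1 / |y|. *)
Lemma gauss_relation y : Om y -> [/\ 0 < e2 (hq y),
  mean_curvature S N (q y) = tr3 (hq y) / (2 * e2 (hq y)) * irad y &
  gaussian_curvature S N (q y) = irad y ^+ 2 / e2 (hq y)].
Proof.
move=> Oy; have [M [gM MN Mq]] := gauss_field ovS Oy; have [fM K0] := gM.
have y0 := On Oy; have Sp := gauss_in ovS y.
set p := q y in gM MN fM K0 Sp *.
have shE : shape_operator S N p = shape_operator S M p.
  apply: (shape_operator_near emb Sp fM).
  have [_ nC] := gauss_inner ovS Oy.
  by apply: filterS2 nC MN => z Cz Mz Sz; apply/esym/Mz/Cz.
rewrite /mean_curvature /gaussian_curvature shE; rewrite /gaussian_curvature in K0.
set A := shape_operator S M p in K0 *.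
pose n := irad y *: y; have nn : dot n n = 1 by exact: irad_unit.
have Bn : B p *m n^T = 0.
  by rewrite linearZ /= -scalemxAr (contact_tangent ovS (gauss_contact ovS y)) scaler0.
have Bf := tangent_basis_free emb Sp.
pose Q : 'M[R]_3 := \matrix_(i, j) hess q i j y.
pose P := pinvmx (B p); pose X := B p *m Q *m P.
have BP : B p *m P = 1%:M by rewrite mulmxVp.
have Qn : Q *m n^T = 0.
  apply/matrixP => i k; rewrite ord1 !mxE.
  have H := hess_mulr oO q2 qm i Oy.
  apply: etrans (_ : irad y * \sum_j hess q i j y * y 0 j = _); last by rewrite H mulr0.
  rewrite mulr_sumr; apply: eq_bigr => j _; rewrite [X in X * _]mxE [X in _ * X]mxE [X in _ * X]mxE.
  exact: mulrCA.
have QB := tangent_sub Bf Bn nn Qn.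
have QPB : Q *m P *m B p = Q by exact: mulmxKpV.
have QD : Q *m 'J M p = - (irad y *: (1%:M - n^T *m n)).
  have [W [oW Wp MC _]] := fM; have dq := gauss_diff Oy.
  have dM : differentiable M (q y) by apply: diff_rV_intro => j; exact: Ck_diff (MC 1%N j) Wp.
  have dMq : differentiable (M \o q) y by exact: differentiable_comp.
  have JE := jacobian_comp dq dM.
  have NE : 'J (fun z : 'rV[R]_3 => - (irad z *: z)) y = 'J (M \o q) y.
    exact: jacobian_near_eq Mq dMq.
  apply: etrans (congr1 (fun Z => Z *m 'J M p) (esym (jacobian_gauss Oy))) _.
  apply: etrans (esym JE) _; apply: etrans (esym NE) _; exact: jacobian_dir.
have XAB : X *m A *m B p = irad y *: B p.
  have AE : A *m B p = - (B p *m 'J M p) by exact: canRL opprK (esym (field_jacobian Sp fM)).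
  have E : X *m B p *m 'J M p = B p *m (Q *m 'J M p).
    by rewrite /X -(mulmxA _ P) -(mulmxA _ Q) (mulmxA Q) QPB mulmxA.
  rewrite -mulmxA AE mulmxN mulmxA E QD mulmxN opprK -scalemxAr mulmxBr mulmx1.
  have BN := normal_dot0 Bn; by rewrite BN subr0.
have XA : X *m A = (irad y)%:M.
  by rewrite -[LHS]mulmx1 -BP mulmxA XAB -scalemxAl BP scalemx1.
have [dXA tXA] := scalar_mul2 XA.
have trX : \tr X = tr3 (hq y).
  rewrite /X -mulmxA mxtrace_mulC QPB /mxtrace.
  by apply: eq_bigr => i _; rewrite mxE.
have trXX : \tr (X *m X) = sq3 (hq y).
  have -> : X *m X = B p *m (Q *m Q *m P).
    apply: etrans (_ : B p *m ((Q *m P *m B p) *m Q *m P) = _); last by rewrite QPB.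
    by rewrite /X !mulmxA.
  rewrite mxtrace_mulC -(mulmxA Q Q P) -(mulmxA Q) QPB /mxtrace /sq3; apply: eq_bigr => i _.
  rewrite mxE; apply: eq_bigr => j _.
  by rewrite !mxE (hess_sym oO q2 qm j i Oy).
have detX : \det X = e2 (hq y) by rewrite det2_tr trX trXX.
have i0 := irad_gt0 y.
(* The sign of det X is that of K, as det X times K is a positive square. *)
have e0 : 0 < e2 (hq y).
  by rewrite -detX -(pmulr_lgt0 _ K0) dXA exprn_gt0.
rewrite detX trX in tXA; rewrite detX in dXA.
by split; [exact: e0|exact: half_solve e0 tXA|exact: div_solve e0 dXA].
Qed.

Lemma gauss_E2_gt0 y : Om y -> 0 < e2 (hq y).
Proof. by move=> /gauss_relation[]. Qed.

Lemma support_gauss y : Om y -> support S N (q y) = supp q y * irad y.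
Proof.
by move=> Oy; rewrite /support gauss_normal// opprK dotZr mulrC.
Qed.

Let E0 := gauss_E2_gt0.

(** Both H and sqrt K carry one factor 1 / |y|; the exponents sigma and 1 - sigma add up to 1, so
    the factor comes out once. *)
Lemma curvature_arg sigma y : Om y ->
  mean_curvature S N (q y) `^ sigma * Num.sqrt (gaussian_curvature S N (q y)) `^ (1 - sigma) =
  psi q sigma y * irad y.
Proof.
move=> Oy; have [e0 -> ->] := gauss_relation Oy.
rewrite -(expR_lnA oO q2 qm E0 Oy) -(expR_lnB E0 Oy).
have -> : irad y ^+ 2 * (expR (lnB q y) * expR (lnB q y)) = (expR (lnB q y) * irad y) ^+ 2 by ring.
rewrite sqrtr_sqr gtr0_norm ?mulr_gt0 ?expR_gt0//.
rewrite /psi /irad -!expRD -!expRM -!expRD; congr expR; ring.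
Qed.

Lemma arg_le_mean sigma y : sigma <= 1 -> Om y ->
  psi q sigma y * irad y <= mean_curvature S N (q y).
Proof.
move=> s1 Oy; have [e0 -> _] := gauss_relation Oy.
by rewrite ler_pM2r ?irad_gt0// (psi_le oO On q2 qm E0 s1 Oy).
Qed.

(** The charts at different points are chosen independently, so their tangent bases need not vary
    continuously. The trace is therefore rewritten without a basis, as minus the trace of the
    ambient Jacobian of M times the projection orthogonal to M z. *)
Lemma field_trace_bounded p M : normal_field S p M ->
  exists b : R, \forall z \near p, S z -> `|\tr (shape_operator S M z)| <= b.
Proof.
move=> fM; have [W [oW Wp MC _]] := fM.
pose D (ij : 'I_3 * 'I_3) := pd ij.1 (fun z => M z 0 ij.2).
(* Near p the derivatives of M are within 1 of their values at p, and the entries of the projection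
   are at most 2 in absolute value. *)
exists (\sum_i \sum_j (`|D (i, j) p| + 1) * 2).
have nD : \forall z \near p, forall ij, `|D ij p - D ij z| <= 1.
  apply: (@filter_forall _ ('I_3 * 'I_3)%type (fun ij z => is_true (`|D ij p - D ij z| <= 1)) (nbhs p)).
  move=> ij; have c : {for p, continuous (D ij)} by apply: Ck_continuous Wp; exact: (Ck_pd ij.1 (MC 1%N ij.2)).
  exact: (cont_near_le c ltr01).
have nW : \forall z \near p, W z by exact: (near_open oW Wp).
apply: filterS3 nD nW (normal_field_move fM) => z zD Wz fMz Sz.
have [nn Bn] := (unit_normalP _ _ _).1 (normal_field_unit Sz fMz).
have Bf := tangent_basis_free emb Sz.
set n := M z in nn Bn; pose Pi : 'M[R]_3 := 1%:M - n^T *m n.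
pose P := pinvmx (B z).
have BP : B z *m P = 1%:M by rewrite mulmxVp.
have BPi : B z *m Pi = B z by rewrite mulmxBr mulmx1 (normal_dot0 Bn) subr0.
have PiP : Pi *m P *m B z = Pi.
  have Pin : Pi *m n^T = 0.
    rewrite mulmxBl mul1mx -mulmxA; have -> : n *m n^T = 1%:M.
      by apply/matrixP => i k; rewrite !ord1 -dot_mulmx nn !mxE.
    by rewrite mulmx1 subrr.
  have PiB := tangent_sub Bf Bn nn Pin; exact: mulmxKpV.
have -> : \tr (shape_operator S M z) = - \tr ('J M z *m Pi).
  have -> : shape_operator S M z = - (B z *m 'J M z *m (Pi *m P)).
    rewrite (field_jacobian Sz fMz) mulNmx opprK -mulmxA (mulmxA (B z)) BPi BP.
    by rewrite mulmx1.
  by rewrite raddfN /= mxtrace_mulC mulmxA PiP mxtrace_mulC.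
rewrite normrN /mxtrace; apply: le_trans (ler_norm_sum _ _ _) _; apply: ler_sum => i _.
rewrite mxE; apply: le_trans (ler_norm_sum _ _ _) _; apply: ler_sum => j _.
rewrite normrM; apply: ler_pM => //.
  have dM : differentiable M z by apply: diff_rV_intro => k; exact: Ck_diff (MC 1%N k) Wz.
  have -> : `|'J M z i j| = `|D (i, j) z|.
    by congr (`|_|); exact: jacobian_coord dM.
  rewrite -[D (i, j) z](subrK (D (i, j) p)) addrC.
  by apply: le_trans (ler_normD _ _) _; rewrite lerD// distrC zD.
have n1 k : `|n 0 k| <= 1.
  rewrite -(@ler_pXn2r _ 2)// ?nnegrE// expr1n real_normK ?num_real// -nn /dot (bigD1 k)//= -expr2.
  by rewrite lerDl sumr_ge0// => l _; rewrite -expr2 sqr_ge0.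
rewrite !mxE big_ord1 !mxE; apply: le_trans (ler_normB _ _) _.
rewrite (_ : 2 = 1 + 1 :> R)//; apply: lerD.
  by rewrite normr_nat; case: eqP.
by rewrite normrM mulr_ile1.
Qed.

End Curvatures.

(* 'd g u is then the default linear map, which is 0. *)
Lemma jacobian_not_diff (R : realType) m n (g : 'rV[R]_m.+1 -> 'rV[R]_n.+1) u :
  ~ differentiable g u -> 'J g u = 0.
Proof.
move=> nd; have d0 : 'd g u = point.
  rewrite /diff /get; apply: xgetPN => h [hc hd]; apply: nd; apply/diffP.
  by rewrite /diff; case: xgetP => [k -> []//|/(_ h)]; case.
by apply/matrixP => i j; rewrite !mxE /= d0 /point /= ?mxE.
Qed.

(** A power of 0 is 0 for every nonzero exponent, negative ones included, and sigma and 1 - sigma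
    are not both 0. *)
Lemma powR_weights0 (R : realType) (sigma : R) : 0 `^ sigma * Num.sqrt 0 `^ (1 - sigma) = 0 :> R.
Proof.
have [->|s0] := eqVneq sigma 0; last by rewrite powR0// mul0r.
by rewrite sqrtr0 [X in _ * X]powR0 ?mulr0// subr0 oner_neq0.
Qed.

(** * All points are inner, and S is a sphere *)

Section Sphere.
Variables (R : realType) (f : R -> R) (sigma : R) (S : set 'rV[R]_3).
Hypothesis f_gt0 : forall s : R, 0 < s -> 0 < f s.
Hypothesis f_decr : forall s t : R, 0 < s -> s < t -> f t <= f s.
Hypotheses (sigma_ge : -1 <= sigma) (sigma_le : sigma <= 1).
Hypothesis ovS : ovaloid S.
Local Notation B p := (tangent_basis S p).
Local Notation C := (support_pts S).
Local Notation I := (inner_pts S).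
Local Notation contact := (contact S).
Local Notation inward := (inward S).
Local Notation Om := (inner_dirs S).
Local Notation q := (gauss_inv S).
Local Notation N := (inward_normal S).
Hypothesis rhoE : forall p, S p -> support S N p =
  f (mean_curvature S N p `^ sigma * Num.sqrt (gaussian_curvature S N p) `^ (1 - sigma)).

Let emb : embedded_surface S. Proof. by case: ovS. Qed.
Let oO := open_inner_dirs ovS.
Let On := @inner_dirs_neq0 R S.
Let q2 := gauss_inv_C2 ovS.
Let qm := gauss_max ovS.
Let E0 := gauss_E2_gt0 ovS.

Lemma rel_gauss y : Om y -> supp q y * irad y = f (psi q sigma y * irad y).
Proof.
move=> Oy; rewrite -(support_gauss ovS Oy) -(curvature_arg ovS sigma Oy).
exact: rhoE (gauss_in ovS y).
Qed.

Lemma inner_param p : I p -> Om (- N p) /\ q (- N p) = p.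
Proof.
move=> Ip; have [Sp _] := Ip; have inN := inward_normalP (inner_support Ip).
have cN := inward_contact Sp inN.
have ON : Om (- N p) by split; [rewrite oppr_eq0 (inward_neq0 inN)|exists p].
by split=> //; rewrite -(gauss_unique ovS ON cN).
Qed.

(** A vanishing derivative, genuine or by default, gives H = K = 0 and feeds f the value 0, where
    neither positivity nor monotonicity of f says anything. *)
Lemma support_flat p : S p -> 'J (N \o chart S p) 0 = 0 -> support S N p = f 0.
Proof.
move=> Sp J0; rewrite rhoE// /mean_curvature /gaussian_curvature /shape_operator J0.
by rewrite mul0mx oppr0 mxtrace0 mulr0 det0 powR_weights0.
Qed.

(** Near such a point the inward normal takes its default value 0 all over S, so its derivative is a
    genuine 0, and the support is 0 as well. *)
Lemma not_support_f0 p : S p -> ~ C p -> f 0 = 0.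
Proof.
move=> Sp nC; have nC' := support_pts_closed ovS Sp nC.
rewrite -(support_flat Sp); first by rewrite /support (inward_normal0 Sp nC) oppr0 dotC dot0l.
have d0 : differentiable (fun=> 0 : 'rV[R]_3) (0 : 'rV[R]_2) by exact: differentiable_cst.
apply: etrans (@jacobian_cst R _ _ 0 0).
apply: jacobian_near_eq d0.
apply: filterS2 (chart_near emb Sp nC') (chart_in emb Sp) => u nCu Su.
exact/esym/(inward_normal0 Su (nCu Su)).
Qed.

(* If the inward normal were differentiable at p, it would be continuous, hence
   nonzero near p, and p would be an inner point. *)
Lemma not_inner_flat p : C p -> ~ I p -> 'J (N \o chart S p) 0 = 0.
Proof.
move=> Cp nI; have [Sp _] := Cp; apply: jacobian_not_diff => d; apply: nI; split=> //.
have c := differentiable_continuous d.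
have N0 : N p != 0 by exact: inward_neq0 (inward_normalP Cp).
have : \forall u \near (0 : 'rV[R]_2), N (chart S p u) != 0.
  have N0' : (N \o chart S p) 0 != 0 by rewrite /= chart0.
  exact: c (near_open (@open_neq0 R) N0' (fun _ => id)).
move=> /(near_chart emb Sp); apply: filterS => z + Sz => /(_ Sz)[u Nu zE].
rewrite -zE in Sz *; by apply: contrapT => nC; move: Nu; rewrite (inward_normal0 Sz nC) eqxx.
Qed.

(** The bound by H is what the limit argument needs: the argument of f itself has no other control
    near a point that is not inner. *)
Lemma support_inner p : I p -> exists2 s, 0 < s <= mean_curvature S N p & support S N p = f s.
Proof.
move=> /inner_param[]; move: (- N p) => y Oy <-; exists (psi q sigma y * irad y).
  apply/andP; split; last exact: (arg_le_mean ovS sigma_le Oy).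
  by apply: mulr_gt0; [exact: expR_gt0|exact: irad_gt0].
exact: etrans (support_gauss ovS Oy) (rel_gauss Oy).
Qed.

(* At a limit p of inner points that is not inner, the junk curvatures H = K = 0 give
   support p = f 0, and f 0 = 0 because there are points without inward normal (where
   support is 0).  But H is bounded by some b near p, so support >= f b > 0 at the
   inner points near p. *)
Lemma inner_closed p : S p -> ~ I p -> \forall z \near p, ~ I z.
Proof.
move=> Sp nI; apply: contrapT => H.
have acc (P : 'rV[R]_3 -> Prop) : (\forall z \near p, P z) -> exists2 z, I z & P z.
  move=> nP; apply: contrapT => nE; apply: H; apply: filterS nP => z Pz Iz.
  by apply: nE; exists z.
have Cp : C p.
  apply: contrapT => /(support_pts_closed ovS Sp)/acc[z Iz]; have [Sz _] := Iz.
  by move=> /(_ Sz); apply; exact: inner_support.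
have f00 : f 0 = 0.
  apply: contrapT => f0; apply: nI; split=> //; near=> z => Sz.
  by apply: contrapT => nC; apply: f0; exact: not_support_f0 Sz nC.
have sp0 := support_flat Sp (not_inner_flat Cp nI).
have [M [[fM _] inM MN]] := support_field ovS Cp.
have d0 : dot (0 - p) (M p) = 0.
  by rewrite -(nbhs_singleton MN Cp) sub0r dotNl -dotNr -f00 -sp0.
have [b nb] := field_trace_bounded ovS fM.
(* Positive, so that f b0 > 0, and strictly above H = tr / 2 at the inner points near p. *)
pose b0 := `|b| + 1; have b0_gt0 : 0 < b0 by rewrite ltr_wpDl.
have fb := f_gt0 b0_gt0.
have nd := cont_near_le (dot_field_cont (s := 0) fM) (divr_gt0 fb (ltr0n R 2)).
have [V [oV Vp VMN]] := near_ex_open MN.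
have [z Iz [[[nbz ndz] fMz] Vz]] := acc _ (filterI (filterI (filterI nb nd)
  (normal_field_move fM)) (near_open oV Vp (fun _ => id))).
have [Sz nCz] := Iz; have Cz := inner_support Iz.
have shE : shape_operator S N z = shape_operator S M z.
  apply: (shape_operator_near emb Sz fMz).
  apply: filterS2 nCz (near_open oV Vz (fun _ => id)) => w Cw Vw Sw.
  exact/esym/(VMN _ Vw)/Cw.
have [s /andP[s0 sH] sE] := support_inner Iz.
have sb : s < b0.
  apply: le_lt_trans sH _; rewrite /mean_curvature shE /b0.
  have h1 := nbz Sz; have h2 := ler_norm (\tr (shape_operator S M z)); have h3 := ler_norm b.
  have h4 := normr_ge0 b.
  lra.
have fs := f_decr s0 sb.
have sz : dot (0 - z) (M z) = f s.
  apply: etrans sE; rewrite sub0r dotNl -dotNr.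
  exact: (congr1 (fun n => dot z (- n)) (esym (VMN _ Vz Cz))).
have E := etrans (congr2 (fun a b : R => a - b) d0 sz) (sub0r (f s)).
have h : `|- f s| <= f b0 / 2 by apply: le_trans ndz; rewrite -[X in `|X| <= _]E.
have h' := le_trans (ler_norm (f s)) (eq_ind _ (fun x => x <= f b0 / 2) h _ (normrN _)).
lra.
Unshelve. all: by end_near.
Qed.

(** Connectedness of S: the inner points form a nonempty set, and both this set and its complement
    in S are relatively open. *)
Lemma inner_all p : S p -> I p.
Proof.
have [_ _ _ Scon _] := ovS.
suff E : I = S by move=> Sp; have := congr1 (fun Z : set _ => Z p) E => /= ->.
apply: Scon; first by have [p0 Ip] := inner_nonempty ovS; exists p0.
- exists (\bigcup_(V in [set V : set 'rV[R]_3 | open V /\ V `&` S `<=` I]) V).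
    by apply: bigcup_open => V [].
  apply/seteqP; split=> z; last by move=> [Sz [V [_ VI] Vz]]; exact: VI.
  move=> Iz; split; first by case: Iz.
  have [V [oV Vz VI]] := near_ex_open (inner_open Iz).
  by exists V => //; split=> // w [Vw Sw]; exact: VI.
exists (~` \bigcup_(V in [set V : set 'rV[R]_3 | open V /\ V `&` S `<=` ~` I]) V).
  by apply: open_closedC; apply: bigcup_open => V [].
apply/seteqP; split=> z.
  move=> Iz; split; first by case: Iz.
  by move=> [V [_ VI] Vz]; case: (VI z) => //; split=> //; case: Iz.
move=> [Sz nz]; apply: contrapT => nI; apply: nz.
have [V [oV Vz VI]] := near_ex_open (inner_closed Sz nI).
by exists V => //; split=> // w [Vw _]; exact: VI.
Qed.

Lemma inner_dirs_full y : y != 0 -> Om y.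
Proof.
move=> y0; split=> //; have [p cp] := contact_ex ovS y; exists p => //.
by apply: inner_all; case: cp.
Qed.

Lemma ovaloid_sphere : is_sphere S.
Proof.
have [c [r [r0 qE]]] := gauss_inverse_sphere oO On q2 qm E0 sigma_ge sigma_le f_gt0 f_decr
  rel_gauss inner_dirs_full.
exists c, r; split=> //; apply/seteqP; split=> s /=.
  move=> /inner_all Is; have [Oy <-] := inner_param Is; have y0 := On Oy.
  rewrite (qE _ Oy) [c + _]addrC addrK -scalerA dotZl dotZr (irad_unit y0) mulr1.
  by rewrite expr2.
move=> sE; pose y := s - c.
have y0 : y != 0 by rewrite -dot_eq0 sE sqrf_eq0 gt_eqF.
have Oy := inner_dirs_full y0.
(* As s is at distance r from c, the number r / |y| has square 1; being positive it is 1, and then q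
   y = c + y = s. *)
have := irad_unit y0; rewrite dotZl dotZr sE mulrA -expr2 -exprMn => /eqP.
rewrite sqrf_eq1 => /orP[]/eqP E.
  have <- : q y = s by rewrite (qE _ Oy) mulrC E scale1r addrC subrK.
  exact: gauss_in.
by have := mulr_gt0 (irad_gt0 y) r0; rewrite E; lra.
Qed.

End Sphere.

Theorem theorem10 (R : realType) (f : R -> R)
  (f_gt0 : forall s : R, 0 < s -> 0 < f s)
  (f_decr : forall s t : R, 0 < s -> s < t -> f t <= f s)
  (sigma : R) (sigma_ge : -1 <= sigma) (sigma_le : sigma <= 1)
  (S : set 'rV[R]_3) (ovS : ovaloid S)
  (rhoE : forall p, S p ->
     let N := inward_normal S in
     let H := mean_curvature S N p in
     let K := gaussian_curvature S N p in
     support S N p = f (H `^ sigma * Num.sqrt K `^ (1 - sigma))) :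
  is_sphere S.
Proof. exact: ovaloid_sphere f_gt0 f_decr sigma_ge sigma_le ovS rhoE. Qed.
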